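(* Let $X$ and $Y$ be metrizable spaces and $f\colon X\to Y$ a perfect map. (a) If $M$ is a Krasinkiewicz space which is a complete $ANR$ (absolute neighborhood retract for metrizable spaces, admitting a compatible complete metric) and $Y$ is strongly countable-dimensional, then the function space $C(X,M)$, endowed with the source limitation topology, contains a dense $G_\delta$-subset consisting of maps $g$ such that for every $y\in Y$ the restriction $g|f^{-1}(y)\colon f^{-1}(y)\to M$ is a Krasinkiewicz map. (b) If $M$ is a Krasinkiewicz space homeomorphic to a closed convex subset of a Banach space and $Y$ is a $C$-space, then the same conclusion holds.
   Context: All spaces are metrizable and all maps continuous. A continuum is a nonempty compact connected metrizable space. For a compact metrizable space $X$ and a metrizable space $M$, a map $g\colon X\to M$ is a Krasinkiewicz map if every subcontinuum of $X$ is either contained in a fiber $g^{-1}(z)$ of $g$ or contains a component of some fiber of $g$. A metrizable space $M$ is a Krasinkiewicz space if for every compact metrizable space $X$ the Krasinkiewicz maps form a dense subset of $C(X,M)$ with the uniform convergence topology. The source limitation topology on $C(X,M)$ has as a base at $f\in C(X,M)$ the sets $B_\varrho(f,\varepsilon)=\{g\in C(X,M):\varrho(g(x),f(x))<\varepsilon(x)\ \text{for all } x\in X\}$, where $\varrho$ is a fixed compatible metric on $M$ and $\varepsilon$ ranges over continuous functions $X\to(0,1]$ (this topology does not depend on the choice of $\varrho$). A map is perfect if it is continuous, closed, and has compact fibers. $Y$ is strongly countable-dimensional if it is a countable union of closed finite-dimensional subsets. $Y$ is a $C$-space if for every sequence $(\nu_n)_{n\ge1}$ of open covers of $Y$ there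 is a sequence $(\gamma_n)_{n\ge1}$ of families of pairwise disjoint open sets such that each $\gamma_n$ refines $\nu_n$ and $\bigcup_n\gamma_n$ covers $Y$. *)

(* Defs.v *)
From Stdlib Require Import Reals List.
Open Scope R_scope.

Set Implicit Arguments.

Definition is_metric (T : Type) (d : T -> T -> R) : Prop :=
  (forall x y, 0 <= d x y) /\
  (forall x y, d x y = 0 <-> x = y) /\
  (forall x y, d x y = d y x) /\
  (forall x y z, d x z <= d x y + d y z).

(* A metrizable space, presented together with a compatible metric.
   All notions below except "complete" are purely topological. *)
Record MetricSpace := {
  ms_car :> Type;
  ms_d : ms_car -> ms_car -> R;
  ms_metric : is_metric ms_d }.
Arguments ms_d {m} _ _.

Section Topology.
Variable T : Type.
Variable d : T -> T -> R.

Definition open_set (S : T -> Prop) : Prop :=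
  forall x, S x -> exists e, 0 < e /\ forall y, d x y < e -> S y.

Definition closed_set (S : T -> Prop) : Prop := open_set (fun x => ~ S x).

Definition compact_set (K : T -> Prop) : Prop :=
  forall (I : Type) (U : I -> T -> Prop),
    (forall i, open_set (U i)) ->
    (forall x, K x -> exists i, U i x) ->
    exists l : list I, forall x, K x -> exists i, In i l /\ U i x.

Definition connected_set (S : T -> Prop) : Prop :=
  forall U V, open_set U -> open_set V ->
    (forall x, S x -> U x \/ V x) ->
    (forall x, ~ (S x /\ U x /\ V x)) ->
    (forall x, S x -> U x) \/ (forall x, S x -> V x).

Definition continuum (C : T -> Prop) : Prop :=
  (exists x, C x) /\ compact_set C /\ connected_set C.

Definition component (S : T -> Prop) (x0 : T) (x : T) : Prop :=
  exists C, connected_set C /\ (forall y, C y -> S y) /\ C x0 /\ C x.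

Definition cauchy_seq (u : nat -> T) : Prop :=
  forall e, 0 < e -> exists N, forall n m, (N <= n)%nat -> (N <= m)%nat -> d (u n) (u m) < e.

Definition complete_metric : Prop :=
  forall u : nat -> T, cauchy_seq u ->
    exists l, forall e, 0 < e -> exists N, forall n, (N <= n)%nat -> d (u n) l < e.

Definition dim_le (F : T -> Prop) (k : nat) : Prop :=
  forall (n : nat) (U : nat -> T -> Prop),
    (forall i, (i < n)%nat -> open_set (U i)) ->
    (forall x, F x -> exists i, (i < n)%nat /\ U i x) ->
    exists (m : nat) (V : nat -> T -> Prop),
      (forall j, (j < m)%nat -> open_set (V j)) /\
      (forall x, F x -> exists j, (j < m)%nat /\ V j x) /\
      (forall j, (j < m)%nat -> exists i, (i < n)%nat /\
                   forall x, F x -> V j x -> U i x) /\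
      (forall x, F x -> forall l : list nat, NoDup l ->
          (forall j, In j l -> (j < m)%nat /\ V j x) -> (length l <= S k)%nat).

Definition strongly_countable_dimensional : Prop :=
  exists F : nat -> T -> Prop,
    (forall n, closed_set (F n)) /\
    (forall n, exists k, dim_le (F n) k) /\
    (forall y, exists n, F n y).

Definition open_cover (nu : (T -> Prop) -> Prop) : Prop :=
  (forall U, nu U -> open_set U) /\ (forall x, exists U, nu U /\ U x).

Definition C_space : Prop :=
  forall nu : nat -> (T -> Prop) -> Prop,
    (forall n, open_cover (nu n)) ->
    exists gamma : nat -> (T -> Prop) -> Prop,
      (forall n G, gamma n G -> open_set G) /\
      (forall n A B, gamma n A -> gamma n B -> (exists x, A x /\ B x) ->
                     forall x, A x <-> B x) /\
      (forall n G, gamma n G -> exists U, nu n U /\ forall x, G x -> U x) /\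
      (forall x, exists n G, gamma n G /\ G x).
End Topology.

Definition continuous {X Y : MetricSpace} (f : X -> Y) : Prop :=
  forall (x : X) e, 0 < e -> exists dl, 0 < dl /\
    forall x' : X, ms_d x x' < dl -> ms_d (f x) (f x') < e.

Definition continuous_on_sub {X Y : MetricSpace} {A : X -> Prop}
  (f : {x : X | A x} -> Y) : Prop :=
  forall a e, 0 < e -> exists dl, 0 < dl /\
    forall b, ms_d (proj1_sig a) (proj1_sig b) < dl -> ms_d (f a) (f b) < e.

Definition closed_map {X Y : MetricSpace} (f : X -> Y) : Prop :=
  forall F, closed_set (@ms_d X) F ->
    closed_set (@ms_d Y) (fun y => exists x, F x /\ f x = y).

Definition fiber {X Y : Type} (f : X -> Y) (y : Y) : X -> Prop := fun x => f x = y.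

Definition perfect_map {X Y : MetricSpace} (f : X -> Y) : Prop :=
  continuous f /\ closed_map f /\
  forall y, compact_set (@ms_d X) (fiber f y).

Definition kras_map_on {X M : MetricSpace} (K : X -> Prop) (g : X -> M) : Prop :=
  forall C, continuum (@ms_d X) C -> (forall x, C x -> K x) ->
    (exists z, forall x, C x -> g x = z) \/
    (exists z x0, K x0 /\ g x0 = z /\
       forall x, component (@ms_d X) (fun x => K x /\ g x = z) x0 x -> C x).

Definition kras_map {X M : MetricSpace} (g : X -> M) : Prop :=
  kras_map_on (fun _ => True) g.

Definition compact_space (X : MetricSpace) : Prop :=
  compact_set (@ms_d X) (fun _ => True).

Definition kras_space (M : MetricSpace) : Prop :=
  forall X : MetricSpace, compact_space X ->
    forall (f : X -> M) e, continuous f -> 0 < e ->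
      exists g : X -> M, continuous g /\ kras_map g /\
        forall x, ms_d (g x) (f x) < e.

Definition ANR (M : MetricSpace) : Prop :=
  forall (Z : MetricSpace) (A : Z -> Prop) (phi : {z : Z | A z} -> M),
    closed_set (@ms_d Z) A -> continuous_on_sub phi ->
    exists (U : Z -> Prop) (psi : {z : Z | U z} -> M),
      open_set (@ms_d Z) U /\ (forall z, A z -> U z) /\ continuous_on_sub psi /\
      forall z (Ha : A z) (Hu : U z), psi (exist _ z Hu) = phi (exist _ z Ha).

Definition complete_ANR (M : MetricSpace) : Prop :=
  ANR M /\
  exists d' : M -> M -> R, is_metric d' /\
    (forall S, open_set (@ms_d M) S <-> open_set d' S) /\ complete_metric d'.

Record Banach := {
  bv :> Type;
  bzero : bv;
  badd : bv -> bv -> bv;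
  bscal : R -> bv -> bv;
  bnorm : bv -> R;
  b_add_assoc : forall x y z, badd x (badd y z) = badd (badd x y) z;
  b_add_comm : forall x y, badd x y = badd y x;
  b_add_zero : forall x, badd x bzero = x;
  b_add_opp : forall x, badd x (bscal (-1) x) = bzero;
  b_scal_one : forall x, bscal 1 x = x;
  b_scal_scal : forall a b x, bscal a (bscal b x) = bscal (a * b) x;
  b_scal_addR : forall a b x, bscal (a + b) x = badd (bscal a x) (bscal b x);
  b_scal_addV : forall a x y, bscal a (badd x y) = badd (bscal a x) (bscal a y);
  b_norm_nonneg : forall x, 0 <= bnorm x;
  b_norm_zero : forall x, bnorm x = 0 -> x = bzero;
  b_norm_scal : forall a x, bnorm (bscal a x) = Rabs a * bnorm x;
  b_norm_triangle : forall x y, bnorm (badd x y) <= bnorm x + bnorm y;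
  b_complete : complete_metric (fun x y => bnorm (badd x (bscal (-1) y)))
}.

Arguments bzero {b0}.
Arguments badd {b0} _ _.
Arguments bscal {b0} _ _.
Arguments bnorm {b0} _.

Definition bdist {B : Banach} (x y : B) : R := bnorm (badd x (bscal (-1) y)).

Definition convex_set {B : Banach} (K : B -> Prop) : Prop :=
  forall x y t, K x -> K y -> 0 <= t <= 1 ->
    K (badd (bscal t x) (bscal (1 - t) y)).

Definition homeo_closed_convex_Banach (M : MetricSpace) : Prop :=
  exists (B : Banach) (K : B -> Prop) (h : M -> B),
    closed_set (@bdist B) K /\ convex_set K /\
    (forall m, K (h m)) /\ (forall k, K k -> exists m, h m = k) /\
    (forall m m', h m = h m' -> m = m') /\
    (forall (m : M) e, 0 < e -> exists dl, 0 < dl /\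
        forall m' : M, bdist (h m) (h m') < dl -> ms_d m m' < e) /\
    (forall (m : M) e, 0 < e -> exists dl, 0 < dl /\
        forall m' : M, ms_d m m' < dl -> bdist (h m) (h m') < e).

(* ---------- source limitation topology on C(X,M) ----------
   subsets of C(X,M) are predicates on X -> M contained in the continuous maps *)
Definition continuous_real {X : MetricSpace} (eps : X -> R) : Prop :=
  forall (x : X) e, 0 < e -> exists dl, 0 < dl /\
    forall x' : X, ms_d x x' < dl -> Rabs (eps x - eps x') < e.

Definition SL_open {X M : MetricSpace} (W : (X -> M) -> Prop) : Prop :=
  (forall g, W g -> continuous g) /\
  forall g, W g ->
    exists eps : X -> R, continuous_real eps /\ (forall x, 0 < eps x <= 1) /\
      forall h : X -> M, continuous h ->
        (forall x, ms_d (h x) (g x) < eps x) -> W h.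

Definition SL_dense {X M : MetricSpace} (S : (X -> M) -> Prop) : Prop :=
  forall W, SL_open W -> (exists g, W g) -> exists g, W g /\ S g.

Definition SL_Gdelta {X M : MetricSpace} (S : (X -> M) -> Prop) : Prop :=
  exists W : nat -> (X -> M) -> Prop,
    (forall n, SL_open (W n)) /\ (forall g, S g <-> forall n, W n g).

Definition fiberwise_kras_dense_Gdelta {X Y : MetricSpace} (M : MetricSpace) (f : X -> Y) : Prop :=
  exists S : (X -> M) -> Prop,
    (forall g, S g -> continuous g) /\
    SL_Gdelta S /\ SL_dense S /\
    (forall g, S g -> forall y, kras_map_on (fiber f y) g).

(* Main.v *)
(** A perfect map [f : X -> Y] admits a map [p] of [X] into the Hilbert cube that is injective on each
    fibre.  A Krasinkiewicz map on a compact subset of a cube restricts to one on every compact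
    subset; hence maps [g] that factor through [(c (f x), p x)], where [c] maps into a finite dimensional
    cube, can be made fibrewise Krasinkiewicz by one approximation on a compactum.  In general [c] is
    the system of weights of a locally finite sigma-discrete partition of unity on [Y], and [Y] is cut into
    strata according to the vertices of nonzero weight; after a first approximation by averages
    of constants, [g] extends continuously to the compact closure of the chart of each stratum.
    The [a]-th move replaces [g], on the part of each stratum where the weights are at least
    [1/(a+1)], by a Krasinkiewicz approximation of this extension, and interpolates by averaging
    points of [M] lying close together.  Points treated at one stage are affected at later stages only
    by the moves of their own stratum, whose size can be chosen afterwards, so the limit of the moves is
    fibrewise good.  Being Krasinkiewicz is written as a countable intersection of conditions [good],
    each stable under small perturbations because limits of continua along an ultrafilter
    are continua; this gives the G-delta.  Of [M] one only uses completeness and the existence of local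
    averages, which come from a neighbourhood retraction in a space of functions for an ANR
    and from convexity in the other case. *)

From Stdlib Require Import Reals List Lra Lia Cantor Classical ClassicalEpsilon FunctionalExtensionality.
From Corelib Require Import ssreflect ssrbool.
From mathcomp.classical Require boolp classical_sets filter wochoice.
Require Import Defs.

Set Implicit Arguments. Unset Strict Implicit.
Set Bullet Behavior "None".
Unset SsrOldRewriteGoalsOrder.
Open Scope R_scope.

(** Members of one discrete family share a single coordinate of [chart], so points of [X] over
    different members may have the same chart. Only on a stratum, where the finitely many active
    vertices have fixed names, does the chart determine the value of [g]. This is why [convergent]
    asks for limits along the traces of balls on strata, and not for an extension to the closure of
    the whole chart. Labels jump inside [X], because a weight may tend to 0. A move is therefore
    damped by a gauge that vanishes where its own label jumps, and it acts in full only at [settled]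
    points; every point of [Y] is settled from some stage on. Since infinitely many strata admit no
    common positive tolerance, sizes of moves and tolerances are functions of the label. The other
    obstacle is that components of fibres do not pass to limits. In [good] a component is replaced
    by all connected sets on which the map is nearly constant, and containment by closeness.
    Closeness is read through [p], so that the condition has the same meaning on a fibre and on its
    image in the cube. *)

Lemma free_ultrafilter_exists : exists F : (nat -> Prop) -> Prop,
  (forall P Q : nat -> Prop, (forall j, P j -> Q j) -> F P -> F Q) /\
  (forall P Q, F P -> F Q -> F (fun j => P j /\ Q j)) /\
  (forall P, F P \/ F (fun j => ~ P j)) /\
  ~ F (fun _ => False) /\
  (forall N, F (fun j => (N <= j)%nat)).
Proof.
pose E (P : nat -> Prop) := exists N, forall j, (N <= j)%nat -> P j.
have EP : filter.ProperFilter E.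
  apply: filter.Build_ProperFilter.
    by move=> [N /(_ N (le_n _))].
  split.
  - by exists 0%nat.
  - move=> P Q [N HN] [N' HN']; exists (N + N')%nat => j Hj.
    by split; [apply: HN; lia | apply: HN'; lia].
  - by move=> P Q PQ [N HN]; exists N => j /HN /PQ.
have [G [GU EG]] := filter.ultraFilterLemma EP.
have GP : filter.ProperFilter G by apply: filter.ultra_proper.
exists G; split; [|split; [|split; [|split]]].
- by move=> P Q PQ; apply: filter.filterS.
- by move=> P Q; apply: filter.filterI.
- by move=> P; apply: (filter.in_ultra_setVsetC P GU).
- exact: filter.filter_not_empty.
- by move=> N; apply: EG; exists N.
Qed.


(** Antisymmetry comes from the uniqueness of minima: if [x] and [y] precede each other, both are
    least in the pair they form. It serves to name a least member of a cover. *)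
Lemma least_selection (T : Type) :
  exists le : T -> T -> Prop,
    (forall x y, le x y -> le y x -> x = y) /\
    (forall P : T -> Prop, (exists x, P x) -> exists x, P x /\ forall y, P y -> le x y).
Proof.
have [R woR] := wochoice.well_ordering_principle (eqtype.Equality.Pack (eqtype.Equality.Class (boolp.gen_eqMixin T))).
have least (P : T -> Prop) : (exists x, P x) ->
    exists x, (P x /\ forall y, P y -> R x y = true) /\
      forall z, P z -> (forall y, P y -> R z y = true) -> x = z.
  move=> exP; have [|x [[Px xmin] xu]] := woR (fun x => boolp.asbool (P x)).
    by have [x Px] := exP; exists x; apply/boolp.asboolP.
  exists x; split.
    split; first by move/boolp.asboolP: Px.
    by move=> y Py; apply: xmin; apply/boolp.asboolP.
  move=> z Pz zmin; apply: xu; split; first exact/boolp.asboolP.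
  by move=> y /boolp.asboolP Py; apply: zmin.
exists (fun x y => R x y = true); split.
- move=> x y xy yx.
  have refl z : R z z = true.
    have [|w [[-> H] _]] := least (fun w => w = z); first by exists z.
    exact: H.
  have [|w [_ wu]] := least (fun w => w = x \/ w = y); first by exists x; left.
  rewrite -(wu x); [by left|by move=> z [] -> //; apply: refl|].
  by apply: wu; [right|move=> z [] -> //; apply: refl].
- by move=> P /least [x [? _]]; exists x.
Qed.

(** * Ultralimits and compactness *)

(** One free ultrafilter is fixed for the whole proof: limits of several sequences, and of sequences
    of sets, are taken along it simultaneously, without passing to subsequences. *)
Definition uf : (nat -> Prop) -> Prop :=
  proj1_sig (constructive_indefinite_description _ free_ultrafilter_exists).

Lemma ufW (P Q : nat -> Prop) : (forall j, P j -> Q j) -> uf P -> uf Q.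
Proof. by rewrite /uf; case: constructive_indefinite_description => F /= [+ _]; apply. Qed.

Lemma uf_and (P Q : nat -> Prop) : uf P -> uf Q -> uf (fun j => P j /\ Q j).
Proof. by rewrite /uf; case: constructive_indefinite_description => F /= [_ [+ _]]; apply. Qed.

Lemma uf_dich (P : nat -> Prop) : uf P \/ uf (fun j => ~ P j).
Proof. by rewrite /uf; case: constructive_indefinite_description => F /= [_ [_ [+ _]]]; apply. Qed.

Lemma uf_ge N : uf (fun j => (N <= j)%nat).
Proof. by rewrite /uf; case: constructive_indefinite_description => F /= [_ [_ [_ [_ +]]]]; apply. Qed.

Lemma uf_ex (P : nat -> Prop) : uf P -> exists j, P j.
Proof.
move=> HP; apply: NNPP => nP.
have : uf (fun _ => False) by apply: ufW HP => j Pj; apply: nP; exists j.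
by rewrite /uf; case: constructive_indefinite_description => F /= [_ [_ [_ [+ _]]]].
Qed.

Lemma ufT (P : nat -> Prop) : (forall j, P j) -> uf P.
Proof. by move=> H; apply: ufW (uf_ge 0). Qed.

Lemma uf_not (P : nat -> Prop) : ~ uf P -> uf (fun j => ~ P j).
Proof. by case: (uf_dich P). Qed.

Lemma uf_list (I : Type) (P : I -> nat -> Prop) (l : list I) :
  uf (fun j => exists i, In i l /\ P i j) -> exists i, In i l /\ uf (P i).
Proof.
elim: l => [|a l IH] H; first by have [j [i []]] := uf_ex H.
have [Ha|Ha] := uf_dich (P a); first by exists a; split => //; left.
have {H}: uf (fun j => exists i, In i l /\ P i j).
  apply: ufW (uf_and H Ha) => j [[i [[<-|Hi] Pi]] nPa] //.
  by exists i.
by move=> /IH [i [Hi HP]]; exists i; split => //; right.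
Qed.

Lemma ms_ge0 (T : MetricSpace) (x y : T) : 0 <= ms_d x y.
Proof. by have [H _] := ms_metric T; apply: H. Qed.

Lemma ms_refl (T : MetricSpace) (x : T) : ms_d x x = 0.
Proof. by have [_ [H _]] := ms_metric T; apply/H. Qed.

Lemma ms_eq (T : MetricSpace) (x y : T) : ms_d x y = 0 -> x = y.
Proof. by have [_ [H _]] := ms_metric T; move/H. Qed.

Lemma ms_sym (T : MetricSpace) (x y : T) : ms_d x y = ms_d y x.
Proof. by have [_ [_ [H _]]] := ms_metric T; apply: H. Qed.

Lemma ms_tri (T : MetricSpace) (y x z : T) : ms_d x z <= ms_d x y + ms_d y z.
Proof. by have [_ [_ [_ H]]] := ms_metric T; apply: H. Qed.

Definition inv_succ (j : nat) : R := / (INR j + 1).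

Lemma inv_succ_pos j : 0 < inv_succ j.
Proof. by apply: Rinv_0_lt_compat; have := pos_INR j; lra. Qed.

Lemma inv_succ_small e : 0 < e -> exists N, forall n, (N <= n)%nat -> inv_succ n < e.
Proof.
move=> e0; have [N [HN N0]] := archimed_cor1 e e0.
exists N => n Hn; apply: Rle_lt_trans HN; apply: Rinv_le_contravar.
  by apply: lt_0_INR.
by have := le_INR _ _ Hn; lra.
Qed.

Lemma uf_inv_succ e : 0 < e -> uf (fun j => inv_succ j < e).
Proof. by move=> /inv_succ_small [N HN]; apply: ufW (uf_ge N). Qed.

Definition ulim {T : MetricSpace} (u : nat -> T) (x : T) : Prop :=
  forall e, 0 < e -> uf (fun j => ms_d x (u j) < e).

Lemma ulim_cont (X Y : MetricSpace) (f : X -> Y) (u : nat -> X) x :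
  continuous f -> ulim u x -> ulim (fun j => f (u j)) (f x).
Proof.
move=> cf ux e /(cf x) [dl [dl0 H]].
by apply: ufW (ux _ dl0) => j; apply: H.
Qed.

Lemma ulim_dist_le (T : MetricSpace) (u v : nat -> T) x y r :
  ulim u x -> ulim v y -> (forall e, 0 < e -> uf (fun j => ms_d (u j) (v j) <= r + e)) ->
  ms_d x y <= r.
Proof.
move=> ux vy H; apply: Rnot_lt_le => lt.
pose e := (ms_d x y - r) / 4.
have e0 : 0 < e by rewrite /e; lra.
have [j [Hu [Hv Hj]]] := uf_ex (uf_and (ux _ e0) (uf_and (vy _ e0) (H _ e0))).
have := ms_tri (u j) x y; have := ms_tri (v j) (u j) y.
rewrite (ms_sym (v j)); move: Hu Hv Hj; rewrite /e; lra.
Qed.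

Lemma ulim_dist_ge (T : MetricSpace) (u v : nat -> T) x y r :
  ulim u x -> ulim v y -> (forall e, 0 < e -> uf (fun j => r - e <= ms_d (u j) (v j))) ->
  r <= ms_d x y.
Proof.
move=> ux vy H; apply: Rnot_lt_le => lt.
pose e := (r - ms_d x y) / 4.
have e0 : 0 < e by rewrite /e; lra.
have [j [Hu [Hv Hj]]] := uf_ex (uf_and (ux _ e0) (uf_and (vy _ e0) (H _ e0))).
have := ms_tri x (u j) (v j); have := ms_tri y x (v j).
rewrite (ms_sym (u j) x); move: Hu Hv Hj; rewrite /e; lra.
Qed.

Lemma ulim_uniq (T : MetricSpace) (u : nat -> T) x y : ulim u x -> ulim u y -> x = y.
Proof.
move=> ux uy; apply: ms_eq; apply: Rle_antisym; last exact: ms_ge0.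
apply: (ulim_dist_le ux uy) => e e0; apply: ufT => j; rewrite ms_refl; lra.
Qed.

Lemma ulim_const (T : MetricSpace) (x : T) : ulim (fun _ => x) x.
Proof. by move=> e e0; apply: ufT => j; rewrite ms_refl. Qed.

Lemma ulim_inv_succ (T : MetricSpace) (u : nat -> T) x :
  (forall j, ms_d x (u j) < inv_succ j) -> ulim u x.
Proof. by move=> H e /uf_inv_succ; apply: ufW => j; have := H j; lra. Qed.

Lemma ulim_near (T : MetricSpace) (u v : nat -> T) x :
  ulim u x -> (forall e, 0 < e -> uf (fun j => ms_d (u j) (v j) < e)) -> ulim v x.
Proof.
move=> ux H e e0; have e2 : 0 < e / 2 by lra.
apply: ufW (uf_and (ux _ e2) (H _ e2)) => j; have := ms_tri (u j) x (v j); lra.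
Qed.

Lemma ulim_in_closed (T : MetricSpace) (S : T -> Prop) (u : nat -> T) x :
  closed_set (@ms_d T) S -> ulim u x -> uf (fun j => S (u j)) -> S x.
Proof.
move=> cS ux uS; apply: NNPP => nS; have [e [e0 He]] := cS x nS.
by have [j [/He nSj]] := uf_ex (uf_and (ux _ e0) uS).
Qed.

Lemma open_ball (T : MetricSpace) (x : T) r : open_set (@ms_d T) (fun y => ms_d x y < r).
Proof.
move=> y Hy; exists (r - ms_d x y); split; first lra.
by move=> z Hz; have := ms_tri y x z; lra.
Qed.

(** Compactness as convergence along the fixed ultrafilter; [compact_ucpt] and [ucpt_compact] show
    that it agrees with the covering definition. *)
Definition ucpt {T : MetricSpace} (K : T -> Prop) : Prop :=
  forall u : nat -> T, (forall j, K (u j)) -> exists x, K x /\ ulim u x.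

(** Without a limit, each point of [K] has a ball containing [u j] for a null set of [j] only.
    Finitely many such balls cannot cover [K], since one of them would contain [u j] for almost all
    [j]. *)
Lemma compact_ucpt (T : MetricSpace) (K : T -> Prop) : compact_set (@ms_d T) K -> ucpt K.
Proof.
move=> cK u Ku; apply: NNPP => nl.
have H x : K x -> exists e, 0 < e /\ ~ uf (fun j => ms_d x (u j) < e).
  move=> Kx; apply: NNPP => ne; apply: nl; exists x; split => // e e0.
  by apply: NNPP => nu; apply: ne; exists e.
pose I := {p : T * R | 0 < snd p /\ ~ uf (fun j => ms_d (fst p) (u j) < snd p)}.
pose U (i : I) y := ms_d (fst (proj1_sig i)) y < snd (proj1_sig i).
have [||l Hl] := cK I U.
- by move=> i; apply: open_ball.
- move=> x /H [e [e0 He]]; exists (exist _ (x, e) (conj e0 He)).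
  by rewrite /U /= ms_refl.
have [|[[x e] /= [e0 ne]] [_ ue]] := @uf_list I (fun i j => U i (u j)) l.
  by apply: ufT => j; apply: Hl.
exact (ne ue).
Qed.

(** Lebesgue's number lemma for any local property inherited by smaller radii: counterexamples at
    the radii [inv_succ j] have a limit, and a radius valid around that limit refutes one of
    them. *)
Lemma ucpt_lebesgue (T : MetricSpace) (K : T -> Prop) (P : T -> R -> Prop) :
  ucpt K -> (forall x r s, s <= r -> P x r -> P x s) ->
  (forall x, K x -> exists r, 0 < r /\ forall y, ms_d x y < r -> K y -> P y r) ->
  exists r, 0 < r /\ forall x, K x -> P x r.
Proof.
move=> cK mono H; apply: NNPP => nr.
have [u Hu] : exists u : nat -> T, forall j, K (u j) /\ ~ P (u j) (inv_succ j).
  apply: (choice (fun j x => K x /\ ~ P x (inv_succ j))) => j.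
  apply: NNPP => nx; apply: nr; exists (inv_succ j); split; first exact: inv_succ_pos.
  by move=> x Kx; apply: NNPP => nP; apply: nx; exists x.
have [x [Kx ux]] := cK u (fun j => proj1 (Hu j)).
have [r [r0 Hr]] := H x Kx.
have [j [H1 H2]] := uf_ex (uf_and (ux _ r0) (uf_inv_succ r0)).
case: (Hu j) => Kj; case; apply: (mono _ r); first lra.
exact: Hr.
Qed.

Lemma ucpt_net (T : MetricSpace) (K : T -> Prop) r : ucpt K -> 0 < r ->
  exists l : list T, (forall x, In x l -> K x) /\
    forall x, K x -> exists y, In y l /\ ms_d y x < r.
Proof.
move=> cK r0; apply: NNPP => nl.
(* Greedy choice of points at mutual distance at least [r]. The resulting sequence would have a
   limit, with two of its terms within [r / 2] of it. *)
pose LK := {l : list T | forall x, In x l -> K x}.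
have next (l : LK) : {x | K x /\ forall y, In y (proj1_sig l) -> r <= ms_d y x}.
  apply: constructive_indefinite_description; apply: NNPP => nx; apply: nl.
  exists (proj1_sig l); split; first exact: (proj2_sig l).
  move=> x Kx; apply: NNPP => ny; apply: nx; exists x; split => // y Hy.
  by apply: Rnot_lt_le => lt; apply: ny; exists y.
have Hcons (l : LK) x : In x (proj1_sig (next l) :: proj1_sig l) -> K x.
  by case=> [<-|]; [case: (next l) => /= ? [] | exact: (proj2_sig l x)].
pose step (l : LK) : LK := exist _ _ (Hcons l).
have nilS : forall x, In x (@nil T) -> K x by [].
pose L := fix L n := match n with O => exist _ nil nilS | S n => step (L n) end.
pose u n := proj1_sig (next (L n)).
have Ku n : K (u n) by rewrite /u; case: (next (L n)) => /= ? [].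
have InL n m : (n < m)%nat -> In (u n) (proj1_sig (L m)).
  elim: m => [|m IH]; first lia.
  move=> nm /=; case: (Nat.eq_dec n m) => [->|ne]; [by left | right; apply: IH; lia].
have sep n m : (n < m)%nat -> r <= ms_d (u n) (u m).
  by move=> nm; have [_ H] := proj2_sig (next (L m)); apply: H; apply: InL.
have [x [Kx ux]] := cK u Ku.
have r2 : 0 < r / 2 by lra.
have [n Hn] := uf_ex (ux _ r2).
have [m [Hm nm]] := uf_ex (uf_and (ux _ r2) (uf_ge (S n))).
have := sep n m nm; have := ms_tri x (u n) (u m); rewrite (ms_sym (u n) x); lra.
Qed.

Lemma ucpt_compact (T : MetricSpace) (K : T -> Prop) : ucpt K -> compact_set (@ms_d T) K.
Proof.
move=> cK I U oU cov.
have [||r [r0 Hr]] := @ucpt_lebesgue T K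
    (fun x r => exists i, forall y, ms_d x y < r -> U i y) cK.
- move=> x r s sr [i Hi]; exists i => y Hy; apply: Hi; lra.
- move=> x Kx; have [i Ui] := cov x Kx; have [e [e0 He]] := oU i x Ui.
  exists (e / 2); split; first lra.
  move=> y xy _; exists i => z yz; apply: He; have := ms_tri y x z; lra.
have [l [lK Hl]] := ucpt_net cK r0.
have [i0|ni] := classic (inhabited I); last first.
  exists nil => x /cov [i _]; case: ni; exact: inhabits.
have [g Hg] : exists g : T -> I, forall x, K x -> forall y, ms_d x y < r -> U (g x) y.
  apply: (choice (fun x i => K x -> forall y, ms_d x y < r -> U i y)) => x.
  have [/Hr [i Hi]|nK] := classic (K x); first by exists i.
  by case: i0 => i; exists i.
exists (map g l) => x Kx; have [y [Hy yx]] := Hl x Kx.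
exists (g y); split; first exact: in_map.
exact: Hg (lK _ Hy) _ yx.
Qed.

Lemma ucpt_closed_sub (T : MetricSpace) (K S : T -> Prop) :
  ucpt K -> closed_set (@ms_d T) S -> (forall x, S x -> K x) -> ucpt S.
Proof.
move=> cK cS SK u Su; have [x [Kx ux]] := cK u (fun j => SK _ (Su j)).
by exists x; split => //; apply: ulim_in_closed ux _ => //; apply: ufT.
Qed.

Lemma ucpt_closed (T : MetricSpace) (K : T -> Prop) : ucpt K -> closed_set (@ms_d T) K.
Proof.
move=> cK x nK; apply: NNPP => ne.
have [u Hu] : exists u : nat -> T, forall j, ms_d x (u j) < inv_succ j /\ K (u j).
  apply: (choice (fun j y => ms_d x y < inv_succ j /\ K y)) => j.
  apply: NNPP => ny; apply: ne; exists (inv_succ j); split; first exact: inv_succ_pos.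
  by move=> y xy Ky; apply: ny; exists y.
have [y [Ky uy]] := cK u (fun j => proj2 (Hu j)).
have xy : x = y by apply: ulim_uniq uy; apply: ulim_inv_succ => j; case: (Hu j).
by rewrite xy in nK.
Qed.

(** * Limits of connected sets along the ultrafilter *)

(** The Kuratowski limit of the sets [A j] along the ultrafilter. It is defined for every sequence
    of sets, which replaces the compactness of a hyperspace. *)
Definition ulimset {T : MetricSpace} (A : nat -> T -> Prop) (x : T) : Prop :=
  forall e, 0 < e -> uf (fun j => exists a, A j a /\ ms_d x a < e).

Lemma inv_succ_anti n m : (n <= m)%nat -> inv_succ m <= inv_succ n.
Proof.
move=> nm; apply: Rinv_le_contravar; first by have := pos_INR n; lra.
by have := le_INR _ _ nm; lra.
Qed.

Lemma ulimset_sel (T : MetricSpace) (A : nat -> T -> Prop) x :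
  (forall j, exists a, A j a) -> ulimset A x ->
  exists u, (forall j, A j (u j)) /\ ulim u x.
Proof.
move=> neA Ax.
(* The point selected in [A j] realises every scale [inv_succ m], [m < j], at which [A j] comes
   close to [x]; one selection thus serves all scales. *)
have best j n : exists a, A j a /\ forall m, (m < n)%nat ->
    (exists b, A j b /\ ms_d x b < inv_succ m) -> ms_d x a < inv_succ m.
  elim: n => [|n [a [Aa Ha]]]; first by have [a Aa] := neA j; exists a; split => // m; lia.
  have [[b [Ab xb]]|nb] := classic (exists b, A j b /\ ms_d x b < inv_succ n).
    exists b; split => // m mn _; have := @inv_succ_anti m n; have : (m <= n)%nat by lia.
    by move=> mn' /(_ mn'); lra.
  exists a; split => // m mn Hm; have [mn'|E] : (m < n)%nat \/ m = n by lia.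
    exact: Ha.
  by case: nb; rewrite -E.
have [u Hu] := choice _ (fun j => best j j).
exists u; split; first by move=> j; case: (Hu j).
move=> e e0; have [N HN] := inv_succ_small e0.
apply: ufW (uf_and (Ax _ (inv_succ_pos N)) (uf_ge (S N))) => j [Hj Nj].
by have [_ /(_ N Nj Hj)] := Hu j; have := HN N (le_n _); lra.
Qed.

Lemma ulimset_intro (T : MetricSpace) (A : nat -> T -> Prop) u x :
  (forall j, A j (u j)) -> ulim u x -> ulimset A x.
Proof. by move=> Au ux e /ux; apply: ufW => j Hj; exists (u j). Qed.

Lemma ulimset_closed (T : MetricSpace) (A : nat -> T -> Prop) :
  closed_set (@ms_d T) (ulimset A).
Proof.
move=> x nx; apply: NNPP => ne; apply: nx => e e0.
apply: NNPP => nu; apply: ne; exists (e / 2); split; first lra.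
move=> y xy Ay; apply: nu; have e2 : 0 < e / 2 by lra.
apply: ufW (Ay _ e2) => j [a [Aa ya]]; exists a; split => //.
by have := ms_tri y x a; lra.
Qed.

(** Connectedness at scale [e]. The sets [U] and [V] may overlap, a common point being a pair at
    distance 0. This weak form of connectedness is what survives approximation, and holding at every
    scale it gives back connectedness in the limit. *)
Definition chained {T : MetricSpace} (e : R) (A : T -> Prop) : Prop :=
  forall U V : T -> Prop, (forall a, A a -> U a \/ V a) ->
    (exists a, A a /\ U a) -> (exists b, A b /\ V b) ->
    exists a b, A a /\ A b /\ U a /\ V b /\ ms_d a b < e.

Lemma connected_chained (T : MetricSpace) (A : T -> Prop) e :
  connected_set (@ms_d T) A -> 0 < e -> chained e A.
Proof.
move=> cA e0 U V cov [a [Aa Ua]] [b [Ab Vb]].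
apply: NNPP => nab.
pose W (P : T -> Prop) x := exists a, (A a /\ P a) /\ ms_d a x < e / 2.
have oW P : open_set (@ms_d T) (W P).
  move=> x [c [Hc cx]]; have [d [d0 Hd]] := open_ball (x := c) (r := e / 2) cx.
  by exists d; split => // y /Hd cy; exists c.
have inW (P : T -> Prop) x : A x -> P x -> W P x.
  by move=> Ax Px; exists x; split => //; rewrite ms_refl; lra.
have sep x : ~ (A x /\ W U x /\ W V x).
  move=> [Ax [[c [[Ac Uc] cx]] [d [[Ad Vd] dx]]]]; apply: nab; exists c, d.
  by split => //; split => //; split => //; split => //; have := ms_tri x c d; rewrite (ms_sym x d); lra.
have [||H|H] := cA (W U) (W V) (oW U) (oW V); try by [].
- by move=> x Ax; case: (cov x Ax) => ?; [left|right]; apply: inW.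
- by apply: (sep b); split => //; split; [apply: H | apply: inW].
- by apply: (sep a); split => //; split; [apply: inW | apply: H].
Qed.

Section LimitSet.
Variables (T : MetricSpace) (A : nat -> T -> Prop) (K : T -> Prop).
Hypothesis neA : forall j, exists a, A j a.
(** The sets [A j] may lie outside [K]; only limits of selections must fall into [K]. This covers
    sets in the fibres over points [y j] converging to [y], with [K] the fibre over [y]. *)
Hypothesis precompact : forall u, (forall j, A j (u j)) -> exists x, K x /\ ulim u x.
Hypothesis cK : ucpt K.

Lemma ulimset_sub x : ulimset A x -> K x.
Proof.
move=> /(ulimset_sel neA) [u [/precompact [y [Ky uy]] ux]].
by rewrite (ulim_uniq ux uy).
Qed.

Lemma ulimset_ucpt : ucpt (ulimset A).
Proof. exact: ucpt_closed_sub cK (ulimset_closed (A := A)) ulimset_sub. Qed.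

Lemma ulimset_near r : 0 < r ->
  uf (fun j => forall a, A j a -> exists x, ulimset A x /\ ms_d x a < r).
Proof.
move=> r0; apply: NNPP => /uf_not nH.
have [u Hu] : exists u : nat -> T, forall j, A j (u j) /\
    ((exists a, A j a /\ forall x, ulimset A x -> ~ ms_d x a < r) ->
      forall x, ulimset A x -> ~ ms_d x (u j) < r).
  apply: (choice (fun j u => A j u /\ (_ -> forall x, ulimset A x -> ~ ms_d x u < r))) => j.
  have [[a [Aa Ha]]|nn] := classic (exists a, A j a /\ forall x, ulimset A x -> ~ ms_d x a < r).
    by exists a.
  by have [a Aa] := neA j; exists a.
have uA j : A j (u j) by case: (Hu j).
have [x [Kx ux]] := precompact uA.
have Lx := ulimset_intro uA ux.
have [j [nj xj]] := uf_ex (uf_and nH (ux _ r0)).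
case: (Hu j) => _ /(_ _ x Lx xj); apply.
apply: NNPP => nn; apply: nj => a Aa; apply: NNPP => nx; apply: nn.
by exists a; split => // y Ly ya; apply: nx; exists y.
Qed.

Lemma ulimset_connected : (forall e, 0 < e -> uf (fun j => chained e (A j))) ->
  connected_set (@ms_d T) (ulimset A).
Proof.
move=> chA U V oU oV cov dis; apply: NNPP => nn.
have [q [Lq nVq]] : exists q, ulimset A q /\ ~ V q.
  apply: NNPP => nq; apply: nn; right => x Lx; apply: NNPP => nV; apply: nq; by exists x.
have [p [Lp nUp]] : exists p, ulimset A p /\ ~ U p.
  apply: NNPP => np; apply: nn; left => x Lx; apply: NNPP => nU; apply: np; by exists x.
have Uq : U q by case: (cov q Lq).
have Vp : V p by case: (cov p Lp).
(* Below distance [r] no point of the limit in [U] has a partner in [V]. One link of a chain and two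
   approximations, each shorter than [r / 4], produce such a forbidden pair. *)
have [||r [r0 Hr]] := @ucpt_lebesgue T (ulimset A)
    (fun x r => forall y, ulimset A y -> ms_d x y < r -> (U x -> ~ V y)) ulimset_ucpt.
- by move=> x r s sr H y Ly xy; apply: H => //; lra.
- move=> x Lx.
  have side (W : T -> Prop) : open_set (@ms_d T) W -> W x -> exists r, 0 < r /\
      forall y, ms_d x y < r -> forall z, ms_d y z < r -> W y /\ W z.
    move=> oW Wx; have [e [e0 He]] := oW x Wx; exists (e / 2); split; first lra.
    by move=> y xy z yz; split; apply: He; have := ms_tri y x z; lra.
  case: (cov x Lx) => [/(side U oU)|/(side V oV)] [r [r0 Hr]]; exists r; split => // y xy Ly z Lz yz.
    by have [_ Uz] := Hr y xy z yz => _ Vz; apply: (dis z).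
  by have [Vy _] := Hr y xy z yz => Uy; case: (dis y).
have r4 : 0 < r / 4 by lra.
have [j [[Hn chj] [[a [Aa qa]] [b [Ab pb]]]]] :=
  uf_ex (uf_and (uf_and (ulimset_near r4) (chA _ r4)) (uf_and (Lq _ r4) (Lp _ r4))).
have [|||a' [b' [_ [_ [[x [Lx [Ux xa]]] [[y [Ly [Vy yb]]] ab]]]]]] := chj
    (fun a => exists x, ulimset A x /\ U x /\ ms_d x a < r / 4)
    (fun a => exists x, ulimset A x /\ V x /\ ms_d x a < r / 4).
- by move=> c /Hn [x [Lx xc]]; case: (cov x Lx); [left|right]; exists x.
- by exists a; split => //; exists q.
- by exists b; split => //; exists p.
apply: (Hr x Lx y Ly _ Ux Vy).
by have := ms_tri a' x y; have := ms_tri b' a' y; rewrite (ms_sym b' y); lra.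
Qed.

Lemma ulimset_continuum : (forall e, 0 < e -> uf (fun j => chained e (A j))) ->
  continuum (@ms_d T) (ulimset A).
Proof.
move=> chA; split; [|split].
- have [u Hu] := choice _ neA; have [x [_ ux]] := precompact Hu.
  by exists x; apply: ulimset_intro ux.
- exact: ucpt_compact ulimset_ucpt.
- exact: ulimset_connected.
Qed.
End LimitSet.

(** * Chains and boundary bumping *)

Inductive chain {T : MetricSpace} (E : T -> Prop) (e : R) (x0 : T) : T -> Prop :=
| chain0 : chain E e x0 x0
| chainS x y : chain E e x0 x -> E y -> ms_d x y < e -> chain E e x0 y.

Lemma chain_chained (T : MetricSpace) (E : T -> Prop) e x0 : 0 < e -> chained e (chain E e x0).
Proof.
move=> e0.
have half (U V : T -> Prop) : (forall a, chain E e x0 a -> U a \/ V a) -> U x0 ->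
    forall x, chain E e x0 x -> V x -> exists a b, chain E e x0 a /\ chain E e x0 b /\
      U a /\ V b /\ ms_d a b < e.
  move=> cov Ux0 x; elim=> [|{}x y cx IH Ey xy].
    by exists x0, x0; rewrite ms_refl; do 2 (split; first exact: chain0).
  move=> Vy; case: (cov x cx) => // Ux; exists x, y.
  by split => //; split => //; apply: chainS xy.
move=> U V cov [a [ca Ua]] [b [cb Vb]].
case: (cov x0 (chain0 _ _ _)) => H0; first exact: half cb Vb.
have [|c [d [? [? [? [? ?]]]]]] := half V U _ H0 a ca Ua.
  by move=> x /cov [];[right|left].
by exists d, c; rewrite ms_sym.
Qed.

(** A form of the boundary bumping theorem. The subcontinuum is the limit of the sets of points
    reached from [x0] by ever finer chains in [E]. If one of these sets stayed at values closer than
    [dl], it would be open and closed in [K], contradicting the presence of [x1]. *)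
Lemma boundary_bumping (T M : MetricSpace) (g : T -> M) (K : T -> Prop) x0 x1 dl :
  continuous g -> continuum (@ms_d T) K -> K x0 -> K x1 -> 0 < dl -> dl < ms_d (g x0) (g x1) ->
  exists C, continuum (@ms_d T) C /\ (forall x, C x -> K x) /\ C x0 /\
    (forall x, C x -> ms_d (g x0) (g x) <= dl) /\
    (exists x, C x /\ dl <= ms_d (g x0) (g x)).
Proof.
move=> cg [_ [/compact_ucpt cK conK]] Kx0 Kx1 dl0 far.
pose E x := K x /\ ms_d (g x0) (g x) <= dl.
have Ex0 : E x0 by split => //; rewrite ms_refl; lra.
have cE : ucpt E.
  move=> u Eu; have [x [Kx ux]] := cK u (fun j => proj1 (Eu j)).
  exists x; split => //; split => //.
  apply: (ulim_dist_le (ulim_const (g x0)) (ulim_cont cg ux)) => e e0.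
  by apply: ufT => j; have [_] := Eu j; lra.
pose A j := chain E (inv_succ j) x0.
have AE j x : A j x -> E x by elim.
have neA j : exists a, A j a by exists x0; apply: chain0.
have precA u : (forall j, A j (u j)) -> exists x, E x /\ ulim u x.
  by move=> Au; apply: cE => j; apply: AE (Au j).
exists (ulimset A); split; [|split; [|split; [|split]]].
- apply: (ulimset_continuum neA precA cE) => e /uf_inv_succ; apply: ufW => j Hj U V cov ha hb.
  have [a [b [? [? [? [? ?]]]]]] := chain_chained (inv_succ_pos j) cov ha hb.
  by exists a, b; do 4 (split => //); lra.
- by move=> x /(ulimset_sub neA precA) [].
- by apply: (@ulimset_intro _ _ (fun _ => x0)) (ulim_const _) => j; apply: chain0.
- by move=> x /(ulimset_sub neA precA) [].
have reach j : exists b, A j b /\ dl <= ms_d (g x0) (g b).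
  apply: NNPP => nb.
  have small b : A j b -> ms_d (g x0) (g b) < dl.
    by move=> Ab; apply: Rnot_le_lt => H; apply: nb; exists b.
  pose U x := exists r, 0 < r /\ forall y, ms_d x y < r -> K y -> A j y.
  pose V x := exists r, 0 < r /\ forall y, ms_d x y < r -> K y -> ~ A j y.
  have oW (P : T -> Prop) : open_set (@ms_d T) (fun x => exists r, 0 < r /\ forall y, ms_d x y < r -> K y -> P y).
    move=> x [r [r0 Hr]]; exists (r / 2); split; first lra.
    move=> y xy; exists (r / 2); split; first lra.
    by move=> z yz; apply: Hr; have := ms_tri y x z; lra.
  have [|x|H|H] := conK U V (oW _) (oW _).
  - move=> x Kx; have [Ax|nAx] := classic (A j x).
      have gap : 0 < dl - ms_d (g x0) (g x) by have := small x Ax; lra.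
      left; have [r [r0 Hr]] := cg x _ gap.
      exists (Rmin r (inv_succ j)); split; first by apply: Rmin_glb_lt => //; apply: inv_succ_pos.
      move=> y xy Ky; have := Rmin_l r (inv_succ j); have := Rmin_r r (inv_succ j) => h1 h2.
      apply: chainS Ax _ _; last lra; split => //.
      by have := Hr y; have := ms_tri (g x) (g x0) (g y); lra.
    right; have [Ex|nEx] := classic (E x).
      exists (inv_succ j); split; first exact: inv_succ_pos.
      by move=> y xy Ky Ay; apply: nAx; apply: chainS Ay Ex _; rewrite ms_sym.
    have lt : 0 < ms_d (g x0) (g x) - dl by apply: Rnot_le_lt => H; apply: nEx; split => //; lra.
    have [r [r0 Hr]] := cg x _ lt; exists r; split => // y xy Ky /AE [_ H].
    by have := Hr y xy; have := ms_tri (g y) (g x0) (g x); rewrite (ms_sym (g y)); lra.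
  - move=> [Kx [[r [r0 Hr]] [s [s0 Hs]]]].
    by apply: (Hs x) => //; [|apply: Hr => //]; rewrite ms_refl.
  - have [r [r0 Hr]] := H x1 Kx1; have /AE [_] : A j x1 by apply: Hr => //; rewrite ms_refl.
    by lra.
  - have [r [r0 Hr]] := H x0 Kx0; apply: (Hr x0) => //; [by rewrite ms_refl | exact: chain0].
have [b Hb] := choice _ reach.
have [x [Ex bx]] := precA b (fun j => proj1 (Hb j)).
exists x; split; first by apply: ulimset_intro bx => j; case: (Hb j).
apply: (ulim_dist_ge (ulim_const (g x0)) (ulim_cont cg bx)) => e e0.
by apply: ufT => j; have [_] := Hb j; lra.
Qed.

Lemma connected_image (X T : MetricSpace) (q : X -> T) (C : X -> Prop) :
  continuous q -> connected_set (@ms_d X) C ->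
  connected_set (@ms_d T) (fun t => exists x, C x /\ t = q x).
Proof.
move=> cq cC U V oU oV cov dis.
have oq W : open_set (@ms_d T) W -> open_set (@ms_d X) (fun x => W (q x)).
  move=> oW x Wx; have [e [e0 He]] := oW _ Wx; have [d [d0 Hd]] := cq x e e0.
  by exists d; split => // y /Hd /He.
have [|x|H|H] := cC _ _ (oq U oU) (oq V oV).
- by move=> x Cx; apply: cov; exists x.
- by move=> [Cx H]; apply: (dis (q x)); split => //; exists x.
- by left => t [x [Cx ->]]; apply: H.
- by right => t [x [Cx ->]]; apply: H.
Qed.

Lemma connected_union (T : MetricSpace) (A B : T -> Prop) x0 :
  connected_set (@ms_d T) A -> connected_set (@ms_d T) B -> A x0 -> B x0 ->
  connected_set (@ms_d T) (fun x => A x \/ B x).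
Proof.
move=> cA cB Ax Bx U V oU oV cov dis.
have HA := cA U V oU oV (fun x h => cov x (or_introl h)) (fun x h => dis x (conj (or_introl (proj1 h)) (proj2 h))).
have HB := cB U V oU oV (fun x h => cov x (or_intror h)) (fun x h => dis x (conj (or_intror (proj1 h)) (proj2 h))).
have dx := dis x0.
case: HA HB => HA [] HB; try by [left => x [/HA|/HB]|right => x [/HA|/HB]].
- by case: dx; split; [left|split; [apply: HA|apply: HB]].
- by case: dx; split; [left|split; [apply: HB|apply: HA]].
Qed.

Lemma connected_point (T : MetricSpace) (x0 : T) : connected_set (@ms_d T) (fun x => x = x0).
Proof.
move=> U V _ _ cov _; case: (cov x0 eq_refl) => H; [left|right] => x ->; exact: H.
Qed.

(** * Quantified Krasinkiewicz maps *)

(** The Krasinkiewicz condition at precision [k]: the sets [A] play the role of the component of a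
    fibre. By [kras_good] and [good_kras], validity for all [k > 0] amounts to the Krasinkiewicz
    property when [P] is injective on the compact set [K]. *)
Definition good {T Z M : MetricSpace} (P : T -> Z) (k : R) (K : T -> Prop) (G : T -> M) : Prop :=
  forall C, continuum (@ms_d T) C -> (forall x, C x -> K x) ->
    (exists x x', C x /\ C x' /\ k <= ms_d (G x) (G x')) ->
    exists x0 dl, C x0 /\ 0 < dl /\
      forall A, connected_set (@ms_d T) A -> (forall a, A a -> K a) -> A x0 ->
        (forall a, A a -> ms_d (G x0) (G a) <= dl) ->
        forall a, A a -> exists c, C c /\ ms_d (P a) (P c) < k.

Lemma good_mono (T Z M : MetricSpace) (P : T -> Z) k k' (K : T -> Prop) (G : T -> M) :
  k <= k' -> good P k K G -> good P k' K G.
Proof.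
move=> kk gk C cC CK [x [x' [Cx [Cx' far]]]].
have [|x0 [dl [Cx0 [dl0 H]]]] := gk C cC CK; first by exists x, x'; do 2 (split => //); lra.
exists x0, dl; do 2 (split => //); move=> A cA AK Ax0 Adl a Aa.
have [c [Cc pc]] := H A cA AK Ax0 Adl a Aa; exists c; split => //; lra.
Qed.

(** If each [h j] is bad, the images under [q] of the offending continua and connected sets have
    limits that are offending for [G]. With [q] the identity this yields openness; with [q] the
    chart it carries goodness from the cube back to the fibres of [f]. *)
Lemma good_stable (X T Z M : MetricSpace) (q : X -> T) (P : T -> Z) (p : X -> Z)
    (K : nat -> X -> Prop) (T0 : T -> Prop) (h : nat -> X -> M) (G : T -> M) k :
  continuous q -> continuous P -> ucpt T0 ->
  (forall u, (forall j, K j (u j)) -> exists t, T0 t /\ ulim (fun j => q (u j)) t) ->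
  (forall u t, (forall j, K j (u j)) -> T0 t -> ulim (fun j => q (u j)) t ->
     ulim (fun j => h j (u j)) (G t)) ->
  (forall j x x', K j x -> K j x' -> ms_d (P (q x)) (P (q x')) = ms_d (p x) (p x')) ->
  good P k T0 G -> exists j, good p k (K j) (h j).
Proof.
move=> cq cP cT0 prec hG Pp gG; apply: NNPP => nj.
have bad j : exists C, (continuum (@ms_d X) C /\ (forall x, C x -> K j x)) /\
    (exists x x', C x /\ C x' /\ k <= ms_d (h j x) (h j x')) /\
    forall x0 dl, C x0 -> 0 < dl -> exists A a, (connected_set (@ms_d X) A /\
      (forall a, A a -> K j a)) /\ (A x0 /\ (forall a, A a -> ms_d (h j x0) (h j a) <= dl)) /\
      A a /\ forall c, C c -> k <= ms_d (p a) (p c).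
  apply: NNPP => nb; apply: nj; exists j => C cC CK far.
  apply: NNPP => ng; apply: nb; exists C; do 2 (split => //); move=> x0 dl Cx0 dl0.
  apply: NNPP => nA; apply: ng; exists x0, dl; do 2 (split => //); move=> A cA AK Ax0 Adl a Aa.
  apply: NNPP => nc; apply: nA; exists A, a; do 3 (split => //).
  by move=> c Cc; apply: Rnot_lt_le => lt; apply: nc; exists c.
have {nj bad} [C HC] := choice _ bad.
have CK j x : C j x -> K j x by have [[_ H] _] := HC j; apply: H.
pose im (S : nat -> X -> Prop) j t := exists x, S j x /\ t = q x.
have im_sel (S : nat -> X -> Prop) u : (forall j, im S j (u j)) ->
    exists v, (forall j, S j (v j)) /\ u = fun j => q (v j).
  move=> Hu; have [v Hv] := choice _ Hu; exists v; split; first by move=> j; case: (Hv j).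
  by apply: functional_extensionality => j; case: (Hv j).
have im_prec (S : nat -> X -> Prop) : (forall j x, S j x -> K j x) ->
    forall u, (forall j, im S j (u j)) -> exists t, T0 t /\ ulim u t.
  by move=> SK u /im_sel [v [Sv ->]]; apply: prec => j; apply: SK (Sv j).
have im_chained (S : nat -> X -> Prop) : (forall j, connected_set (@ms_d X) (S j)) ->
    forall e, 0 < e -> uf (fun j => chained e (im S j)).
  move=> cS e e0; apply: ufT => j; apply: connected_chained e0; exact: connected_image.
have neC j : exists t, im C j t.
  by have [[[[x Cx] _] _] _] := HC j; exists (q x), x.
have cC j : connected_set (@ms_d X) (C j) by have [[[_ [_ H]] _] _] := HC j.
have contL := ulimset_continuum neC (im_prec C CK) cT0 (im_chained C cC).
have subL := ulimset_sub neC (im_prec C CK).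
have [x Hx] : exists x : nat -> X * X, forall j, C j (fst (x j)) /\ C j (snd (x j)) /\
    k <= ms_d (h j (fst (x j))) (h j (snd (x j))).
  apply: (choice (fun j x => C j (fst x) /\ C j (snd x) /\ k <= ms_d (h j (fst x)) (h j (snd x)))) => j.
  by have [_ [[y [z H]] _]] := HC j; exists (y, z).
have [t [T0t xt]] := prec _ (fun j => CK _ _ (proj1 (Hx j))).
have [t' [T0t' xt']] := prec _ (fun j => CK _ _ (proj1 (proj2 (Hx j)))).
have Lim_in (S : nat -> X -> Prop) u s : (forall j, S j (u j)) -> ulim (fun j => q (u j)) s ->
    ulimset (im S) s.
  by move=> Su; apply: ulimset_intro => j; exists (u j).
have Lt := Lim_in C _ _ (fun j => proj1 (Hx j)) xt.
have Lt' := Lim_in C _ _ (fun j => proj1 (proj2 (Hx j))) xt'.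
have [|t0 [dl [Lt0 [dl0 Hgood]]]] := gG _ contL subL.
  exists t, t'; do 2 (split => //).
  apply: (ulim_dist_ge (hG _ _ (fun j => CK _ _ (proj1 (Hx j))) T0t xt)
                       (hG _ _ (fun j => CK _ _ (proj1 (proj2 (Hx j)))) T0t' xt')) => e e0.
  by apply: ufT => j; have [_ [_]] := Hx j; lra.
(* Badness of [h j] is invoked at points [v j] of [C j] that converge to the base point [t0]
   supplied by the goodness of [G]. *)
have [w [/im_sel [v [Cv ->]] vt0]] := ulimset_sel neC Lt0.
have [Aa HA] : exists Aa : nat -> (X -> Prop) * X, forall j,
   (connected_set (@ms_d X) (fst (Aa j)) /\ (forall a, fst (Aa j) a -> K j a)) /\
   (fst (Aa j) (v j) /\ (forall a, fst (Aa j) a -> ms_d (h j (v j)) (h j a) <= dl / 2)) /\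
   fst (Aa j) (snd (Aa j)) /\ forall c, C j c -> k <= ms_d (p (snd (Aa j))) (p c).
  apply: (choice (fun j Aa => (connected_set (@ms_d X) (fst Aa) /\ (forall a, fst Aa a -> K j a)) /\
   (fst Aa (v j) /\ (forall a, fst Aa a -> ms_d (h j (v j)) (h j a) <= dl / 2)) /\
   fst Aa (snd Aa) /\ forall c, C j c -> k <= ms_d (p (snd Aa)) (p c))) => j.
  have [_ [_ /(_ (v j) (dl / 2) (Cv j))]] := HC j.
  by case; [lra | move=> A [a H]; exists (A, a)].
pose A j := fst (Aa j); pose a j := snd (Aa j).
have AK j x1 : A j x1 -> K j x1 by have [[_ H] _] := HA j; apply: H.
have neA j : exists s, im A j s by exists (q (v j)), (v j); split => //; have [_ [[]]] := HA j.
have Aaj j : A j (a j) by have [_ [_ []]] := HA j.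
have Avj j : A j (v j) by have [_ [[]]] := HA j.
have cA j : connected_set (@ms_d X) (A j) by have [[]] := HA j.
have [_ [_ conL]] := ulimset_continuum neA (im_prec A AK) cT0 (im_chained A cA).
have [s [T0s as_]] := prec _ (fun j => AK _ _ (Aaj j)).
have [||c [Lc lt]] := Hgood _ conL (ulimset_sub neA (im_prec A AK)) _ _ s (Lim_in A _ _ Aaj as_).
- exact: Lim_in Avj vt0.
- move=> s' Ls'; have T0s' := ulimset_sub neA (im_prec A AK) Ls'.
  have [w' [/im_sel [v' [Av' ->]] vs']] := ulimset_sel neA Ls'.
  apply: (ulim_dist_le (hG _ _ (fun j => CK _ _ (Cv j)) (subL _ Lt0) vt0)
                       (hG _ _ (fun j => AK _ _ (Av' j)) T0s' vs')) => e e0.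
  by apply: ufT => j; have [_ [[_ /(_ _ (Av' j))]]] := HA j; lra.
have [w' [/im_sel [v' [Cv' ->]] vc]] := ulimset_sel neC Lc.
have : k <= ms_d (P s) (P c); last lra.
apply: (ulim_dist_ge (ulim_cont cP as_) (ulim_cont cP vc)) => e e0; apply: ufT => j.
rewrite (Pp j _ _ (AK _ _ (Aaj j)) (CK _ _ (Cv' j))).
by have [_ [_ [_ /(_ _ (Cv' j))]]] := HA j; rewrite -/(a j); lra.
Qed.

Lemma component_refl (T : MetricSpace) (S : T -> Prop) x0 : S x0 -> component (@ms_d T) S x0 x0.
Proof.
by move=> Sx; exists (fun x => x = x0); split; [exact: connected_point | split => // y ->].
Qed.

(** Connected sets through [x0] on which [G] varies less and less have a connected limit inside one
    fibre. This limit lies in the component of [x0], hence in [C], although it contains a limit of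
    points kept at distance [k] from [C]. *)
Lemma kras_good (T Z M : MetricSpace) (P : T -> Z) (B : T -> Prop) (G : T -> M) k :
  continuous P -> ucpt B -> 0 < k ->
  (forall u t, (forall j, B (u j)) -> B t -> ulim u t -> ulim (fun j => G (u j)) (G t)) ->
  kras_map_on B G -> good P k B G.
Proof.
move=> cP cB k0 cG kG C cC CB [x [x' [Cx [Cx' far]]]].
case: (kG C cC CB) => [[z Hz]|[z [x0 [Bx0 [Gx0 comp]]]]].
  by move: far; rewrite (Hz x Cx) (Hz x' Cx') ms_refl; lra.
have Cx0 : C x0 by apply: comp; apply: component_refl.
apply: NNPP => ng.
have bad j : exists Aa : (T -> Prop) * T, (connected_set (@ms_d T) (fst Aa) /\
    (forall a, fst Aa a -> B a)) /\ (fst Aa x0 /\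
    (forall a, fst Aa a -> ms_d (G x0) (G a) <= inv_succ j)) /\
    fst Aa (snd Aa) /\ forall c, C c -> k <= ms_d (P (snd Aa)) (P c).
  apply: NNPP => nA; apply: ng; exists x0, (inv_succ j); split => //; split; first exact: inv_succ_pos.
  move=> A cA AB Ax0 Adl a Aa; apply: NNPP => nc; apply: nA; exists (A, a) => /=; do 3 (split => //).
  by move=> c Cc; apply: Rnot_lt_le => lt; apply: nc; exists c.
have [Aa HA] := choice _ bad.
pose A j := fst (Aa j).
have AB j y : A j y -> B y by have [[_ H] _] := HA j; apply: H.
have Ax0 j : A j x0 by have [_ [[]]] := HA j.
have neA j : exists a, A j a by exists x0.
have prec u : (forall j, A j (u j)) -> exists x, B x /\ ulim u x.
  by move=> Au; apply: cB => j; apply: AB (Au j).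
have [|_ [_ conL]] := ulimset_continuum neA prec cB.
  by move=> e e0; apply: ufT => j; apply: connected_chained e0; have [[]] := HA j.
have Aaj j : A j (snd (Aa j)) by have [_ [_ []]] := HA j.
have [s [Bs as_]] := prec _ Aaj.
have Cs : C s.
  apply: comp; exists (ulimset A); split => //; split; last split.
  - move=> y Ly; have By := ulimset_sub neA prec Ly; split => //.
    have [u [Au uy]] := ulimset_sel neA Ly; rewrite -Gx0; symmetry; apply: ms_eq.
    apply: Rle_antisym; last exact: ms_ge0.
    apply: (ulim_dist_le (ulim_const (G x0)) (cG _ _ (fun j => AB _ _ (Au j)) By uy)) => e e0.
    apply: ufW (uf_inv_succ e0) => j Hj; have [_ [[_ /(_ _ (Au j))]]] := HA j; lra.
  - exact: ulimset_intro Ax0 (ulim_const _).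
  - exact: ulimset_intro Aaj as_.
have : k <= ms_d (P s) (P s); last by rewrite ms_refl; lra.
apply: (ulim_dist_ge (ulim_cont cP as_) (ulim_const (P s))) => e e0; apply: ufT => j.
by have [_ [_ [_ /(_ _ Cs)]]] := HA j; lra.
Qed.

Section GoodKras.
Variables (X Z M : MetricSpace) (p : X -> Z) (K : X -> Prop) (g : X -> M).
Hypothesis cp : continuous p.
Hypothesis cg : continuous g.
Hypothesis cK : ucpt K.
Hypothesis injp : forall x x', K x -> K x' -> p x = p x' -> x = x'.
Hypothesis gd : forall k, 0 < k -> good p k K g.

Let nondeg C := (continuum (@ms_d X) C /\ (forall x, C x -> K x)) /\
  exists x x', C x /\ C x' /\ g x <> g x'.

Let next k C C' := (forall x, C' x -> C x) /\
  forall x D, C' x -> connected_set (@ms_d X) D -> (forall y, D y -> K y /\ g y = g x) -> D x ->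
    forall a, D a -> exists c, C c /\ ms_d (p a) (p c) < k.

Lemma good_next k C : 0 < k -> nondeg C -> exists C', nondeg C' /\ next k C C'.
Proof.
move=> k0 [[cC CK] [x [x' [Cx [Cx' ne]]]]].
have pos : 0 < ms_d (g x) (g x').
  by case: (ms_ge0 (g x) (g x')) => // E; case: ne; apply: ms_eq.
(* Capping [k] by the distance of the two values makes [C] large enough for goodness to apply to
   it. *)
pose k1 := Rmin k (ms_d (g x) (g x')).
have k10 : 0 < k1 by apply: Rmin_glb_lt.
have [|x0 [dl [Cx0 [dl0 H]]]] := gd k10 cC CK.
  by exists x, x'; do 2 (split => //); apply: Rmin_r.
(* One of [g x], [g x'] is at least half of their distance away from [g x0], hence farther than a
   third of it; this gives boundary bumping a point to run towards. *)
pose dl1 := Rmin dl (ms_d (g x) (g x') / 3).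
have dl10 : 0 < dl1 by apply: Rmin_glb_lt => //; lra.
have [x1 [Cx1 far]] : exists x1, C x1 /\ dl1 < ms_d (g x0) (g x1).
  have := Rmin_r dl (ms_d (g x) (g x') / 3); rewrite -/dl1 => le1.
  have := ms_tri (g x0) (g x) (g x'); rewrite (ms_sym (g x) (g x0)) => tri.
  case: (Rlt_dec dl1 (ms_d (g x0) (g x))) => ?; first by exists x.
  by exists x'; split => //; lra.
have [C' [cC' [C'C [C'x0 [C'le [x2 [C'x2 x2far]]]]]]] :=
  boundary_bumping cg cC Cx0 Cx1 dl10 far.
exists C'; split.
  split; first by split => // y /C'C /CK.
  exists x0, x2; do 2 (split => //); move=> E; move: x2far; rewrite E ms_refl; lra.
split => // y D C'y cD Dg Dy a Da.
(* Goodness speaks of connected sets through [x0]; the set [D] is attached to [x0] by means of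
   [C']. *)
have [|||c [Cc lt]] := H (fun x => C' x \/ D x) _ _ (or_introl C'x0) _ a (or_intror Da).
- by apply: (connected_union (x0 := y)) => //; case: cC' => _ [].
- by move=> z [/C'C /CK|/Dg []].
- move=> z [/C'le|/Dg [_ ->]]; last have := C'le y C'y; have := Rmin_l dl (ms_d (g x) (g x') / 3);
    rewrite -/dl1; lra.
- by exists c; split => //; have := Rmin_l k (ms_d (g x) (g x')); rewrite -/k1; lra.
Qed.

(** Goodness is applied along a decreasing sequence of continua, each kept nondegenerate by boundary
    bumping so that the next application is possible. The component of a fibre of [g] through a
    common point [y] of all of them is arbitrarily close to [C] as seen by [p], so it lies in [C]
    because [p] is injective on [K]. *)
Lemma good_kras : kras_map_on K g.
Proof.
move=> C cC CK.
have [[x [x' [Cx [Cx' ne]]]]|deg] := classic (exists x x', C x /\ C x' /\ g x <> g x'); last first.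
  left; have [x0 Cx0] := proj1 cC; exists (g x0) => x Cx.
  by apply: NNPP => ne; apply: deg; exists x, x0.
right.
have nC : nondeg C by split => //; exists x, x'.
pose ND := {C | nondeg C}.
have [step Hstep] : exists step : nat -> ND -> ND, forall n c,
    next (inv_succ n) (proj1_sig c) (proj1_sig (step n c)).
  apply: (choice (fun (n : nat) (f : ND -> ND) => forall c, next (inv_succ n) (proj1_sig c) (proj1_sig (f c)))) => n.
  apply: (choice (fun (c c' : ND) => next (inv_succ n) (proj1_sig c) (proj1_sig c'))) => c.
  have [C' [nC' H]] := good_next (inv_succ_pos n) (proj2_sig c).
  by exists (exist _ C' nC').
pose D n : ND := nat_rect (fun _ => ND) (exist _ C nC) (fun n c => step n c) n.
pose E n := proj1_sig (D n).
have ES n : next (inv_succ n) (E n) (E (S n)) by apply: Hstep.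
have Emono n m : (n <= m)%nat -> forall x, E m x -> E n x.
  elim=> [|{}m nm IH] y // Ey; apply: IH; have [H _] := ES m; exact: H.
have EC n y : E n y -> C y by apply: (Emono 0%nat n); lia.
have neE n : exists x, E n x by have [[[H _] _] _] := proj2_sig (D n).
have [u Hu] := choice _ neE.
have [y [Ky uy]] := cK (fun j => CK _ (EC _ _ (Hu j))).
have Ey n : E n y.
  have [[[_ [cE _]] _] _] := proj2_sig (D n).
  apply: (ulim_in_closed _ uy); first exact: ucpt_closed (compact_ucpt cE).
  by apply: ufW (uf_ge n) => j nj; apply: Emono (Hu j).
exists (g y), y; do 2 (split => //); move=> a [A [cA [AK [Ay Aa]]]].
have cl j : exists c, C c /\ ms_d (p a) (p c) < inv_succ j.
  have [_ /(_ y A (Ey _) cA AK Ay a Aa)] := ES j.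
  by move=> [c [Ec lt]]; exists c; split => //; apply: EC Ec.
have [c Hc] := choice _ cl.
have [_ [/compact_ucpt ucC _]] := cC.
have [b [Cb cb]] := ucC c (fun j => proj1 (Hc j)).
have [Ka _] := AK a Aa.
rewrite (injp Ka (CK _ Cb)) //; apply: ulim_uniq (ulim_cont cp cb).
by apply: ulim_inv_succ => j; case: (Hc j).
Qed.
End GoodKras.

(** * Filter bases and the Hilbert cube *)

(** The sets [N d] form a base of a filter as [d] tends to 0. They may be empty, in which case every
    map tends to every point. *)
Definition eventually {X : Type} (N : R -> X -> Prop) (P : X -> Prop) : Prop :=
  exists d, 0 < d /\ forall x, N d x -> P x.

Definition filter_base {X : Type} (N : R -> X -> Prop) : Prop :=
  forall d d' x, 0 < d -> d <= d' -> N d x -> N d' x.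

Definition tends {X : Type} {T : MetricSpace} (N : R -> X -> Prop) (F : X -> T) (t : T) : Prop :=
  forall e, 0 < e -> eventually N (fun x => ms_d t (F x) < e).

Definition tendsR {X : Type} (N : R -> X -> Prop) (w : X -> R) (a : R) : Prop :=
  forall e, 0 < e -> eventually N (fun x => Rabs (w x - a) < e).

Definition ball_base {T : MetricSpace} (x0 : T) : R -> T -> Prop := fun d x => ms_d x0 x < d.

Lemma ball_base_mono (T : MetricSpace) (x0 : T) : filter_base (ball_base x0).
Proof. by move=> d d' x _; rewrite /ball_base; lra. Qed.

Lemma continuousP (X Y : MetricSpace) (f : X -> Y) :
  continuous f <-> forall x0, tends (ball_base x0) f (f x0).
Proof. by []. Qed.

Section Bases.
Variables (X : Type) (N : R -> X -> Prop).
Hypothesis baseN : filter_base N.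

Lemma ev_mono (P Q : X -> Prop) : (forall x, P x -> Q x) -> eventually N P -> eventually N Q.
Proof. by move=> PQ [d [d0 H]]; exists d; split => // x /H /PQ. Qed.

Lemma ev_all (P : X -> Prop) : (forall x, P x) -> eventually N P.
Proof. by move=> H; exists 1; split; [lra|]. Qed.

Lemma ev_and (P Q : X -> Prop) : eventually N P -> eventually N Q -> eventually N (fun x => P x /\ Q x).
Proof.
move=> [d [d0 H]] [d' [d'0 H']]; exists (Rmin d d'); split; first exact: Rmin_glb_lt.
move=> x Nx; have m0 : 0 < Rmin d d' by exact: Rmin_glb_lt.
by split; [apply: H|apply: H']; apply: baseN Nx => //; [apply: Rmin_l|apply: Rmin_r].
Qed.

Lemma ev_nat (P : nat -> X -> Prop) n :
  (forall i, (i < n)%nat -> eventually N (P i)) -> eventually N (fun x => forall i, (i < n)%nat -> P i x).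
Proof.
elim: n => [|n IH] H; first by apply: ev_all => x i; lia.
apply: ev_mono (ev_and (IH (fun i ni => H i (Nat.lt_lt_succ_r _ _ ni))) (H n (Nat.lt_succ_diag_r n))).
move=> x [H1 H2] i Hi; have [/H1|->] : (i < n)%nat \/ i = n by lia.
  by [].
by [].
Qed.

Lemma tendsR_ext (w w' : X -> R) a : eventually N (fun x => w x = w' x) -> tendsR N w a -> tendsR N w' a.
Proof. by move=> E H e /H H1; apply: ev_mono (ev_and E H1) => x [->]. Qed.

Lemma tendsR_cst a : tendsR N (fun _ => a) a.
Proof. by move=> e e0; apply: ev_all => x; rewrite Rminus_diag Rabs_R0. Qed.

Lemma tendsR_lip (phi : R -> R) L (w : X -> R) a : 0 <= L ->
  (forall x y, Rabs (phi x - phi y) <= L * Rabs (x - y)) -> tendsR N w a ->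
  tendsR N (fun x => phi (w x)) (phi a).
Proof.
move=> L0 Hl H e e0; have d0 : 0 < e / (L + 1) by apply: Rdiv_lt_0_compat; lra.
apply: ev_mono (H _ d0) => x Hx; apply: Rle_lt_trans (Hl _ _) _.
have -> : e = (L + 1) * (e / (L + 1)) by field; lra.
by have := Rabs_pos (w x - a); nra.
Qed.

Lemma tendsR_add (w w' : X -> R) a a' : tendsR N w a -> tendsR N w' a' ->
  tendsR N (fun x => w x + w' x) (a + a').
Proof.
move=> H H' e e0; have e2 : 0 < e / 2 by lra.
apply: ev_mono (ev_and (H _ e2) (H' _ e2)) => x.
have -> : w x + w' x - (a + a') = (w x - a) + (w' x - a') by ring.
by have := Rabs_triang (w x - a) (w' x - a'); lra.
Qed.

Lemma tendsR_opp (w : X -> R) a : tendsR N w a -> tendsR N (fun x => - w x) (- a).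
Proof.
apply: (@tendsR_lip Ropp 1); first lra.
move=> x y; have -> : - x - - y = - (x - y) by ring.
by rewrite Rabs_Ropp; lra.
Qed.

Lemma tendsR_sub (w w' : X -> R) a a' : tendsR N w a -> tendsR N w' a' ->
  tendsR N (fun x => w x - w' x) (a - a').
Proof. by move=> H /tendsR_opp; apply: tendsR_add. Qed.

Lemma tendsR_mul (w w' : X -> R) a a' : tendsR N w a -> tendsR N w' a' ->
  tendsR N (fun x => w x * w' x) (a * a').
Proof.
move=> H H' e e0.
pose C := Rabs a + Rabs a' + 1.
have C0 : 0 < C by rewrite /C; have := Rabs_pos a; have := Rabs_pos a'; lra.
have d0 : 0 < Rmin 1 (e / (2 * C)) by apply: Rmin_glb_lt; [lra | apply: Rdiv_lt_0_compat; lra].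
apply: ev_mono (ev_and (H _ d0) (H' _ d0)) => x [Hx Hx'].
have -> : w x * w' x - a * a' = (w x - a) * a' + (w' x - a') * a + (w x - a) * (w' x - a') by ring.
have := Rabs_triang ((w x - a) * a' + (w' x - a') * a) ((w x - a) * (w' x - a')).
have := Rabs_triang ((w x - a) * a') ((w' x - a') * a); rewrite !Rabs_mult.
have := Rmin_l 1 (e / (2 * C)); have := Rmin_r 1 (e / (2 * C)).
move: (Rmin 1 (e / (2 * C))) d0 Hx Hx' => d d0 Hx Hx' dC d1.
have dC' : d * C <= e / 2.
  have E : e / (2 * C) * C = e / 2 by field; lra.
  by rewrite -E; apply: Rmult_le_compat_r; lra.
move: (Rabs_pos a) (Rabs_pos a') (Rabs_pos (w x - a)) (Rabs_pos (w' x - a')) dC' Hx Hx'.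
rewrite /C; move: (Rabs a) (Rabs a') (Rabs (w x - a)) (Rabs (w' x - a')) => p q r s.
nra.
Qed.

Lemma tendsR_inv (w : X -> R) a : 0 < a -> tendsR N w a -> tendsR N (fun x => / w x) (/ a).
Proof.
move=> a0 H e e0.
have d0 : 0 < Rmin (a / 2) (e * (a * a) / 2).
  have := Rmult_lt_0_compat _ _ e0 (Rmult_lt_0_compat _ _ a0 a0).
  by move=> ?; apply: Rmin_glb_lt; lra.
apply: ev_mono (H _ d0) => x Hx.
have wl : a / 2 < w x by move: Hx; have := Rmin_l (a / 2) (e * (a * a) / 2); move=> l /Rabs_def2; lra.
have Hx' : Rabs (w x - a) < e * (a * a) / 2 by have := Rmin_r (a / 2) (e * (a * a) / 2); lra.
have -> : / w x - / a = - (w x - a) * (/ (w x * a)) by field; lra.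
have wa : 0 < w x * a by apply: Rmult_lt_0_compat; lra.
rewrite Rabs_mult Rabs_Ropp Rabs_inv (Rabs_right (w x * a)); first lra.
apply: (Rmult_lt_reg_r (w x * a)) => //; rewrite Rmult_assoc Rinv_l; first lra.
rewrite Rmult_1_r; apply: Rlt_le_trans Hx' _.
have : a / 2 * a <= w x * a by apply: Rmult_le_compat_r; lra.
by move=> /(Rmult_le_compat_l e _ _ (Rlt_le _ _ e0)); lra.
Qed.

Lemma tendsR_pos (w : X -> R) a : tendsR N w a -> tendsR N (fun x => Rmax 0 (w x)) (Rmax 0 a).
Proof.
apply: (@tendsR_lip (Rmax 0) 1); first lra.
move=> x y; rewrite /Rmax; case: Rle_dec => ?; case: Rle_dec => ?; split_Rabs; lra.
Qed.


Lemma tendsR_gt (w : X -> R) a a' : tendsR N w a -> a' < a -> eventually N (fun x => a' < w x).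
Proof.
move=> H lt; have e0 : 0 < a - a' by lra.
by apply: ev_mono (H _ e0) => x /Rabs_def2; lra.
Qed.

Lemma tends_dist (T : MetricSpace) (F G : X -> T) s t : tends N F s -> tends N G t ->
  tendsR N (fun x => ms_d (F x) (G x)) (ms_d s t).
Proof.
move=> HF HG e e0; have e2 : 0 < e / 2 by lra.
apply: ev_mono (ev_and (HF _ e2) (HG _ e2)) => x [Hs Ht].
have := ms_tri s (F x) (G x); have := ms_tri t s (G x); have := ms_tri (F x) s t; have := ms_tri (G x) (F x) t.
rewrite (ms_sym (F x) s) (ms_sym (G x) t) => ? ? ? ?.
split_Rabs; lra.
Qed.

Lemma tends_cst (T : MetricSpace) (t : T) : tends N (fun _ => t) t.
Proof. by move=> e e0; apply: ev_all => x; rewrite ms_refl. Qed.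

Lemma tends_ext (T : MetricSpace) (F F' : X -> T) t :
  eventually N (fun x => F x = F' x) -> tends N F t -> tends N F' t.
Proof. by move=> E H e /H H1; apply: ev_mono (ev_and E H1) => x [->]. Qed.

End Bases.

Lemma seq_d_lub (z z' : nat -> R) :
  {m | is_lub (fun r => exists n, r = Rmin (inv_succ n) (Rabs (z n - z' n))) m}.
Proof.
apply: completeness; last by exists (Rmin (inv_succ 0) (Rabs (z 0%nat - z' 0%nat))), 0%nat.
exists 1 => r [n ->]; apply: Rle_trans (Rmin_l _ _) _.
by have := @inv_succ_anti 0 n (le_0_n n); rewrite /inv_succ /=; lra.
Qed.

(** A metric for the product topology. It depends only on differences of coordinates ([seq_d_diff]),
    so adding the same sequence to two points leaves their distance unchanged. *)
Definition seq_d (z z' : nat -> R) : R := proj1_sig (seq_d_lub z z').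

Lemma seq_d_ge z z' n : Rmin (inv_succ n) (Rabs (z n - z' n)) <= seq_d z z'.
Proof. by rewrite /seq_d; case: (seq_d_lub z z') => m [H _] /=; apply: H; exists n. Qed.

Lemma seq_d_le z z' r : (forall n, Rmin (inv_succ n) (Rabs (z n - z' n)) <= r) -> seq_d z z' <= r.
Proof. by move=> Hr; rewrite /seq_d; case: (seq_d_lub z z') => m [_ H] /=; apply: H => s [n ->]. Qed.

Lemma seq_d_metric : is_metric seq_d.
Proof.
split; [|split; [|split]].
- move=> z z'; apply: Rle_trans (seq_d_ge z z' 0); apply: Rmin_glb; last exact: Rabs_pos.
  by have := inv_succ_pos 0; lra.
- move=> z z'; split => [H|<-].
    apply: functional_extensionality => n; have := seq_d_ge z z' n; rewrite H.
    have := inv_succ_pos n; rewrite /Rmin; case: Rle_dec => ? ? ?; first lra.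
    split_Rabs; lra.
  apply: Rle_antisym.
    apply: seq_d_le => n; rewrite Rminus_diag Rabs_R0; exact: Rmin_r.
  apply: Rle_trans (seq_d_ge z z 0); apply: Rmin_glb; last exact: Rabs_pos.
  by have := inv_succ_pos 0; lra.
- move=> z z'; apply: Rle_antisym; apply: seq_d_le => n; rewrite Rabs_minus_sym; exact: seq_d_ge.
- move=> x y z; apply: seq_d_le => n.
  have := seq_d_ge x y n; have := seq_d_ge y z n; have := inv_succ_pos n.
  have := Rabs_triang (x n - y n) (y n - z n).
  have -> : x n - y n + (y n - z n) = x n - z n by ring.
  have := Rabs_pos (x n - y n); have := Rabs_pos (y n - z n).
  rewrite /Rmin; do 3 case: Rle_dec => ?; lra.
Qed.

Definition Seq : MetricSpace := {| ms_d := seq_d; ms_metric := seq_d_metric |}.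

Lemma seq_d_diff (z z' w w' : Seq) : (forall n, z n - z' n = w n - w' n) -> ms_d z z' = ms_d w w'.
Proof.
move=> E; apply: Rle_antisym; apply: seq_d_le => n; first by rewrite E; apply: seq_d_ge.
by rewrite -E; apply: seq_d_ge.
Qed.

Lemma seq_d_small e : 0 < e -> exists N, forall z z' : Seq,
  (forall n, (n < N)%nat -> Rabs (z n - z' n) < e) -> ms_d z z' <= e.
Proof.
move=> e0; have [N HN] := inv_succ_small e0; exists N => z z' H; apply: seq_d_le => n.
have [nN|nN] : (n < N)%nat \/ (N <= n)%nat by lia.
  by apply: Rle_trans (Rmin_r _ _) _; have := H n nN; lra.
by apply: Rle_trans (Rmin_l _ _) _; have := HN n nN; lra.
Qed.

Lemma seq_d_coord n e : 0 < e -> exists d, 0 < d /\ forall z z' : Seq, ms_d z z' < d -> Rabs (z n - z' n) < e.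
Proof.
move=> e0; exists (Rmin (inv_succ n) e); split.
  by apply: Rmin_glb_lt => //; apply: inv_succ_pos.
move=> z z' H; have := seq_d_ge z z' n; move: H; rewrite /= /Rmin.
by do 2 case: Rle_dec => ?; lra.
Qed.

Section BasesSeq.
Variables (X : Type) (N : R -> X -> Prop).
Hypothesis baseN : filter_base N.

Lemma tends_seq (F : X -> Seq) (z : Seq) : (forall n, tendsR N (fun x => F x n) (z n)) -> tends N F z.
Proof.
move=> H e e0; have e2 : 0 < e / 2 by lra.
have [m Hm] := seq_d_small e2.
have := ev_nat baseN (n := m) (fun i _ => H i _ e2).
apply: ev_mono => x Hx; have := Hm z (F x); case=> [i im||]; try lra.
by rewrite Rabs_minus_sym; apply: Hx.
Qed.

Lemma tends_coord (F : X -> Seq) (z : Seq) n : tends N F z -> tendsR N (fun x => F x n) (z n).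
Proof.
move=> H e /(seq_d_coord n) [d [d0 Hd]]; apply: ev_mono (H _ d0) => x /Hd.
by rewrite Rabs_minus_sym.
Qed.
End BasesSeq.

Definition cube (z : Seq) : Prop := forall n, 0 <= z n <= 1.

(** The limit is the supremum of the numbers that are at most [u j] for almost all [j]. *)
Lemma unit_ulim (u : nat -> R) : (forall j, 0 <= u j <= 1) ->
  exists x, 0 <= x <= 1 /\ forall e, 0 < e -> uf (fun j => Rabs (x - u j) < e).
Proof.
move=> Hu.
have [||x [ubx lubx]] := @completeness (fun r => uf (fun j => r <= u j)).
- by exists 1 => r /uf_ex [j]; have := Hu j; lra.
- by exists 0; apply: ufT => j; have := Hu j; lra.
exists x; split.
  split; first by apply: ubx; apply: ufT => j; have := Hu j; lra.
  by apply: lubx => r /uf_ex [j]; have := Hu j; lra.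
move=> e e0.
have Hup : uf (fun j => u j < x + e).
  have [H|] := uf_dich (fun j => x + e <= u j); first by have := ubx _ H; lra.
  by apply: ufW => j; lra.
have Hlo : uf (fun j => x - e < u j).
  apply: NNPP => nH; have : x <= x - e; last lra.
  apply: lubx => r Hr; apply: Rnot_lt_le => lt; apply: nH; apply: ufW Hr => j; lra.
by apply: ufW (uf_and Hup Hlo) => j [? ?]; split_Rabs; lra.
Qed.

Lemma cube_ucpt : ucpt cube.
Proof.
move=> u Hu.
have [x Hx] := choice _ (fun n => unit_ulim (fun j => Hu j n)).
exists x; split; first by move=> n; case: (Hx n).
move=> e e0; have e2 : 0 < e / 2 by lra.
have [N HN] := seq_d_small e2.
have H m : uf (fun j => forall n, (n < m)%nat -> Rabs (x n - u j n) < e / 2).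
  elim: m => [|m IH]; first by apply: ufT => j n; lia.
  have [_ H] := Hx m; apply: ufW (uf_and IH (H _ e2)) => j [H1 H2] n nm.
  have [/H1|->] : (n < m)%nat \/ n = m by lia.
    by [].
  by [].
by apply: ufW (H N) => j /HN; lra.
Qed.

(** * Partitions of unity on metric spaces *)

(** Take the supremum of [r - ms_d x0 x] over the balls, of radius [r] at most 1, on which [r] is
    valid. It is 1-Lipschitz; it need not be attained, hence the factor 1/2. This turns local radii
    into a continuous tolerance. *)
Lemma lipschitz_minorant (X : MetricSpace) (P : X -> R -> Prop) :
  (forall x r s, 0 < s -> s <= r -> P x r -> P x s) ->
  (forall x0, exists r, 0 < r /\ forall x, ms_d x0 x < r -> P x r) ->
  exists sg : X -> R, (forall x, 0 < sg x <= 1) /\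
    (forall x x', Rabs (sg x - sg x') <= ms_d x x') /\ forall x, P x (sg x).
Proof.
move=> mono loc.
pose E x s := exists x0 r, (0 < r /\ r <= 1 /\ forall x', ms_d x0 x' < r -> P x' r) /\ s = r - ms_d x0 x.
have E1 x s : E x s -> s <= 1 by move=> [x0 [r [[? [? _]] ->]]]; have := ms_ge0 x0 x; lra.
have Epos x : exists s, 0 < s /\ E x s.
  have [r [r0 Hr]] := loc x; exists (Rmin r 1); have m0 : 0 < Rmin r 1 by apply: Rmin_glb_lt; lra.
  split => //; exists x, (Rmin r 1); split; last by rewrite ms_refl; ring.
  split => //; split; first exact: Rmin_r.
  by move=> x' xx'; apply: mono (Hr x' _) => //; [apply: Rmin_l | have := Rmin_l r 1; lra].
have lub x : exists m, is_lub (E x) m.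
  have [||m Hm] := @completeness (E x); last by exists m.
  - by exists 1 => s /E1.
  - by have [s [_ Hs]] := Epos x; exists s.
have [S HS] := choice _ lub.
have Sge x s : E x s -> s <= S x by have [H _] := HS x; apply: H.
have Sle x b : (forall s, E x s -> s <= b) -> S x <= b by have [_ H] := HS x; apply: H.
have Spos x : 0 < S x by have [s [s0 /Sge]] := Epos x; lra.
have lip x x' : S x <= S x' + ms_d x x'.
  apply: Sle => s [x0 [r [H ->]]]; have : r - ms_d x0 x' <= S x' by apply: Sge; exists x0, r.
  by have := ms_tri x x0 x'; lra.
exists (fun x => S x / 2); split; [|split].
- by move=> x; have := Spos x; have := Sle x 1 (@E1 x); lra.
- by move=> x x'; have := lip x x'; have := lip x' x; have := ms_ge0 x x'; rewrite (ms_sym x' x); split_Rabs; lra.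
- move=> x; have S0 := Spos x.
  have [s [[x0 [r [[r0 [r1 H]] ->]]] big]] : exists s, E x s /\ S x / 2 < s.
    apply: NNPP => ns; have : S x <= S x / 2; last lra.
    by apply: Sle => s Es; apply: Rnot_lt_le => lt; apply: ns; exists s.
  by apply: mono (H x _); [lra | have := ms_ge0 x0 x; lra | lra].
Qed.

Section Perfect.
Variables (X Y : MetricSpace) (f : X -> Y).
Hypothesis Hf : perfect_map f.

Lemma perfect_tube (O : X -> Prop) y : open_set (@ms_d X) O -> (forall x, f x = y -> O x) ->
  exists r, 0 < r /\ forall x, ms_d y (f x) < r -> O x.
Proof.
move=> oO yO; have [_ [cl _]] := Hf.
have cF : closed_set (@ms_d X) (fun x => ~ O x).
  move=> x /NNPP Ox; have [e [e0 He]] := oO x Ox; exists e; split => // z /He Oz nO; exact: nO.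
have [|r [r0 Hr]] := cl _ cF y; first by move=> [x [nO /yO]].
exists r; split => // x xr; apply: NNPP => nO; apply: (Hr (f x) xr); by exists x.
Qed.

(** Otherwise the compact fibre is covered by finitely many balls, each containing [u j] for a null
    set of [j] only; since [f] is closed, the balls also cover a tube around the fibre, where almost
    all [u j] lie. *)
Lemma perfect_ulim (u : nat -> X) y : ulim (fun j => f (u j)) y -> exists x, f x = y /\ ulim u x.
Proof.
move=> uy; apply: NNPP => nx; have [cf [_ /(_ y) ck]] := Hf.
have H x : fiber f y x -> exists e, 0 < e /\ ~ uf (fun j => ms_d x (u j) < e).
  move=> fx; apply: NNPP => ne; apply: nx; exists x; split => // e e0.
  by apply: NNPP => nu; apply: ne; exists e.
pose I := {p : X * R | 0 < snd p /\ ~ uf (fun j => ms_d (fst p) (u j) < snd p)}.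
pose U (i : I) x := ms_d (fst (proj1_sig i)) x < snd (proj1_sig i).
have [||l Hl] := ck I U.
- by move=> i; apply: open_ball.
- move=> x /H [e [e0 He]]; exists (exist _ (x, e) (conj e0 He)).
  by rewrite /U /= ms_refl.
have [||r [r0 Hr]] := @perfect_tube (fun x => exists i, In i l /\ U i x) y.
- move=> x [i [il Ui]]; have [e [e0 He]] := open_ball Ui.
  by exists e; split => // z /He Uz; exists i.
- by move=> x /Hl.
have [|[[x e] /= [e0 ne]] [_ ue]] := @uf_list I (fun i j => U i (u j)) l.
  by apply: ufW (uy _ r0) => j; apply: Hr.
exact (ne ue).
Qed.

Lemma fiber_ucpt y : ucpt (fiber f y).
Proof. by have [_ [_ H]] := Hf; apply: compact_ucpt. Qed.
End Perfect.

(** The function [c n] collects the weights of the whole [n]-th discrete family, and [idx n y] names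
    the member active at [y]; a vertex is a pair of [n] and a name. The weights are normalised to
    have maximum 1, not sum 1. *)
Record partition_data (Y : MetricSpace) (U : Y -> Y -> Prop) (c : nat -> Y -> R) (idx : nat -> Y -> Y) : Prop := {
  pd_unit : forall n y, 0 <= c n y <= 1;
  pd_one : forall y, exists n, c n y = 1;
  pd_loc : forall y, exists r N s, 0 < r /\ forall y', ms_d y y' < r -> forall n, 0 < c n y' ->
    (n < N)%nat /\ idx n y' = s n;
  pd_cont : forall n y, tendsR (ball_base y) (c n) (c n y);
  pd_sub : forall n y, 0 < c n y -> U (idx n y) y }.

Lemma sup_family (I Y : Type) (F : I -> Y -> R) b : inhabited I ->
  (forall i y, F i y <= b) -> exists S : Y -> R, (forall i y, F i y <= S y) /\
    (forall y m, (forall i, F i y <= m) -> S y <= m).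
Proof.
move=> [i0] Fb.
have [S HS] : exists S : Y -> R, forall y, is_lub (fun r => exists i, r = F i y) (S y).
  apply: (choice (fun y m => is_lub (fun r => exists i, r = F i y) m)) => y.
  have [||m Hm] := @completeness (fun r => exists i, r = F i y); last by exists m.
    by exists b => r [i ->].
  by exists (F i0 y), i0.
exists S; split.
- by move=> i y; have [H _] := HS y; apply: H; exists i.
- by move=> y m H; have [_ H'] := HS y; apply: H' => r [i ->].
Qed.

(* Given a well-order on the indices, let [A n] be the set of the [a] whose ball of radius [1/(n+1)]
   lies in the least [U i] containing [a]: two points of [A n] with distinct least
   indices are at distance at least [1/(n+1)], so that each [A n] is a discrete union. *)
Lemma partition_exists (Y : MetricSpace) (U : Y -> Y -> Prop) :
  (forall i, open_set (@ms_d Y) (U i)) -> (forall y, exists i, U i y) ->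
  exists c idx, partition_data U c idx.
Proof.
move=> oU cov.
have [le [anti least]] := least_selection Y.
have [io Hio] := choice _ (fun y => least (fun i => U i y) (cov y)).
pose A n a := forall y, ms_d a y < inv_succ n -> U (io a) y.
have same n a a' : A n a -> A n a' -> ms_d a a' < inv_succ n -> io a = io a'.
  move=> Aa Aa' aa'; apply: anti.
    by have [_ H] := Hio a; apply: H; apply: Aa'; rewrite ms_sym.
  by have [_ H] := Hio a'; apply: H; apply: Aa.
(* The bumps have radius a quarter of the gap [inv_succ n]. Hence bumps with distinct indices stay
   apart, and the index is constant among active points closer than another quarter. *)
have [phi Hphi] : exists phi : nat -> Y -> R, forall n,
    (forall a y, A n a -> inv_succ n / 4 - ms_d a y <= phi n y) /\ (forall y, 0 <= phi n y) /\
    (forall y m, 0 <= m -> (forall a, A n a -> inv_succ n / 4 - ms_d a y <= m) -> phi n y <= m).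
  apply: (choice (fun n phi => (forall a y, A n a -> inv_succ n / 4 - ms_d a y <= phi y) /\ (forall y, 0 <= phi y) /\
    (forall y m, 0 <= m -> (forall a, A n a -> inv_succ n / 4 - ms_d a y <= m) -> phi y <= m))) => n.
  have [|i y|S [S1 S2]] := @sup_family (option {a | A n a}) Y
    (fun i y => match i with None => 0 | Some a => inv_succ n / 4 - ms_d (proj1_sig a) y end) (inv_succ n / 4).
  - exact: inhabits None.
  - by case: i => [[a /= _]|]; [have := ms_ge0 a y; lra | have := inv_succ_pos n; lra].
  exists S; split; [|split].
  - by move=> a y Aa; apply: (S1 (Some (exist _ a Aa))).
  - by move=> y; apply: (S1 None).
  - by move=> y m m0 H; apply: S2; case=> [[a Aa]|] //=; apply: H.
have phi0 n y : 0 <= phi n y by have [_ [H _]] := Hphi n.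
have phi_le n y : phi n y <= inv_succ n / 4.
  have [_ [_ H]] := Hphi n; apply: H; first by have := inv_succ_pos n; lra.
  by move=> a _; have := ms_ge0 a y; lra.
have phi_lip n y y' : phi n y <= phi n y' + ms_d y y'.
  have [H1 [_ H]] := Hphi n; apply: H; first by have := phi0 n y'; have := ms_ge0 y y'; lra.
  by move=> a /(H1 a y'); have := ms_tri y a y'; lra.
have phi_pos n y : 0 < phi n y -> exists a, A n a /\ ms_d a y < inv_succ n / 4.
  move=> pos; apply: NNPP => na; have [_ [_ H]] := Hphi n; have : phi n y <= 0; last lra.
  apply: H => [|a Aa]; first lra; apply: Rnot_lt_le => lt; apply: na; exists a; split => //; lra.
have [idx Hidx] : exists idx : nat -> Y -> Y, forall n y, 0 < phi n y ->
    exists a, (A n a /\ ms_d a y < inv_succ n / 4) /\ idx n y = io a.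
  apply: (choice (fun n (idx : Y -> Y) => forall y, 0 < phi n y -> exists a, (A n a /\ ms_d a y < inv_succ n / 4) /\ idx y = io a)) => n.
  apply: (choice (fun y i => 0 < phi n y -> exists a, (A n a /\ ms_d a y < inv_succ n / 4) /\ i = io a)) => y.
  have [/phi_pos [a Ha]|np] := classic (0 < phi n y); last by exists y.
  by exists (io a) => _; exists a.
have idx_loc n y y' : 0 < phi n y -> 0 < phi n y' -> ms_d y y' < inv_succ n / 4 -> idx n y = idx n y'.
  move=> /Hidx [a [[Aa ay] ->]] /Hidx [a' [[Aa' ay'] ->]] yy'; apply: (same n) => //.
  have := ms_tri y a a'; have := ms_tri y' y a'; rewrite (ms_sym y' a'); have := inv_succ_pos n; lra.
have [|n y|S [S1 S2]] := @sup_family nat Y phi 1.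
- exact: inhabits 0%nat.
- have E : inv_succ 0 = 1 by rewrite /inv_succ /=; lra.
  by have := phi_le n y; have := @inv_succ_anti 0 n (le_0_n n); lra.
have Spos y : 0 < S y.
  have [Uy _] := Hio y; have [e [e0 He]] := oU _ y Uy.
  have [n Hn] := inv_succ_small e0.
  have Ay : A n y by move=> z yz; apply: He; have := Hn n (le_n _); lra.
  have [H _] := Hphi n; have := H y y Ay; rewrite ms_refl; have := S1 n y; have := inv_succ_pos n; lra.
have S_lip y y' : S y <= S y' + ms_d y y'.
  by apply: S2 => n; have := phi_lip n y y'; have := S1 n y'; lra.
(* [clamp] truncates to the unit interval, written with [Rmax 0] alone so that [tendsR_pos] applies.
   The weight [c n] is positive only where [phi n] exceeds half of the supremum [S], which forces
   local finiteness since [phi n] tends to 0 uniformly; it is 1 from three quarters of [S] on. *)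
pose clamp x := Rmax 0 (1 - Rmax 0 (1 - x)).
pose c n y := clamp (4 * (phi n y * / S y) - 2).
have c_pos n y : 0 < c n y -> S y / 2 < phi n y.
  move=> c0; apply: Rnot_le_lt => le2; move: c0; rewrite /c /clamp.
  have : phi n y * / S y <= / 2; last by rewrite /Rmax; do 2 case: Rle_dec; lra.
  apply: (Rmult_le_reg_r (S y)) => //; rewrite Rmult_assoc Rinv_l; have := Spos y; lra.
have lipc (F : Y -> R) y : (forall y y', F y <= F y' + ms_d y y') -> tendsR (ball_base y) F (F y).
  move=> H e e0; exists e; split => // y'; rewrite /ball_base => yy'.
  by have := H y y'; have := H y' y; rewrite (ms_sym y' y); split_Rabs; lra.
exists c, idx; split.
- by move=> n y; rewrite /c /clamp /Rmax; do 2 case: Rle_dec; lra.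
- move=> y; have S0 := Spos y.
  have [n Hn] : exists n, 3 / 4 * S y < phi n y.
    apply: NNPP => nn; have : S y <= 3 / 4 * S y; last lra.
    by apply: S2 => n; apply: Rnot_lt_le => lt; apply: nn; exists n.
  exists n; rewrite /c /clamp; have : 3 / 4 <= phi n y * / S y.
    apply: (Rmult_le_reg_r (S y)) => //; rewrite Rmult_assoc Rinv_l; lra.
  by rewrite /Rmax; do 2 case: Rle_dec; lra.
- move=> y; have S0 := Spos y; have [N HN] := inv_succ_small S0.
  pose r := Rmin (S y / 4) (inv_succ N / 8).
  have r0 : 0 < r by apply: Rmin_glb_lt; have := inv_succ_pos N; lra.
  have rS : r <= S y / 4 by apply: Rmin_l.
  have rN : r <= inv_succ N / 8 by apply: Rmin_r.
  have [s Hs] : exists s : nat -> Y, forall n, (exists y', ms_d y y' < r /\ 0 < phi n y') ->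
      exists y', (ms_d y y' < r /\ 0 < phi n y') /\ idx n y' = s n.
    apply: (choice (fun n s => (exists y', ms_d y y' < r /\ 0 < phi n y') ->
      exists y', (ms_d y y' < r /\ 0 < phi n y') /\ idx n y' = s)) => n.
    have [[y' H]|nH] := classic (exists y', ms_d y y' < r /\ 0 < phi n y'); last by exists y.
    by exists (idx n y') => _; exists y'.
  exists r, N, s; split => // y' yy' n /c_pos big.
  have Sy' : 3 / 4 * S y <= S y' by have := S_lip y y'; lra.
  have nN : (n < N)%nat.
    by apply: (proj1 (Nat.nle_gt _ _)) => /HN; have := phi_le n y'; lra.
  split => //.
  have pos : 0 < phi n y' by lra.
  have [|y'' [[yy'' pos''] <-]] := Hs n; first by exists y'.
  apply: idx_loc => //; have := ms_tri y y' y''; rewrite (ms_sym y' y).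
  have := @inv_succ_anti n N; case; [lia | lra | lra].
- move=> n y; rewrite /c /clamp; have bb := ball_base_mono (x0 := y).
  apply: tendsR_pos; apply: tendsR_sub; [exact: bb | exact: tendsR_cst |].
  apply: tendsR_pos; apply: tendsR_sub; [exact: bb | exact: tendsR_cst |].
  apply: tendsR_sub; [exact: bb | | exact: tendsR_cst].
  apply: tendsR_mul; [exact: bb | exact: tendsR_cst |].
  apply: tendsR_mul; [exact: bb | apply: lipc; exact: phi_lip |].
  by apply: tendsR_inv => //; apply: lipc.
- move=> n y /c_pos; have := Spos y => ? ?; have [|a [[Aa ay] ->]] := Hidx n y; first lra.
  by apply: Aa; have := inv_succ_pos n; lra.
Qed.

(** * Fibrewise embedding into the Hilbert cube *)

Lemma tendsR_comp_ball (X Y : MetricSpace) (f : X -> Y) (w : Y -> R) x0 : continuous f ->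
  tendsR (ball_base (f x0)) w (w (f x0)) -> tendsR (ball_base x0) (fun x => w (f x)) (w (f x0)).
Proof.
move=> cf H e /H [d [d0 Hd]]; have [d' [d'0 Hd']] := cf x0 d d0.
by exists d'; split => // x /Hd' /Hd.
Qed.

(** The coordinates measure distances to points of finite nets of fibres, with one net for each
    member of a cover of [Y] at each scale, cut off by the weights of that cover. The even
    coordinates are reserved for the weights that [chart] inserts. *)
Lemma fiber_embedding (X Y : MetricSpace) (f : X -> Y) : perfect_map f ->
  exists p : X -> Seq, continuous p /\ (forall x, cube (p x)) /\
    (forall x n, Nat.odd n = false -> p x n = 0) /\
    (forall x x', f x = f x' -> p x = p x' -> x = x').
Proof.
move=> Hf; have cf := proj1 Hf.
have [l Hl] : exists l : nat -> Y -> list X, forall m y x, f x = y -> exists a, In a (l m y) /\ ms_d a x < inv_succ m.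
  apply: (choice (fun m (l : Y -> list X) => forall y x, f x = y -> exists a, In a (l y) /\ ms_d a x < inv_succ m)) => m.
  apply: (choice (fun y l => forall x, f x = y -> exists a, In a l /\ ms_d a x < inv_succ m)) => y.
  have [l [_ H]] := ucpt_net (fiber_ucpt Hf (y := y)) (inv_succ_pos m).
  by exists l.
(* The points around which the net chosen for the fibre over [i] still approximates all fibres up to
   [inv_succ m]. *)
pose U m i y' := exists r, 0 < r /\ forall x, ms_d y' (f x) < r -> exists a, In a (l m i) /\ ms_d a x < inv_succ m.
have oU m i : open_set (@ms_d Y) (U m i).
  move=> y [r [r0 Hr]]; exists (r / 2); split; first lra.
  move=> z yz; exists (r / 2); split; first lra.
  by move=> x zx; apply: Hr; have := ms_tri z y (f x); lra.
have cov m y : exists i, U m i y.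
  exists y; apply: (perfect_tube Hf); last by move=> x; apply: Hl.
  move=> x [a [la ax]]; have [e [e0 He]] := open_ball ax; exists e; split => // z /He az.
  by exists a.
have [cidx Hc] : exists cidx : nat -> (nat -> Y -> R) * (nat -> Y -> Y),
    forall m, partition_data (U m) (fst (cidx m)) (snd (cidx m)).
  apply: (choice (fun m cidx => partition_data (U m) (fst cidx) (snd cidx))) => m.
  by have [c [idx H]] := partition_exists (oU m) (cov m); exists (c, idx).
pose c m := fst (cidx m); pose idx m := snd (cidx m).
pose psi m (o : option X) x := match o with Some a => Rmax 0 (inv_succ m - ms_d a x / 2) | None => 0 end.
pose G m n i x := c m n (f x) * psi m (nth_error (l m (idx m n (f x))) i) x.
pose dec k := let mq := Cantor.of_nat k in (fst mq, Cantor.of_nat (snd mq)).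
pose p x : Seq := fun j => if Nat.odd j then
  let mq := dec (Nat.div2 j) in G (fst mq) (fst (snd mq)) (snd (snd mq)) x else 0.
have psi01 m o x : 0 <= psi m o x <= 1.
  case: o => [a|] /=; last lra; split; first exact: Rmax_l.
  apply: Rmax_lub; first lra; have := ms_ge0 a x; have := @inv_succ_anti 0 m (le_0_n m).
  have E : inv_succ 0 = 1 by rewrite /inv_succ /=; lra.
  by lra.
have G01 m n i x : 0 <= G m n i x <= 1.
  have [c0 c1] := pd_unit (Hc m) n (f x); have := psi01 m (nth_error (l m (idx m n (f x))) i) x.
  rewrite /G /c; move: (fst (cidx m) n (f x)) c0 c1 (psi m _ x) => u u0 u1 v [v0 v1]; nra.
exists p; split; [|split; [|split]].
- apply/continuousP => x0; apply: tends_seq; first exact: ball_base_mono.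
  move=> j; rewrite /p; case: (Nat.odd j); last exact: tendsR_cst.
  move: (dec _) => [m [n i]] /=.
  have [r [N [s [r0 Hs]]]] := pd_loc (Hc m) (f x0).
  have [d [d0 Hd]] := cf x0 r r0.
  have near x : ms_d x0 x < d -> c m n (f x) * psi m (nth_error (l m (s n)) i) x = G m n i x.
    move=> /Hd xr; rewrite /G; have [c0 _] := pd_unit (Hc m) n (f x).
    case: c0 => [/(Hs _ xr) [_ <-] //|]; rewrite -/(c m) => <-; ring.
  have bb := ball_base_mono (x0 := x0).
  apply: (tendsR_ext bb (w := fun x => c m n (f x) * psi m (nth_error (l m (s n)) i) x)).
    by exists d; split => // x /near.
  rewrite -near; first by rewrite ms_refl.
  apply: tendsR_mul => //; first by apply: tendsR_comp_ball => //; apply: pd_cont (Hc m) _ _.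
  case: (nth_error _ i) => [a|] /=; last exact: tendsR_cst.
  apply: tendsR_pos; apply: tendsR_sub => //; first exact: tendsR_cst.
  apply: tendsR_mul => //; last exact: tendsR_cst.
  by apply: tends_dist => //; [exact: tends_cst | move=> e e0; exists e].
- move=> x j; rewrite /p; case: (Nat.odd j); [exact: G01 | lra].
- by move=> x n; rewrite /p => ->.
- move=> x x' ff pp; apply: NNPP => ne.
  have dpos : 0 < ms_d x x' / 4.
    by case: (ms_ge0 x x') => [|E]; [lra | case: ne; apply: ms_eq].
  (* At this scale a net point [a] near [x] is farther than [2 * inv_succ m] from [x'], so its
     coordinate is positive at [x] and zero at [x']. *)
  have [m Hm] := inv_succ_small dpos; have {Hm} small := Hm m (le_n _).
  have [n cn] := pd_one (Hc m) (f x).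
  have [r [r0 Hr]] : U m (idx m n (f x)) (f x) by apply: (pd_sub (Hc m)); rewrite cn; lra.
  have [|a [la ax]] := Hr x; first by rewrite ms_refl.
  have [i Hi] := In_nth_error _ _ la.
  have : p x (2 * Cantor.to_nat (m, Cantor.to_nat (n, i)) + 1)%nat = p x' (2 * Cantor.to_nat (m, Cantor.to_nat (n, i)) + 1)%nat by rewrite pp.
  rewrite /p Nat.odd_odd Nat.add_1_r Nat.div2_succ_double /dec !Cantor.cancel_of_to /=.
  rewrite ?Cantor.cancel_of_to /= /G -ff Hi /= /c cn /Rmax.
  have := ms_tri a x x'; rewrite (ms_sym x a).
  by have := inv_succ_pos m; do 2 case: Rle_dec; lra.
Qed.

(** * Local averages *)

(* [nle x r] reads: the norm of [x] is at most [r]; it is a relation so that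
   the space of all real functions, with the sup norm, is an instance. *)
Record bound_space := {
  vec :> Type;
  vzero : vec;
  vadd : vec -> vec -> vec;
  vscal : R -> vec -> vec;
  nle : vec -> R -> Prop;
  vaddA : forall x y z, vadd x (vadd y z) = vadd (vadd x y) z;
  vaddC : forall x y, vadd x y = vadd y x;
  vadd0 : forall x, vadd x vzero = x;
  vaddN : forall x, vadd x (vscal (-1) x) = vzero;
  vscal1 : forall x, vscal 1 x = x;
  vscalA : forall a b x, vscal a (vscal b x) = vscal (a * b) x;
  vscalDl : forall a b x, vscal (a + b) x = vadd (vscal a x) (vscal b x);
  vscalDr : forall a x y, vscal a (vadd x y) = vadd (vscal a x) (vscal a y);
  nle_mono : forall x r s, nle x r -> r <= s -> nle x s;
  nle_add : forall x y r s, nle x r -> nle y s -> nle (vadd x y) (r + s);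
  nle_scal : forall a x r, nle x r -> nle (vscal a x) (Rabs a * r) }.

Arguments vzero {_}.
Arguments vadd {_} _ _.
Arguments vscal {_} _ _.
Arguments nle {_} _ _.

Definition vsub {V : bound_space} (x y : V) : V := vadd x (vscal (-1) y).

Section VectorAlgebra.
Variable V : bound_space.
Implicit Types x y : V.

Lemma vscal0 x : vscal 0 x = vzero.
Proof.
have -> : 0 = 1 + -1 by ring.
by rewrite vscalDl vscal1 vaddN.
Qed.

Lemma vadd4 x y x' y' : vadd (vadd x y) (vadd x' y') = vadd (vadd x x') (vadd y y').
Proof. by rewrite -!vaddA (vaddA y) (vaddC y) -vaddA. Qed.

Lemma vsubD x y x' y' : vsub (vadd x y) (vadd x' y') = vadd (vsub x x') (vsub y y').
Proof. by rewrite /vsub vscalDr vadd4. Qed.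

Lemma vsub_scal a b x y : vsub (vscal a x) (vscal b y) = vadd (vscal a (vsub x y)) (vscal (a - b) y).
Proof.
rewrite /vsub vscalDr !vscalA -vaddA -vscalDl.
by have -> : a * -1 + (a - b) = -1 * b by ring.
Qed.

Lemma vsub_scal_same a x y : vsub (vscal a x) (vscal a y) = vscal a (vsub x y).
Proof. by rewrite vsub_scal Rminus_diag vscal0 vadd0. Qed.
End VectorAlgebra.

Section Averages.
Variables (M : MetricSpace) (V : bound_space) (em : M -> V).

Fixpoint wsum (l : list (R * M)) : V :=
  match l with nil => vzero | wm :: l => vadd (vscal (fst wm) (em (snd wm))) (wsum l) end.

Fixpoint wtot (l : list (R * M)) : R :=
  match l with nil => 0 | wm :: l => fst wm + wtot l end.

Definition wavg l : V := vscal (/ wtot l) (wsum l).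

Definition weighted (l : list (R * M)) : Prop := (forall wm, In wm l -> 0 <= fst wm) /\ 0 < wtot l.

(** Entries of weight 0 are unconstrained, so a list of fixed shape can stay clustered while its
    weights vary continuously. *)
Definition clustered (m : M) (dl : R) (l : list (R * M)) : Prop :=
  forall wm, In wm l -> 0 < fst wm -> ms_d m (snd wm) <= dl.

End Averages.

Lemma wavg_near (M : MetricSpace) (V : bound_space) (em : M -> V) m dl l : (forall m m', nle (vsub (em m') (em m)) (ms_d m m')) -> 0 <= dl -> weighted l -> clustered m dl l -> nle (vsub (wavg em l) (em m)) dl.
Proof.
move=> lip dl0 [wl pos] cl.
have key : nle (vsub (wsum em l) (vscal (wtot l) (em m))) (wtot l * dl).
  elim: l wl cl {pos} => [|[w m'] l IH] wl cl /=.
    have := nle_scal 0 (lip m m); rewrite 2!vscal0 /vsub vaddN.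
    by move=> hz; apply: nle_mono hz _; rewrite Rabs_R0; lra.
  rewrite vscalDl vsubD vsub_scal_same Rmult_plus_distr_r; apply: nle_add.
    have w0 : 0 <= w by apply: (wl (w, m')); left.
    apply: nle_mono (nle_scal w (lip m m')) _; rewrite (Rabs_right w); first lra.
    case: w0 => [w0|<-]; last lra.
    by apply: Rmult_le_compat_l; [lra | apply: (cl (w, m')) => //; left].
  by apply: IH => wm iwm; [apply: wl | apply: cl]; right.
have -> : em m = vscal (/ wtot l) (vscal (wtot l) (em m)).
  by rewrite vscalA Rinv_l ?vscal1 //; lra.
rewrite /wavg vsub_scal_same; apply: nle_mono (nle_scal _ key) _.
have i0 := Rinv_0_lt_compat _ pos; rewrite Rabs_right; first lra.
by rewrite -Rmult_assoc Rinv_l; lra.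
Qed.

(** The common content of the two hypotheses on [M]: an embedding [em] into a vector space, a left
    inverse [r] continuous on [D], and averages of clustered points landing in [D]. As [nle] may
    fail to bound a vector at all, [av_bdd] supplies the bounds behind the continuity of scalar
    multiplication. *)
Record averaging (M : MetricSpace) (V : bound_space) (em : M -> V) (D : V -> Prop) (r : V -> M) : Prop := {
  av_bdd : forall m, exists C, nle (em m) C;
  av_lip : forall m m', nle (vsub (em m') (em m)) (ms_d m m');
  av_id : forall m, r (em m) = m;
  av_cont : forall b e, D b -> 0 < e -> exists d, 0 < d /\
    forall b', D b' -> nle (vsub b' b) d -> ms_d (r b) (r b') < e;
  av_dom : forall m, exists dl, 0 < dl /\
    forall l, weighted l -> clustered m dl l -> D (wavg em l) }.

Section AveragingTheory.
Variables (M : MetricSpace) (V : bound_space) (em : M -> V) (D : V -> Prop) (r : V -> M).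
Hypothesis H : averaging em D r.

Lemma wsum_cat l l' : wsum em (l ++ l') = vadd (wsum em l) (wsum em l').
Proof.
elim: l => [|wm l IH] /=; first by rewrite vaddC vadd0.
by rewrite IH vaddA.
Qed.

Lemma wtot_cat (l l' : list (R * M)) : wtot (l ++ l') = wtot l + wtot l'.
Proof. by elim: l => [|wm l IH] /=; [ring | rewrite IH; ring]. Qed.

Lemma wtot_ge0 (l : list (R * M)) : (forall wm, In wm l -> 0 <= fst wm) -> 0 <= wtot l.
Proof.
elim: l => [|wm l IH] /= Hl; first lra.
by have := Hl wm (or_introl eq_refl); have := IH (fun wm h => Hl wm (or_intror h)); lra.
Qed.

Lemma wtot_ge (l : list (R * M)) wm : (forall wm, In wm l -> 0 <= fst wm) -> In wm l -> fst wm <= wtot l.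
Proof.
elim: l => [|wm' l IH] // Hl /= [<-|il].
  by have := wtot_ge0 (fun wm h => Hl wm (or_intror h)); lra.
have := IH (fun wm h => Hl wm (or_intror h)) il.
by have := Hl wm' (or_introl eq_refl); lra.
Qed.

Lemma wavg_point m : wavg em ((1, m) :: nil) = em m.
Proof. by rewrite /wavg /= vadd0 vscal1 Rplus_0_r Rinv_1 vscal1. Qed.

Lemma dom_point m : D (em m).
Proof.
have [dl [dl0 Hd]] := av_dom H m; rewrite -wavg_point; apply: Hd.
  by split => [wm [<-|[]]|] /=; lra.
by move=> wm [<-|[]] /= _; rewrite ms_refl; lra.
Qed.

Lemma safe_point m al : 0 < al -> exists dl, 0 < dl /\
  forall l, weighted l -> clustered m dl l -> D (wavg em l) /\ ms_d m (r (wavg em l)) < al.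
Proof.
move=> al0; have [d1 [d10 H1]] := av_dom H m; have [d2 [d20 H2]] := av_cont H (dom_point m) al0.
exists (Rmin d1 d2); split; first exact: Rmin_glb_lt.
move=> l wl cl; have Dl : D (wavg em l).
  by apply: H1 => // wm iwm /(cl wm iwm); have := Rmin_l d1 d2; lra.
split => //; rewrite -{1}(av_id H m); apply: H2 => //.
apply: (wavg_near (av_lip H)) => //; first lra.
by move=> wm iwm /(cl wm iwm); have := Rmin_r d1 d2; lra.
Qed.

Lemma safe_unif (K : M -> Prop) al : ucpt K -> 0 < al -> exists dl, 0 < dl /\
  forall m, K m -> forall l, weighted l -> clustered m dl l ->
    D (wavg em l) /\ ms_d m (r (wavg em l)) < al.
Proof.
move=> cK al0.
apply: (ucpt_lebesgue (P := fun m dl => forall l, weighted l -> clustered m dl l ->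
    D (wavg em l) /\ ms_d m (r (wavg em l)) < al) cK).
  by move=> m d s sd Hd l wl cl; apply: Hd => // wm iwm /(cl wm iwm); lra.
move=> m Km; have al2 : 0 < al / 2 by lra.
have [dl [dl0 Hdl]] := safe_point m al2.
pose s := Rmin (dl / 2) (al / 2); have sl : s <= dl / 2 := Rmin_l _ _; have sr : s <= al / 2 := Rmin_r _ _.
exists s; split; first by apply: Rmin_glb_lt; lra.
move=> m' mm' _ l wl cl; have [|Dl near] := Hdl l wl.
  by move=> wm iwm /(cl wm iwm); have := ms_tri m' m (snd wm); lra.
by split => //; have := ms_tri m m' (r (wavg em l)); rewrite (ms_sym m' m); lra.
Qed.

Lemma avg_constant m l : weighted l -> clustered m 0 l -> r (wavg em l) = m.
Proof.
move=> wl cl; symmetry; apply: ms_eq; apply: Rle_antisym; last exact: ms_ge0.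
apply: Rnot_lt_le => pos; have [dl [dl0 Hdl]] := safe_point m pos.
by have [|_] := Hdl l wl; [move=> wm iwm /(cl wm iwm); lra | lra].
Qed.

Section AverageLimit.
Variables (X : Type) (N : R -> X -> Prop).
Hypothesis baseN : filter_base N.

Definition tendsV (F : X -> V) (v : V) : Prop :=
  forall e, 0 < e -> eventually N (fun x => nle (vsub (F x) v) e).

Lemma tendsV_add F G v w : tendsV F v -> tendsV G w -> tendsV (fun x => vadd (F x) (G x)) (vadd v w).
Proof.
move=> HF HG e e0; have e2 : 0 < e / 2 by lra.
apply: ev_mono (ev_and baseN (HF _ e2) (HG _ e2)) => x [h1 h2].
by rewrite vsubD; apply: nle_mono (nle_add h1 h2) _; lra.
Qed.

Lemma tendsV_scal (w : X -> R) a F v C : nle v C -> tendsR N w a -> tendsV F v ->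
  tendsV (fun x => vscal (w x) (F x)) (vscal a v).
Proof.
move=> vC Hw HF e e0.
have C'0 : 0 < Rabs C + 1 by have := Rabs_pos C; lra.
have d0 : 0 < e / 2 / (Rabs C + 1) by apply: Rdiv_lt_0_compat; lra.
have A0 : 0 < Rabs a + 1 by have := Rabs_pos a; lra.
have d1 : 0 < e / 2 / (Rabs a + 1) by apply: Rdiv_lt_0_compat; lra.
apply: ev_mono (ev_and baseN (ev_and baseN (Hw _ d0) (Hw _ Rlt_0_1)) (HF _ d1)) => x [[h1 h2] h3].
rewrite vsub_scal; apply: (nle_mono (r := e / 2 + e / 2)); last lra.
apply: nle_add.
  apply: nle_mono (nle_scal _ h3) _.
  have wa : Rabs (w x) <= Rabs a + 1.
    have E : w x - a + a = w x by ring.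
    by have := Rabs_triang (w x - a) a; rewrite E; lra.
  have E : e / 2 = (Rabs a + 1) * (e / 2 / (Rabs a + 1)) by field; lra.
  by rewrite {2}E; apply: Rmult_le_compat_r; lra.
have vC' : nle v (Rabs C + 1) by apply: nle_mono vC _; have := Rle_abs C; lra.
apply: nle_mono (nle_scal _ vC') _.
have E : e / 2 = (e / 2 / (Rabs C + 1)) * (Rabs C + 1) by field; lra.
by rewrite E; apply: Rmult_le_compat_r; lra.
Qed.

Definition list_tends (L : list ((X -> R) * (X -> M))) (l : list (R * M)) : Prop :=
  Forall2 (fun wF wm => tendsR N (fst wF) (fst wm) /\ tends N (snd wF) (snd wm)) L l.

Definition list_at (L : list ((X -> R) * (X -> M))) (x : X) : list (R * M) :=
  map (fun wF => (fst wF x, snd wF x)) L.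

(** The shape of the list is fixed and only its total weight must be positive in the limit, so
    single weights may tend to 0. *)
Lemma avg_tends L l : list_tends L l -> 0 < wtot l ->
  eventually N (fun x => D (wavg em (list_at L x))) -> D (wavg em l) ->
  tends N (fun x => r (wavg em (list_at L x))) (r (wavg em l)).
Proof.
move=> HL pos ED Dl.
have [Hs [[C HC] Ht]] : tendsV (fun x => wsum em (list_at L x)) (wsum em l) /\
    (exists C, nle (wsum em l) C) /\ tendsR N (fun x => wtot (list_at L x)) (wtot l).
  have m0 : M by case: l pos {HL Dl} => [|[w m] l] //= /Rlt_irrefl.
  (* A bound on [vzero] is obtained by scaling a bounded vector by 0. *)
  have nle0 : nle (vzero : V) 0.
    by have := nle_scal 0 (av_lip H m0 m0); rewrite vscal0 Rabs_R0 Rmult_0_l.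
  elim: HL => {L l pos ED Dl} [|[w F] [a m] L l [/= Hw HF] _ [IH1 [[C HC] IH2]]] /=.
    split; [|split].
    - move=> e e0; apply: ev_all => x; rewrite /vsub vaddN.
      by apply: nle_mono nle0 _; lra.
    - by exists 0.
    - exact: tendsR_cst.
  have [C' HC'] := av_bdd H m; split; [|split].
  - apply: tendsV_add => //; apply: (tendsV_scal HC') => //.
    move=> e /HF; apply: ev_mono => x h; apply: nle_mono (av_lip H _ _) _; lra.
  - by exists (Rabs a * C' + C); apply: nle_add => //; apply: nle_scal.
  - exact: tendsR_add.
move=> e e0; have [d [d0 Hd]] := av_cont H Dl e0.
have Hav := tendsV_scal HC (tendsR_inv pos Ht) Hs.
by apply: ev_mono (ev_and baseN ED (Hav d d0)) => x [h1 h2]; apply: Hd.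
Qed.
End AverageLimit.
End AveragingTheory.

(** * Blending with a Krasinkiewicz approximation *)

Definition continuous_within {T M : MetricSpace} (B : T -> Prop) (u : T -> M) : Prop :=
  forall z e, B z -> 0 < e -> exists d, 0 < d /\ forall z', B z' -> ms_d z z' < d -> ms_d (u z) (u z') < e.

Lemma continuous_within_ulim (T M : MetricSpace) (B : T -> Prop) (u : T -> M) : continuous_within B u ->
  forall v t, (forall j, B (v j)) -> B t -> ulim v t -> ulim (fun j => u (v j)) (u t).
Proof.
move=> cu v t Bv Bt vt e e0; have [d [d0 Hd]] := cu t e Bt e0.
by apply: ufW (vt _ d0) => j; apply: Hd.
Qed.

Lemma image_ucpt (T M : MetricSpace) (B : T -> Prop) (u : T -> M) : continuous_within B u -> ucpt B ->
  ucpt (fun m => exists z, B z /\ u z = m).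
Proof.
move=> cu cB v Hv; have [w Hw] := choice _ Hv.
have Bw j : B (w j) by case: (Hw j).
have [z [Bz wz]] := cB w Bw; exists (u z); split; first by exists z.
have -> : v = fun j => u (w j) by apply: functional_extensionality => j; case: (Hw j).
exact: (continuous_within_ulim cu).
Qed.

Lemma uniform_continuity (T M : MetricSpace) (B : T -> Prop) (u : T -> M) e : continuous_within B u -> ucpt B ->
  0 < e -> exists d, 0 < d /\ forall z z', B z -> B z' -> ms_d z z' < d -> ms_d (u z) (u z') < e.
Proof.
move=> cu cB e0.
have [||d [d0 Hd]] := @ucpt_lebesgue T B (fun z d => forall z', B z' -> ms_d z z' < d -> ms_d (u z) (u z') < e) cB.
- by move=> z r s sr H z' Bz' zz'; apply: H => //; lra.
- move=> z Bz; have e2 : 0 < e / 2 by lra.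
  have [d [d0 Hd]] := cu z _ Bz e2; exists (d / 2); split; first lra.
  move=> y zy By z' Bz' yz'; have := Hd y By; have := Hd z' Bz'.
  have := ms_tri y z z'; have := ms_tri (u z) (u y) (u z'); rewrite (ms_sym (u y) (u z)); lra.
by exists d; split => // z z' Bz Bz'; apply: Hd.
Qed.

Section Blend.
Variables (M : MetricSpace) (V : bound_space) (em : M -> V) (D : V -> Prop) (r : V -> M).
Hypothesis Av : averaging em D r.
Variables (Z : MetricSpace) (B : Z -> Prop) (u : Z -> M).
Hypothesis cB : ucpt B.
Hypothesis cu : continuous_within B u.

Section Config.
Variables (rho eta tau : R) (zs : list Z) (U : Z -> M).

Definition bump z m zi := Rmax 0 (rho - ms_d z zi) * Rmax 0 (eta - ms_d m (U zi)).

Fixpoint bumps z m (l : list Z) : R := match l with nil => 0 | zi :: l => bump z m zi + bumps z m l end.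

(** At [s = 0] only [m] is left. At [s = 1] the weight of [m] is what the bumps lack to reach [tau]:
    it keeps the total positive far from the net, and it vanishes where the bumps are large. *)
Definition config s z m : list (R * M) :=
  ((1 - s) + Rmax 0 (tau - bumps z m zs), m) :: map (fun zi => (s * bump z m zi, U zi)) zs.

Lemma bump_ge0 z m zi : 0 <= bump z m zi.
Proof. by apply: Rmult_le_pos; apply: Rmax_l. Qed.

Lemma bump_pos z m zi : 0 < bump z m zi -> ms_d z zi < rho /\ ms_d m (U zi) < eta.
Proof.
rewrite /bump => H; split; apply: Rnot_le_lt => le; move: H.
  by rewrite (Rmax_left 0 (rho - ms_d z zi)); lra.
by rewrite (Rmax_left 0 (eta - ms_d m (U zi))); lra.
Qed.

Lemma bumps_ge0 z m l : 0 <= bumps z m l.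
Proof. by elim: l => [|zi l IH] /=; [lra | have := bump_ge0 z m zi; lra]. Qed.

Lemma bumps_ge z m l zi : In zi l -> bump z m zi <= bumps z m l.
Proof.
elim: l => [|zj l IH] //= [<-|/IH]; first by have := bumps_ge0 z m l; lra.
by have := bump_ge0 z m zj; lra.
Qed.

Lemma wtot_config s z m : wtot (config s z m) = (1 - s) + Rmax 0 (tau - bumps z m zs) + s * bumps z m zs.
Proof.
rewrite /config /=; congr (_ + _); elim: (zs) => [|zi l IH] /=; first ring.
by rewrite IH; ring.
Qed.

Lemma config_weighted s z m : 0 <= s <= 1 -> 0 < tau -> weighted (config s z m).
Proof.
move=> [s0 s1] tau0; have b0 := bumps_ge0 z m zs; have mx := Rmax_l 0 (tau - bumps z m zs).
split.
- move=> wm [<-|] /=; first lra.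
  by move=> /in_map_iff [zi [<- _]] /=; apply: Rmult_le_pos (bump_ge0 _ _ _).
- rewrite wtot_config; have mr := Rmax_r 0 (tau - bumps z m zs).
  have : 0 <= s * bumps z m zs by apply: Rmult_le_pos.
  case: s1 => [s1|->]; lra.
Qed.

Lemma config_tends (X : Type) (N : R -> X -> Prop) w F G s z m : filter_base N ->
  tendsR N w s -> tends N F z -> tends N G m ->
  exists L, list_tends N L (config s z m) /\ forall x, list_at L x = config (w x) (F x) (G x).
Proof.
move=> bN Hw HF HG.
have Hb zi : tendsR N (fun x => bump (F x) (G x) zi) (bump z m zi).
  apply: tendsR_mul => //; apply: tendsR_pos; apply: tendsR_sub => //; try exact: tendsR_cst;
    by apply: tends_dist => //; exact: tends_cst.
exists ((fun x => (1 - w x) + Rmax 0 (tau - bumps (F x) (G x) zs), G) ::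
  map (fun zi => (fun x => w x * bump (F x) (G x) zi, fun _ => U zi)) zs); split.
  apply: Forall2_cons => /=.
    split => //; apply: tendsR_add => //; first by apply: tendsR_sub => //; exact: tendsR_cst.
    apply: tendsR_pos; apply: tendsR_sub => //; first exact: tendsR_cst.
    elim: (zs) => [|zi l IH] /=; first exact: tendsR_cst.
    exact: tendsR_add.
  elim: (zs) => [|zi l IH] /=; first exact: Forall2_nil.
  by apply: Forall2_cons IH => /=; split; [exact: tendsR_mul | exact: tends_cst].
by move=> x; rewrite /list_at /= map_map.
Qed.
End Config.

(* [H s z m] averages [m] with the values of [U] on a finite net of [B]; the weight of a value vanishes
   when it is far from [m], so that only points in one small set are ever averaged. *)
Lemma blend al : 0 < al -> exists eta, 0 < eta /\
  forall U : Z -> M, continuous_within B U -> (forall z, B z -> ms_d (u z) (U z) < eta / 4) ->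
  forall eta2, 0 < eta2 -> exists H : R -> Z -> M -> M,
    (forall (X : Type) (N : R -> X -> Prop) w F G s z m, filter_base N -> (forall x, 0 <= w x <= 1) -> 0 <= s <= 1 ->
       tendsR N w s -> tends N F z -> tends N G m ->
       tends N (fun x => H (w x) (F x) (G x)) (H s z m)) /\
    (forall z m, H 0 z m = m) /\
    (forall s z m, 0 <= s <= 1 -> ms_d m (H s z m) < al) /\
    (forall z, B z -> ms_d (U z) (H 1 z (u z)) < eta2).
Proof.
move=> al0; have al2 : 0 < al / 2 by lra.
have [dl [dl0 Hdl]] := safe_unif Av (image_ucpt cu cB) al2.
(* If some bump is active at [zi], then [m] is within [2 * eta] of [u zi] and all active values
   within [3 * eta < dl] of it, so the average is safe; [2 * eta] and [al / 2] together stay below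
   [al]. *)
pose eta := Rmin (dl / 4) (al / 8).
have eta_dl : eta <= dl / 4 by apply: Rmin_l.
have eta_al : eta <= al / 8 by apply: Rmin_r.
have eta0 : 0 < eta by apply: Rmin_glb_lt; lra.
exists eta; split => // U cU uU eta2 eta20.
have [dl2 [dl20 Hdl2]] := safe_unif Av (image_ucpt cU cB) eta20.
have e4 : 0 < eta / 4 by lra.
have [r1 [r10 Hr1]] := uniform_continuity cu cB e4.
have [r2 [r20 Hr2]] := uniform_continuity cU cB dl20.
pose rho := Rmin r1 r2; have rho1 : rho <= r1 by apply: Rmin_l. have rho2 : rho <= r2 by apply: Rmin_r.
have rho0 : 0 < rho by apply: Rmin_glb_lt.
have rh0 : 0 < rho / 2 by lra.
have [zs [zsB net]] := ucpt_net cB rh0.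
(* For [z] in [B] and [m = u z], a net point within [rho / 2] of [z] has its value under [U] within
   [eta / 2] of [m]; its bump alone reaches [tau], and [m] drops out of the average at [s = 1]. *)
pose tau := rho / 2 * (eta / 2).
have tau0 : 0 < tau by apply: Rmult_lt_0_compat; lra.
pose cfg := config rho eta tau zs U.
have wcfg s z m : 0 <= s <= 1 -> weighted (cfg s z m) by move=> Hs; apply: config_weighted.
have active s z m : 0 <= s -> (exists zi, In zi zs /\ 0 < bump rho eta U z m zi) \/ clustered m 0 (cfg s z m).
  move=> s0; have [|none] := classic (exists zi, In zi zs /\ 0 < bump rho eta U z m zi); first by left.
  right=> wm [<-|] /=; first by rewrite ms_refl; lra.
  move=> /in_map_iff [zi [<- izi]] /= pos; case: none; exists zi; split => //.
  by case: (bump_ge0 rho eta U z m zi) => // E; move: pos; rewrite -E; lra.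
have safe s z m : 0 <= s <= 1 -> D (wavg em (cfg s z m)) /\ ms_d m (r (wavg em (cfg s z m))) < al.
  move=> Hs; case: (active s z m); first lra; last first.
    move=> cl; have [d [d0 Hd]] := safe_point Av m al0; apply: Hd; first exact: wcfg.
    by move=> wm iwm /(cl wm iwm); lra.
  move=> [zi [izi /bump_pos [_ mzi]]]; have Bzi := zsB _ izi.
  have near : ms_d (u zi) m < 2 * eta.
    by have := uU _ Bzi; have := ms_tri (U zi) (u zi) m; rewrite (ms_sym (U zi)); lra.
  have [||Dc dc] := Hdl (u zi) _ (cfg s z m) (wcfg s z m Hs).
  - by exists zi.
  - move=> wm [<-|] /=; first lra.
    move=> /in_map_iff [zj [<- izj]] /= pos.
    have [_ mzj] : ms_d z zj < rho /\ ms_d m (U zj) < eta.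
      apply: (@bump_pos rho eta U); case: (bump_ge0 rho eta U z m zj) => // E; move: pos; rewrite -E; lra.
    by have := ms_tri m (u zi) (U zj); lra.
  by split => //; have := ms_tri (u zi) m (r (wavg em (cfg s z m))); rewrite (ms_sym m (u zi)); lra.
exists (fun s z m => r (wavg em (cfg s z m))); split; [|split; [|split]].
- move=> X N w F G s z m bN Hw Hs ws Fz Gm.
  have [L [HL EL]] := config_tends rho eta tau zs U bN ws Fz Gm.
  have [_ pos] := wcfg s z m Hs.
  apply: (tends_ext bN (F := fun x => r (wavg em (list_at L x)))).
    by apply: ev_all => x; rewrite EL.
  apply: (avg_tends Av bN HL) => //; last by have [] := safe s z m Hs.
  by apply: ev_all => x; rewrite EL; have [] := safe (w x) (F x) (G x) (Hw x).
- move=> z m; apply: (avg_constant Av); first by apply: wcfg; lra.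
  move=> wm [<-|] /=; first by rewrite ms_refl; lra.
  by move=> /in_map_iff [zi [<- izi]] /=; rewrite Rmult_0_l; lra.
- by move=> s z m Hs; have [] := safe s z m Hs.
- move=> z Bz; have [|||_ //] := Hdl2 (U z) _ (cfg 1 z (u z)).
  + by exists z.
  + by apply: wcfg; lra.
  have [zi [izi ziz]] := net z Bz.
  have big : tau <= bumps rho eta U z (u z) zs.
    apply: Rle_trans (bumps_ge _ _ _ _ _ izi); rewrite /tau /bump.
    have := Hr1 z zi Bz (zsB _ izi); rewrite (ms_sym z zi) => h1.
    have := uU _ (zsB _ izi); have := ms_tri (u zi) (u z) (U zi) => h2 h3.
    by apply: Rmult_le_compat; try lra; apply: Rle_trans (Rmax_r _ _); lra.
  move=> wm [<-|] /=; first by rewrite (Rmax_left 0); lra.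
  move=> /in_map_iff [zj [<- izj]] /=; rewrite Rmult_1_l => /bump_pos [zzj _].
  by have := Hr2 z zj Bz (zsB _ izj); lra.
Qed.
End Blend.

(** * Krasinkiewicz approximation on compact subsets *)

Lemma sub_metric (T : MetricSpace) (B : T -> Prop) :
  is_metric (fun a b : {t | B t} => ms_d (proj1_sig a) (proj1_sig b)).
Proof.
split; [|split; [|split]].
- by move=> *; apply: ms_ge0.
- move=> [a Ba] [b Bb] /=; split => [/ms_eq E|[<-]]; last exact: ms_refl.
  by subst b; congr (exist _ _ _); apply: proof_irrelevance.
- by move=> *; apply: ms_sym.
- by move=> *; apply: ms_tri.
Qed.

Definition SubMS (T : MetricSpace) (B : T -> Prop) : MetricSpace :=
  {| ms_d := fun a b : {t | B t} => ms_d (proj1_sig a) (proj1_sig b); ms_metric := sub_metric B |}.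

Section Subspace.
Variables (T : MetricSpace) (B : T -> Prop).

Lemma sub_ucpt (C : T -> Prop) : ucpt C -> (forall x, C x -> B x) ->
  ucpt (fun b : SubMS B => C (proj1_sig b)).
Proof.
move=> cC CB u Cu; have [x [Cx ux]] := cC _ Cu.
by exists (exist _ x (CB x Cx)).
Qed.

Lemma sub_connected (A : T -> Prop) : connected_set (@ms_d T) A -> (forall x, A x -> B x) ->
  connected_set (@ms_d (SubMS B)) (fun b : SubMS B => A (proj1_sig b)).
Proof.
move=> cA AB U V oU oV cov dis.
pose ext (W : SubMS B -> Prop) t := exists b r, (0 < r /\ forall b' : SubMS B, ms_d b b' < r -> W b') /\ ms_d (proj1_sig b) t < r.
have oext W : open_set (@ms_d T) (ext W).
  move=> t [b [r [Hr bt]]]; have [e [e0 He]] := open_ball bt.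
  by exists e; split => // z /He bz; exists b, r.
have extP W : open_set (@ms_d (SubMS B)) W -> forall b : SubMS B, ext W (proj1_sig b) <-> W b.
  move=> oW b; split => [[b' [r [[r0 Hr] bb']]]|Wb]; first exact: Hr.
  by have [r [r0 Hr]] := oW b Wb; exists b, r; rewrite ms_refl.
have [|x|H|H] := cA _ _ (oext U) (oext V).
- move=> x Ax; case: (cov (exist _ x (AB x Ax)) Ax) => /extP H; [left|right]; exact: H.
- move=> [Ax [HU HV]]; apply: (dis (exist _ x (AB x Ax))); split => //.
  by split; apply/extP.
- by left => b /H /extP; apply.
- by right => b /H /extP; apply.
Qed.

Lemma sub_kras (M : MetricSpace) (v : SubMS B -> M) (U : T -> M) :
  (forall b : SubMS B, U (proj1_sig b) = v b) -> kras_map v -> kras_map_on B U.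
Proof.
move=> Uv kv C [[x Cx] [cC conC]] CB.
have [||[z Hz]|[z [b0 [_ [vb0 comp]]]]] := kv (fun b => C (proj1_sig b)).
- split; first by exists (exist _ x (CB x Cx)).
  split; last exact: sub_connected.
  by apply: ucpt_compact; apply: sub_ucpt => //; apply: compact_ucpt.
- by [].
- by left; exists z => y Cy; rewrite -(Hz (exist _ y (CB y Cy)) Cy) -Uv.
right; exists z, (proj1_sig b0); split; first exact: proj2_sig.
split; first by rewrite Uv.
move=> y [A [cA [AK [Ab0 Ay]]]].
have AB x' : A x' -> B x' by move=> /AK [].
apply: (comp (exist _ y (AB y Ay))); exists (fun b => A (proj1_sig b)); split.
  exact: sub_connected.
by split => // b /AK [_ <-]; split => //; rewrite Uv.
Qed.
End Subspace.

Lemma kras_approx (T M : MetricSpace) (B : T -> Prop) (u : T -> M) e : kras_space M ->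
  ucpt B -> continuous_within B u -> 0 < e ->
  exists U : T -> M, kras_map_on B U /\ continuous_within B U /\ forall z, B z -> ms_d (u z) (U z) < e.
Proof.
move=> kM cB cu e0.
have [||//|v [cv [kv near]]] := kM (SubMS B) _ (fun b => u (proj1_sig b)) e.
- apply: ucpt_compact => w _; have [x [Bx wx]] := cB (fun j => proj1_sig (w j)) (fun j => proj2_sig (w j)).
  by exists (exist _ x Bx).
- move=> [b Bb] d d0; have [d' [d'0 Hd']] := cu b d Bb d0.
  by exists d'; split => // -[b' Bb'] /=; apply: Hd'.
(* Off [B] the values of [u] serve as filler: every condition on [U] is relative to [B]. *)
pose U t := match excluded_middle_informative (B t) with left Bt => v (exist _ t Bt) | right _ => u t end.
have UE (b : SubMS B) : U (proj1_sig b) = v b.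
  case: b => b Bb /=; rewrite /U; case: excluded_middle_informative => // Bb'.
  by congr (v (exist _ _ _)); apply: proof_irrelevance.
exists U; split; first exact: sub_kras UE kv.
split.
- move=> z d Bz d0; have [d' [d'0 Hd']] := cv (exist _ z Bz) d d0.
  exists d'; split => // z' Bz' zz'; rewrite (UE (exist _ z Bz)) (UE (exist _ z' Bz')).
  exact: Hd'.
- by move=> z Bz; rewrite (UE (exist _ z Bz)) ms_sym; apply: near.
Qed.

(** * Openness *)

Section Openness.
Variables (X Y M : MetricSpace) (f : X -> Y) (p : X -> Seq).
Hypothesis Hf : perfect_map f.
Hypothesis cp : continuous p.

(** Bad maps over points tending to [y0] would contradict [good_stable], because points of their
    fibres accumulate on the fibre over [y0]. *)
Lemma good_local k (g : X -> M) y0 : continuous g -> good p k (fiber f y0) g ->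
  exists s, 0 < s /\ forall y, ms_d y0 y < s -> forall h : X -> M,
    (forall x, f x = y -> ms_d (h x) (g x) < s) -> good p k (fiber f y) h.
Proof.
move=> cg gg; apply: NNPP => ns.
have bad j : exists yh : Y * (X -> M), ms_d y0 (fst yh) < inv_succ j /\
    (forall x, f x = fst yh -> ms_d (snd yh x) (g x) < inv_succ j) /\ ~ good p k (fiber f (fst yh)) (snd yh).
  apply: NNPP => nb; apply: ns; exists (inv_succ j); split; first exact: inv_succ_pos.
  by move=> y yy h Hh; apply: NNPP => ng; apply: nb; exists (y, h).
have {ns bad} [yh Hyh] := choice _ bad.
have toy u : (forall j, fiber f (fst (yh j)) (u j)) -> ulim (fun j => f (u j)) y0.
  by move=> Hu; apply: ulim_inv_succ => j; rewrite (Hu j); case: (Hyh j).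
have [|||||||j gj] := @good_stable X X Seq M (fun x => x) p p (fun j => fiber f (fst (yh j)))
  (fiber f y0) (fun j => snd (yh j)) g k.
- by move=> x e e0; exists e.
- by [].
- exact: (fiber_ucpt Hf).
- by move=> u /toy /(perfect_ulim Hf).
- move=> u t Hu _ ut; apply: (ulim_near (ulim_cont cg ut)) => e e0.
  apply: ufW (uf_inv_succ e0) => j; have [_ [H _]] := Hyh j.
  by have := H _ (Hu j); rewrite ms_sym; lra.
- by [].
- exact: gg.
- by case: (Hyh j) => _ [_ []].
Qed.

Definition fiberwise_good k (g : X -> M) : Prop := continuous g /\ forall y, good p k (fiber f y) g.

(** The local radii of [good_local] are merged into a Lipschitz function on [Y]; its composition
    with [f] is the required tolerance on [X]. *)
Lemma fiberwise_good_open k : SL_open (fiberwise_good k).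
Proof.
split=> [g []|g [cg gg]] //.
have [||sg [sg01 [lip Hsg]]] := @lipschitz_minorant Y (fun y s => forall h : X -> M,
    (forall x, f x = y -> ms_d (h x) (g x) < s) -> good p k (fiber f y) h).
- by move=> y s s' _ le H h Hh; apply: H => x fx; have := Hh x fx; lra.
- by move=> y0; have [s [s0 Hs]] := good_local cg (gg y0); exists s.
exists (fun x => sg (f x)); split; [|split] => //.
- move=> x e e0; have [d [d0 Hd]] := proj1 Hf x e e0; exists d; split => // x' /Hd.
  by have := lip (f x) (f x'); lra.
- move=> h ch Hh; split => // y; apply: Hsg => x <-; exact: Hh.
Qed.
End Openness.

(** * Geometrically convergent sequences *)

Lemma geometric_limit (M : MetricSpace) (v : nat -> M) C : complete_metric (@ms_d M) -> 0 <= C ->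
  (forall n, ms_d (v n) (v (S n)) <= C * (/ 4) ^ n) ->
  exists l, forall e, 0 < e -> exists N, forall n, (N <= n)%nat -> ms_d (v n) l < e.
Proof.
move=> cM C0 H.
(* The factor 2 is a convenient bound for 4/3, the sum of the powers of 1/4; the last factor carries
   the induction. *)
have step n k : ms_d (v n) (v (n + k)%nat) <= 2 * C * (/ 4) ^ n * (1 - (/ 4) ^ k).
  elim: k => [|k IH]; first by rewrite Nat.add_0_r ms_refl /=; lra.
  have := H (n + k)%nat; rewrite Nat.add_succ_r pow_add => h.
  have := ms_tri (v (n + k)%nat) (v n) (v (S (n + k))).
  have qn : 0 <= (/ 4) ^ n by apply: pow_le; lra.
  have qk : 0 <= (/ 4) ^ k by apply: pow_le; lra.
  have : 0 <= C * (/ 4) ^ n * (/ 4) ^ k by do 2 (apply: Rmult_le_pos => //).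
  by rewrite /=; lra.
apply: cM => e e0.
have e1 : 0 < e / (2 * C + 1) by apply: Rdiv_lt_0_compat; lra.
have q1 : Rabs (/ 4) < 1 by rewrite Rabs_right; lra.
have [N HN] := pow_lt_1_zero (/ 4) q1 _ e1.
have tail n k : (N <= n)%nat -> ms_d (v n) (v (n + k)%nat) < e.
  move=> nN; apply: Rle_lt_trans (step n k) _.
  have qn : 0 <= (/ 4) ^ n by apply: pow_le; lra.
  have qk : 0 <= (/ 4) ^ k by apply: pow_le; lra.
  have := HN n nN; rewrite Rabs_right; first lra.
  move=> lt; have : (2 * C + 1) * (/ 4) ^ n < e.
    have -> : e = (2 * C + 1) * (e / (2 * C + 1)) by field; lra.
    by apply: Rmult_lt_compat_l => //; lra.
  have : 0 <= 2 * C * (/ 4) ^ n * (/ 4) ^ k by do 2 (apply: Rmult_le_pos => //); lra.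
  lra.
exists N => n m nN mN; have [nm|mn] : (n <= m)%nat \/ (m <= n)%nat by lia.
  by have := tail n (m - n)%nat nN; have -> : (n + (m - n))%nat = m by lia.
by rewrite ms_sym; have := tail m (n - m)%nat mN; have -> : (m + (n - m))%nat = n by lia.
Qed.

Lemma geometric_bound (M : MetricSpace) (v : nat -> M) C l : 0 <= C ->
  (forall n, ms_d (v n) (v (S n)) <= C * (/ 4) ^ n) ->
  (forall e, 0 < e -> exists N, forall n, (N <= n)%nat -> ms_d (v n) l < e) ->
  ms_d (v 0%nat) l <= 2 * C.
Proof.
move=> C0 H lim.
have step k : ms_d (v 0%nat) (v k) <= 2 * C * (1 - (/ 4) ^ k).
  elim: k => [|k IH]; first by rewrite ms_refl /=; lra.
  have := H k; have := ms_tri (v k) (v 0%nat) (v (S k)).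
  have qk : 0 <= (/ 4) ^ k by apply: pow_le; lra.
  have : 0 <= C * (/ 4) ^ k by apply: Rmult_le_pos.
  by rewrite /=; lra.
apply: Rnot_lt_le => lt; have e0 : 0 < ms_d (v 0%nat) l - 2 * C by lra.
have [N HN] := lim _ e0; have := HN N (le_n _); have := step N; have := ms_tri (v N) (v 0%nat) l.
have qk : 0 <= (/ 4) ^ N by apply: pow_le; lra.
have : 0 <= 2 * C * (/ 4) ^ N by apply: Rmult_le_pos => //; lra.
lra.
Qed.

(** * Charts and strata *)

Section Strata.
Variables (X Y : MetricSpace) (f : X -> Y) (p : X -> Seq).
Variables (U : Y -> Y -> Prop) (c : nat -> Y -> R) (idx : nat -> Y -> Y).
Hypothesis cf : continuous f.
Hypothesis cp : continuous p.
Hypothesis cubep : forall x, cube (p x).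
Hypothesis evenp : forall x n, Nat.odd n = false -> p x n = 0.
Hypothesis pd : partition_data U c idx.

(** On a fibre the weights are constant and [p] vanishes in their places, so [chart] and [p] have
    the same distances there ([chart_fiber]). *)
Definition chart (x : X) : Seq := fun j => if Nat.odd j then p x j else c (Nat.div2 j) (f x).

Lemma chart_cube x : cube (chart x).
Proof. by move=> j; rewrite /chart; case: (Nat.odd j); [exact: cubep | exact: (pd_unit pd)]. Qed.

Lemma chart_weight x n : chart x (2 * n)%nat = c n (f x).
Proof. by rewrite /chart Nat.odd_even Nat.div2_double. Qed.

Lemma chart_fiber x x' : f x = f x' -> ms_d (chart x) (chart x') = ms_d (p x) (p x').
Proof.
move=> ff; apply: seq_d_diff => n; rewrite /chart; case E: (Nat.odd n) => //.
by rewrite ff !evenp //; lra.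
Qed.

Lemma chart_continuous : continuous chart.
Proof.
apply/continuousP => x0; apply: tends_seq; first exact: ball_base_mono.
move=> j; rewrite /chart; case E: (Nat.odd j).
  by apply: (tends_coord j (F := p)); exact: (proj1 (continuousP p) cp x0).
by apply: tendsR_comp_ball => //; apply: (pd_cont pd).
Qed.

Definition bounded_by (N : nat) (s : nat -> Y) (x : X) : Prop :=
  forall n, 0 < c n (f x) -> (n < N)%nat /\ idx n (f x) = s n.

(* Two kinds of nice bases matter: the balls around a point, and the traces on a stratum of the balls of
   the cube.  Convergence along the former is continuity, along the latter it is extendability to
   the closure of the chart of the stratum. *)
Definition nice (B : R -> X -> Prop) (z : Seq) : Prop :=
  filter_base B /\ (exists N s, eventually B (bounded_by N s)) /\ tends B chart z.

(** The open simplex of the nerve that contains [y], given by its set of vertices. *)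
Definition label (y : Y) : nat -> option Y :=
  fun n => if Rlt_dec 0 (c n y) then Some (idx n y) else None.

Definition stratum_base (l : nat -> option Y) (z : Seq) : R -> X -> Prop :=
  fun d x => label (f x) = l /\ ms_d z (chart x) < d.

Lemma weight_zero_or n y : c n y = 0 \/ 0 < c n y.
Proof. by have [[h|h] _] := pd_unit pd n y; [right | left]. Qed.

Lemma active_bound y : exists N, forall n, 0 < c n y -> (n < N)%nat.
Proof.
have [r [N [s [r0 H]]]] := pd_loc pd y; exists N => n h.
by have [] := H y _ n h; rewrite ?ms_refl.
Qed.

Lemma nice_ball x0 : nice (ball_base x0) (chart x0).
Proof.
split; first exact: ball_base_mono.
split; last exact: (proj1 (continuousP chart) chart_continuous x0).
have [r [N [s [r0 H]]]] := pd_loc pd (f x0); exists N, s.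
by have [d [d0 Hd]] := cf x0 r0; exists d; split => // x /Hd /H.
Qed.

Lemma nice_stratum x0 z : nice (stratum_base (label (f x0)) z) z.
Proof.
split; first by move=> d d' x _ le [? ?]; split => //; lra.
split; last by move=> e e0; exists e; split => // x [].
have [N HN] := active_bound (f x0); exists N, (fun n => idx n (f x0)).
exists 1; split; first lra.
move=> x [E _] n cx; have := f_equal (fun l => l n) E; rewrite /label.
case: Rlt_dec => // h1; case: Rlt_dec => // h2 [->]; split => //; exact: HN.
Qed.

(** The invariant kept by all moves: continuity on [X] together with extendability of [g], stratum
    by stratum, to the closure of the chart of the stratum. *)
Definition convergent (M : MetricSpace) (g : X -> M) : Prop :=
  forall B z, nice B z -> exists m, tends B g m.

Lemma convergent_continuous (M : MetricSpace) (g : X -> M) : convergent g -> continuous g.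
Proof.
move=> cg; apply/continuousP => x0; have [m Hm] := cg _ _ (nice_ball x0).
suff -> : g x0 = m by [].
symmetry; apply: ms_eq; apply: Rle_antisym; last exact: ms_ge0.
apply: Rnot_lt_le => /Hm [d [d0 /(_ x0)]]; rewrite /ball_base ms_refl => /(_ d0); lra.
Qed.

Fixpoint sumr (F : nat -> R) (N : nat) : R :=
  match N with O => 0 | S N => sumr F N + F N end.

Lemma sumr_ge0 F N : (forall n, 0 <= F n) -> 0 <= sumr F N.
Proof. by move=> F0; elim: N => [|N IH] /=; [lra | have := F0 N; lra]. Qed.

Lemma sumr_ge F N n : (forall n, 0 <= F n) -> (n < N)%nat -> F n <= sumr F N.
Proof.
move=> F0; elim: N => [|N IH] /=; first lia.
move=> nN; have [/IH|->] : (n < N)%nat \/ n = N by lia.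
  by have := F0 N; lra.
by have := sumr_ge0 N F0; lra.
Qed.

Lemma sumr_bound F N N' : (forall n, F n <> 0 -> (n < N)%nat /\ (n < N')%nat) -> sumr F N = sumr F N'.
Proof.
have tail K k : (forall n, (K <= n)%nat -> F n = 0) -> sumr F (K + k) = sumr F K.
  move=> H; elim: k => [|k IH]; first by rewrite Nat.add_0_r.
  by rewrite Nat.add_succ_r /= IH H; [lia | lra].
move=> H; have zero K n : (forall n, F n <> 0 -> (n < K)%nat) -> (K <= n)%nat -> F n = 0.
  by move=> HK Kn; apply: NNPP => /HK; lia.
rewrite -(tail N N'); first by move=> n; apply: zero => m /H [].
by rewrite Nat.add_comm tail // => n; apply: zero => m /H [].
Qed.

Lemma sumr_tends (B : R -> X -> Prop) (F : X -> nat -> R) (a : nat -> R) N : filter_base B ->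
  (forall n, tendsR B (fun x => F x n) (a n)) -> tendsR B (fun x => sumr (F x) N) (sumr a N).
Proof.
move=> bB H; elim: N => [|N IH] /=; first exact: tendsR_cst.
exact: tendsR_add.
Qed.

(* [tent a] vanishes outside of the interval from 0 to [1/(a+1)] and is at least 1 near its midpoint,
   where [label_at a] jumps. *)
Definition tent (a : nat) (t : R) : R := Rmax 0 (2 - 4 / inv_succ a * Rabs (t - inv_succ a / 2)).

Definition label_at (a : nat) (y : Y) : nat -> option Y :=
  fun n => if Rlt_dec (inv_succ a / 2) (c n y) then Some (idx n y) else None.

Definition settled (a : nat) (y : Y) : Prop := forall n, c n y = 0 \/ inv_succ a <= c n y.

Lemma tent_ge0 a t : 0 <= tent a t.
Proof. exact: Rmax_l. Qed.

Lemma tent_eq0 a t : t = 0 \/ inv_succ a <= t -> tent a t = 0.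
Proof.
have i0 := inv_succ_pos a => H; rewrite /tent Rmax_left //.
have : inv_succ a / 2 <= Rabs (t - inv_succ a / 2).
  by case: H => [->|h]; split_Rabs; lra.
have k0 : 0 < 4 / inv_succ a by apply: Rdiv_lt_0_compat; lra.
move=> /(Rmult_le_compat_l _ _ _ (Rlt_le _ _ k0)).
have -> : 4 / inv_succ a * (inv_succ a / 2) = 2 by field; lra.
by lra.
Qed.

Lemma tent_ge1 a t : inv_succ a / 4 <= t <= 3 / 4 * inv_succ a -> 1 <= tent a t.
Proof.
have i0 := inv_succ_pos a => H; apply: Rle_trans (Rmax_r _ _).
have : Rabs (t - inv_succ a / 2) <= inv_succ a / 4 by split_Rabs; lra.
have k0 : 0 < 4 / inv_succ a by apply: Rdiv_lt_0_compat; lra.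
move=> /(Rmult_le_compat_l _ _ _ (Rlt_le _ _ k0)).
have -> : 4 / inv_succ a * (inv_succ a / 4) = 1 by field; lra.
by lra.
Qed.

(** All tents vanish at settled points, so the gauge is 1 there; a weight close to half of
    [inv_succ a] makes it 0. The sum is cut off at a bound for the active indices, and any such
    bound gives the same value. *)
Lemma gauge_exists a : exists w : X -> R,
  (forall x, 0 <= w x <= 1) /\
  (forall x, settled a (f x) -> w x = 1) /\
  (forall N s x, bounded_by N s x -> w x = Rmax 0 (1 - sumr (fun n => tent a (c n (f x))) N)).
Proof.
have [Nb HNb] := choice _ active_bound.
exists (fun x => Rmax 0 (1 - sumr (fun n => tent a (c n (f x))) (Nb (f x)))); split; [|split].
- move=> x; split; first exact: Rmax_l.
  apply: Rmax_lub; first lra.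
  by have := @sumr_ge0 (fun n => tent a (c n (f x))) (Nb (f x)) (fun n => tent_ge0 _ _); lra.
- move=> x st; have -> : sumr (fun n => tent a (c n (f x))) (Nb (f x)) = 0.
    elim: (Nb _) => [|n IH] //=; rewrite IH tent_eq0; [exact: st | lra].
  by rewrite Rmax_right; lra.
- move=> N s x Bx; congr (Rmax 0 (1 - _)); apply: sumr_bound => n ne.
  have pos : 0 < c n (f x).
    by case: (weight_zero_or n (f x)) => // E; case: ne; apply: tent_eq0; left.
  by split; [apply: HNb | have [] := Bx n pos].
Qed.

Lemma settled_label a y : settled a y -> label_at a y = label y.
Proof.
move=> st; apply: functional_extensionality => n; rewrite /label_at /label.
have i0 := inv_succ_pos a.
by case: (st n) => h; case: Rlt_dec => h1; case: Rlt_dec => h2 //; lra.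
Qed.

Lemma settled_mono a b y : (a <= b)%nat -> settled a y -> settled b y.
Proof.
by move=> /inv_succ_anti le st n; case: (st n); [left | right; lra].
Qed.

Lemma settled_exists y : exists a, settled a y.
Proof.
have [N HN] := active_bound y.
have [a Ha] : exists a, forall n, (n < N)%nat -> c n y = 0 \/ inv_succ a <= c n y.
  elim: (N) => [|K [a Ha]]; first by exists 0%nat => n; lia.
  case: (weight_zero_or K y) => [z|pos].
    exists a => n nK; have [/Ha //|->] : (n < K)%nat \/ n = K by lia.
    by left.
  have [b Hb] := inv_succ_small pos; exists (a + b)%nat => n nK.
  have [/Ha|->] : (n < K)%nat \/ n = K by lia.
    by case=> h; [left | right; have := @inv_succ_anti a (a + b) (Nat.le_add_r _ _); lra].
  have /Hb h : (b <= a + b)%nat by lia.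
  by right; lra.
exists a => n; case: (weight_zero_or n y) => [|pos]; first by left.
exact: Ha (HN n pos).
Qed.

(** [label_at a] changes only where a weight crosses [inv_succ a / 2], and there the gauge is 0.
    Hence a construction depending on this label and trivial at gauge 0 still has limits along nice
    bases. *)
Lemma gauge_alternative a (w : X -> R) B z :
  (forall N s x, bounded_by N s x -> w x = Rmax 0 (1 - sumr (fun n => tent a (c n (f x))) N)) ->
  nice B z ->
  eventually B (fun x => w x = 0) \/
  exists l t, 0 <= t <= 1 /\ tendsR B w t /\ eventually B (fun x => label_at a (f x) = l).
Proof.
move=> Hw [bB [[N [s Hs]] toz]]; have i0 := inv_succ_pos a.
have cn n : tendsR B (fun x => c n (f x)) (z (2 * n)%nat).
  apply: (tendsR_ext bB (w := fun x => chart x (2 * n)%nat)); last exact: tends_coord toz.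
  by apply: ev_all => x; rewrite chart_weight.
(* The margin [inv_succ a / 12] widens the middle third to the interval where the tent is at least
   1; from outside the middle third it does not reach the jump at one half. *)
have [[n [nN mid]]|out] := classic (exists n, (n < N)%nat /\ inv_succ a / 3 <= z (2 * n)%nat <= 2 / 3 * inv_succ a).
  left; have e0 : 0 < inv_succ a / 12 by lra.
  apply: ev_mono (ev_and bB Hs (cn n _ e0)) => x [bx cx]; rewrite (Hw N s x bx).
  have := @sumr_ge (fun n => tent a (c n (f x))) N n (fun n => tent_ge0 _ _) nN.
  have ge1 : 1 <= tent a (c n (f x)) by apply: tent_ge1; move: cx; split_Rabs; lra.
  by move=> h0; rewrite Rmax_left //; lra.
right; exists (fun n => if Rlt_dec (inv_succ a / 2) (z (2 * n)%nat) then (if Nat.ltb n N then Some (s n) else None) else None).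
exists (Rmax 0 (1 - sumr (fun n => tent a (z (2 * n)%nat)) N)); split; last split.
  split; first exact: Rmax_l.
  apply: Rmax_lub; first lra.
  by have := @sumr_ge0 (fun n => tent a (z (2 * n)%nat)) N (fun n => tent_ge0 _ _); lra.
  apply: (tendsR_ext bB (w := fun x => Rmax 0 (1 - sumr (fun n => tent a (c n (f x))) N))).
    by apply: ev_mono Hs => x /Hw ->.
  apply: tendsR_pos; apply: tendsR_sub => //; first exact: tendsR_cst.
  apply: sumr_tends => // n; apply: tendsR_pos; apply: tendsR_sub => //; first exact: tendsR_cst.
  apply: tendsR_mul => //; first exact: tendsR_cst.
  apply: (@tendsR_lip _ _ Rabs 1); first lra.
    by move=> x y; rewrite Rmult_1_l; exact: Rabs_triang_inv2.
  by apply: tendsR_sub => //; exact: tendsR_cst.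
have e0 : 0 < inv_succ a / 12 by lra.
apply: ev_mono (ev_and bB Hs (ev_nat bB (fun n (_ : (n < N)%nat) => cn n _ e0))) => x [bx cx].
apply: functional_extensionality => n; rewrite /label_at.
case E : (Nat.ltb n N).
  move/Nat.ltb_lt: E => nN; have := cx n nN => near.
  have zout : z (2 * n)%nat < inv_succ a / 3 \/ 2 / 3 * inv_succ a < z (2 * n)%nat.
    by apply: NNPP => no; apply: out; exists n; split => //; lra.
  case: Rlt_dec => h1; case: Rlt_dec => h2 //.
  - by have [|_ ->] := bx n; first lra.
  - by move: near; split_Rabs; lra.
  - by move: near; split_Rabs; lra.
move/Nat.ltb_ge: E => nN.
have cz : c n (f x) = 0.
  by case: (weight_zero_or n (f x)) => // /bx [h _]; lia.
by rewrite cz; case: Rlt_dec => h1; [lra | case: Rlt_dec].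
Qed.
End Strata.

(** * Moves *)

Section Moves.
Variables (X Y M : MetricSpace) (f : X -> Y) (p : X -> Seq).
Variables (U : Y -> Y -> Prop) (c : nat -> Y -> R) (idx : nat -> Y -> Y).
Variables (V : bound_space) (em : M -> V) (D : V -> Prop) (r : V -> M).
Hypothesis Hf : perfect_map f.
Hypothesis cp : continuous p.
Hypothesis cubep : forall x, cube (p x).
Hypothesis evenp : forall x n, Nat.odd n = false -> p x n = 0.
Hypothesis pd : partition_data U c idx.
Hypothesis Av : averaging em D r.
Hypothesis kM : kras_space M.

Local Notation chart := (chart f p c).
Local Notation label := (label c idx).
Local Notation label_at := (label_at c idx).
Local Notation convergent := (convergent f p c idx).

(** Continuity is required along arbitrary filter bases, so that composing with such an [H]
    preserves limits along strata as well as at points. *)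
Definition deformation (H : R -> Seq -> M -> M) (al : R) : Prop :=
  (forall (N : R -> X -> Prop) w F G s z m, filter_base N -> (forall x, 0 <= w x <= 1) -> 0 <= s <= 1 ->
     tendsR N w s -> tends N F z -> tends N G m ->
     tends N (fun x => H (w x) (F x) (G x)) (H s z m)) /\
  (forall z m, H 0 z m = m) /\
  (forall s z m, 0 <= s <= 1 -> ms_d m (H s z m) < al).

(** The tolerance [et] is uniform over all fibres above [S]: bad maps over a sequence in [S] have
    charts in the single compactum [B], where [good_stable] compares them with [W]. *)
Lemma kras_fiber_good (B : Seq -> Prop) (W : Seq -> M) (S : Y -> Prop) k : 0 < k ->
  ucpt B -> (forall x, S (f x) -> B (chart x)) -> kras_map_on B W -> continuous_within B W ->
  exists et, 0 < et /\ forall y, S y -> forall h : X -> M,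
    (forall x, f x = y -> ms_d (h x) (W (chart x)) < et) -> good p k (fiber f y) h.
Proof.
move=> k0 cB SB kW cW; apply: NNPP => ne.
have bad j : exists yh : Y * (X -> M), S (fst yh) /\
    (forall x, f x = fst yh -> ms_d (snd yh x) (W (chart x)) < inv_succ j) /\
    ~ good p k (fiber f (fst yh)) (snd yh).
  apply: NNPP => nb; apply: ne; exists (inv_succ j); split; first exact: inv_succ_pos.
  by move=> y Sy h Hh; apply: NNPP => ng; apply: nb; exists (y, h).
have {ne bad} [yh Hyh] := choice _ bad.
have inB u : (forall j, fiber f (fst (yh j)) (u j)) -> forall j, B (chart (u j)).
  by move=> Hu j; apply: SB; rewrite (Hu j); case: (Hyh j).
have cid : continuous (fun z : Seq => z) by move=> z e e0; exists e.
have cWu := continuous_within_ulim cW.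
have [|||||||j gj] := @good_stable X Seq Seq M chart (fun z => z) p (fun j => fiber f (fst (yh j)))
  B (fun j => snd (yh j)) W k.
- exact: (chart_continuous (proj1 Hf) cp pd).
- exact: cid.
- exact: cB.
- by move=> u /inB; apply: cB.
- move=> u t Hu Bt ut; apply: (ulim_near (cWu _ _ (inB u Hu) Bt ut)) => e e0.
  apply: ufW (uf_inv_succ e0) => j; have [_ [H _]] := Hyh j.
  by have := H _ (Hu j); rewrite ms_sym; lra.
- by move=> j x x' fx fx'; apply: (chart_fiber c evenp); rewrite fx fx'.
- exact: (kras_good cid cB k0 cWu kW).
- by case: (Hyh j) => _ [_ []].
Qed.

(** Limits along the stratum extend [g] to a map [u] on the closure [B] of its chart. A
    Krasinkiewicz approximation [W] of [u] is blended into [g], and closeness to [W] on the chart of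
    a fibre gives goodness. An empty stratum gets the identity deformation. *)
Lemma stratum_blend (g : X -> M) l al k : convergent g -> 0 < al -> 0 < k ->
  exists H et, (deformation H al /\ 0 < et) /\ forall y, label y = l -> forall h : X -> M,
    (forall x, f x = y -> ms_d (h x) (H 1 (chart x) (g x)) < et) -> good p k (fiber f y) h.
Proof.
move=> cg al0 k0.
have [[x0 Ex0]|none] := classic (exists x, label (f x) = l); last first.
  exists (fun _ _ m => m), 1; split.
    split; last lra; split; first by [].
    by split => // s z m _; rewrite ms_refl.
  move=> y ly h _ C [[x Cx] _] Cy; case: none; exists x; by rewrite (Cy x Cx).
have conv z : exists m, tends (stratum_base f p c idx l z) g m.
  by apply: cg; rewrite -Ex0; apply: (nice_stratum f p pd x0 z).
have [u Hu] := choice _ conv.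
pose B z := forall e, 0 < e -> exists x, label (f x) = l /\ ms_d z (chart x) < e.
have chB x : label (f x) = l -> B (chart x).
  by move=> lx e e0; exists x; rewrite ms_refl.
have cB : ucpt B.
  apply: (ucpt_closed_sub cube_ucpt).
    move=> z nB; apply: NNPP => no; apply: nB => e e0; apply: NNPP => nx.
    apply: no; exists (e / 2); split; first lra.
    move=> z' zz' B'; apply: nx; have e2 : 0 < e / 2 by lra.
    have [x [lx zx]] := B' _ e2; exists x; split => //.
    by have := ms_tri z' z (chart x); lra.
  move=> z Bz.
  have [x Hx] := choice _ (fun j => Bz _ (inv_succ_pos j)).
  apply: (ulim_in_closed (ucpt_closed cube_ucpt) (u := fun j => chart (x j))).
    by apply: ulim_inv_succ => j; case: (Hx j).
  by apply: ufT => j; apply: (chart_cube f cubep pd).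
have ug x : label (f x) = l -> u (chart x) = g x.
  move=> lx; apply: ms_eq; apply: Rle_antisym; last exact: ms_ge0.
  apply: Rnot_lt_le => /(Hu (chart x)) [d [d0 /(_ x)]]; rewrite /stratum_base ms_refl.
  by move=> /(_ (conj lx d0)); lra.
have cu : continuous_within B u.
  move=> z e Bz e0; have e2 : 0 < e / 2 by lra.
  have [d [d0 Hd]] := Hu z _ e2; exists (d / 2); split; first lra.
  move=> z' Bz' zz'; have [d' [d'0 Hd']] := Hu z' _ e2.
  have m0 : 0 < Rmin (d / 2) d' by apply: Rmin_glb_lt; lra.
  have [x [lx zx]] := Bz' _ m0; have := Rmin_l (d / 2) d'; have := Rmin_r (d / 2) d' => h1 h2.
  have h3 : ms_d (u z) (g x) < e / 2.
    by apply: Hd; split => //; have := ms_tri z' z (chart x); lra.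
  have h4 : ms_d (u z') (g x) < e / 2 by apply: Hd'; split => //; lra.
  by have := ms_tri (g x) (u z) (u z'); rewrite (ms_sym (g x)); lra.
have [eta [eta0 Heta]] := blend Av cB cu al0.
have eta4 : 0 < eta / 4 by lra.
have [W [kW [cW uW]]] := kras_approx kM cB cu eta4.
have [|et [et0 Het]] := @kras_fiber_good B W (fun y => label y = l) k k0 cB _ kW cW.
  exact: chB.
have et2 : 0 < et / 2 by lra.
have [H [Hc [H0 [Hs H1]]]] := Heta W cW uW _ et2.
exists H, (et / 2); split; first by split; [split; [exact: Hc | split] | lra].
move=> y ly h Hh; apply: (Het y ly) => x fx.
have lx : label (f x) = l by rewrite fx.
have := Hh x fx; have := H1 _ (chB x lx); rewrite (ug x lx) => h1 h2.
have := ms_tri (H 1 (chart x) (g x)) (h x) (W (chart x)).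
by rewrite (ms_sym (H 1 _ _) (W _)); lra.
Qed.

(** Each point is deformed by the [H] of its truncated label, with the gauge as time. At a settled
    point that label is the true one and the time is 1, so the guarantee of [stratum_blend] holds
    there. *)
Lemma move_map (g : X -> M) (al : (nat -> option Y) -> R) a : convergent g -> (forall l, 0 < al l) ->
  exists g' et, convergent g' /\ (forall l, 0 < et l) /\
    (forall x, ms_d (g x) (g' x) < al (label_at a (f x))) /\
    forall y, settled c a y -> forall h : X -> M,
      (forall x, f x = y -> ms_d (h x) (g' x) < et (label y)) -> good p (inv_succ a) (fiber f y) h.
Proof.
move=> cg al0.
have [He HHe] : exists He : (nat -> option Y) -> (R -> Seq -> M -> M) * R, forall l,
    (deformation (fst (He l)) (al l) /\ 0 < snd (He l)) /\ forall y, label y = l -> forall h : X -> M,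
    (forall x, f x = y -> ms_d (h x) (fst (He l) 1 (chart x) (g x)) < snd (He l)) ->
    good p (inv_succ a) (fiber f y) h.
  apply: (choice (fun l (He : (R -> Seq -> M -> M) * R) => (deformation (fst He) (al l) /\ 0 < snd He) /\
    forall y, label y = l -> forall h : X -> M,
    (forall x, f x = y -> ms_d (h x) (fst He 1 (chart x) (g x)) < snd He) ->
    good p (inv_succ a) (fiber f y) h)) => l.
  by have [H [et Het]] := stratum_blend l cg (al0 l) (inv_succ_pos a); exists (H, et).
have [w [w01 [w1 wb]]] := gauge_exists f pd a.
exists (fun x => fst (He (label_at a (f x))) (w x) (chart x) (g x)), (fun l => snd (He l)).
split; [|split; [|split]].
- move=> B z nB; have [m gm] := cg B z nB; have [bB [_ toz]] := nB.
  have [w0|[l [t [t01 [wt lab]]]]] := gauge_alternative pd wb nB.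
    exists m; apply: (tends_ext bB (F := g)) => //; apply: ev_mono w0 => x ->.
    by have [[[_ [-> _]] _] _] := HHe (label_at a (f x)).
  have [[[Hc _] _] _] := HHe l.
  exists (fst (He l) t z m); apply: (tends_ext bB (F := fun x => fst (He l) (w x) (chart x) (g x))).
    by apply: ev_mono lab => x ->.
  exact: Hc.
- by move=> l; have [[_ H] _] := HHe l.
- by move=> x; have [[[_ [_ Hs]] _] _] := HHe (label_at a (f x)); apply: Hs.
- move=> y st h Hh; have [_ Hg] := HHe (label y); apply: (Hg y) => // x fx.
  have stx : settled c a (f x) by rewrite fx.
  by have := Hh x fx; rewrite (w1 x stx) (settled_label idx stx) fx.
Qed.
End Moves.

(** * The initial approximation *)

Lemma ev_list (X I : Type) (N : R -> X -> Prop) (P : I -> X -> Prop) (l : list I) : filter_base N ->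
  (forall i, In i l -> eventually N (P i)) -> eventually N (fun x => forall i, In i l -> P i x).
Proof.
move=> bN; elim: l => [|i l IH] H; first by apply: ev_all => x i [].
apply: ev_mono (ev_and bN (H i (or_introl eq_refl)) (IH (fun j h => H j (or_intror h)))).
by move=> x [Hi Hl] j [<-|/Hl].
Qed.

Lemma wtot_tends (X : Type) (M : MetricSpace) (N : R -> X -> Prop) (L : list ((X -> R) * (X -> M))) l :
  filter_base N -> list_tends N L l -> tendsR N (fun x => wtot (list_at L x)) (wtot l).
Proof.
move=> bN; elim=> [|wF wm {}L {}l [Hw _] _ IH] /=; first exact: tendsR_cst.
exact: tendsR_add.
Qed.

Section Start.
Variables (X Y M : MetricSpace) (f : X -> Y) (p : X -> Seq).
Variables (U : Y -> Y -> Prop) (c : nat -> Y -> R) (idx : nat -> Y -> Y).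
Variables (V : bound_space) (em : M -> V) (D : V -> Prop) (r : V -> M).
Hypothesis evenp : forall x n, Nat.odd n = false -> p x n = 0.
Hypothesis pd : partition_data U c idx.
Hypothesis Av : averaging em D r.
Variables (g0 : X -> M) (sg : X -> R) (rho : Y -> R) (pts : Y -> list X).
Hypothesis rho0 : forall i, 0 < rho i.
Hypothesis safe : forall x l, weighted l -> clustered (g0 x) (sg x) l -> D (wavg em l).
Hypothesis net : forall x n, 0 < c n (f x) ->
  exists a, In a (pts (idx n (f x))) /\ ms_d (p x) (p a) < rho (idx n (f x)) / 2.
Hypothesis close : forall x n, 0 < c n (f x) -> forall a, In a (pts (idx n (f x))) ->
  ms_d (p x) (p a) < rho (idx n (f x)) -> ms_d (g0 x) (g0 a) < sg x.

Local Notation chart := (chart f p c).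
Local Notation bounded_by := (bounded_by f c idx).

Definition block (t : R) (i : Y) (z : Seq) : list (R * M) :=
  map (fun a => (t * Rmax 0 (rho i - ms_d z (p a)), g0 a)) (pts i).

Fixpoint blocks (N : nat) (s : nat -> Y) (t : nat -> R) (z : Seq) : list (R * M) :=
  match N with O => nil | S N => blocks N s t z ++ block (t N) (s N) z end.

(** Two lists with equal sums and totals have the same average. The bounds [N] and [s] are local
    choices, and different choices give lists differing by blocks of weight 0. *)
Definition same_mass (l l' : list (R * M)) : Prop := wsum em l = wsum em l' /\ wtot l = wtot l'.

Lemma same_mass_app l l' k k' : same_mass l l' -> same_mass k k' -> same_mass (l ++ k) (l' ++ k').
Proof. by move=> [h1 h2] [h3 h4]; split; rewrite ?wsum_cat ?wtot_cat ?h1 ?h2 ?h3 ?h4. Qed.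

Lemma block_zero i z : same_mass (block 0 i z) nil.
Proof.
rewrite /block; elim: (pts i) => [|a l [h1 h2]] //=.
by split => /=; rewrite ?h1 ?h2 ?Rmult_0_l ?vscal0 ?vadd0 ?Rplus_0_l.
Qed.

Lemma blocks_indep N N' s s' x : bounded_by N s x -> bounded_by N' s' x ->
  same_mass (blocks N s (fun n => c n (f x)) (p x)) (blocks N' s' (fun n => c n (f x)) (p x)).
Proof.
pose b K s0 := blocks K s0 (fun n => c n (f x)) (p x); rewrite -!/(b _ _).
have sym l l' : same_mass l l' -> same_mass l' l by move=> [h1 h2].
have trans l l' l'' : same_mass l l' -> same_mass l' l'' -> same_mass l l''.
  by move=> [h1 h2] [h3 h4]; split; congruence.
have ext K k s0 : bounded_by K s0 x -> same_mass (b (K + k)%nat s0) (b K s0).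
  move=> bK; elim: k => [|k IH]; first by rewrite Nat.add_0_r.
  rewrite Nat.add_succ_r -[X in same_mass _ X]app_nil_r; apply: same_mass_app => //.
  case: (weight_zero_or pd (K + k) (f x)) => [->|/bK [h _]]; last lia.
  exact: block_zero.
move=> bN bN'; apply: (trans _ _ _ (sym _ _ (ext N N' s bN))).
apply: (trans _ (b (N' + N)%nat s') _ _ (ext N' N s' bN')).
rewrite (Nat.add_comm N'); elim: (N + N')%nat => [|K IH] //=.
apply: same_mass_app => //.
case: (weight_zero_or pd K (f x)) => [->|pos].
  exact: (trans _ _ _ (block_zero _ _) (sym _ _ (block_zero _ _))).
by have [_ <-] := bN K pos; have [_ <-] := bN' K pos.
Qed.

Lemma in_blocks N s t z wm : In wm (blocks N s t z) <->
  exists n a, (n < N)%nat /\ In a (pts (s n)) /\ wm = (t n * Rmax 0 (rho (s n) - ms_d z (p a)), g0 a).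
Proof.
elim: N => [|N IH] /=; first by split => // -[n [a [h _]]]; lia.
rewrite in_app_iff IH /block in_map_iff; split.
  move=> [[n [a [h H]]]|[a [<- h]]]; first by exists n, a; split => //; lia.
  by exists N, a; split; [lia|].
move=> [n [a [h [ia E]]]]; have [nN|En] : (n < N)%nat \/ n = N by lia.
  by left; exists n, a.
by right; exists a; rewrite -En.
Qed.

Lemma blocks_total N s x : bounded_by N s x -> exists n, (n < N)%nat /\
  rho (s n) / 2 <= wtot (blocks N s (fun n => c n (f x)) (p x)).
Proof.
move=> bx; have [n cn] := pd_one pd (f x).
have pos : 0 < c n (f x) by rewrite cn; lra.
have [nN En] := bx n pos; have [a [ia pa]] := net pos; rewrite En in ia pa.
exists n; split => //.
have := @wtot_ge M (blocks N s (fun n => c n (f x)) (p x)) (c n (f x) * Rmax 0 (rho (s n) - ms_d (p x) (p a)), g0 a).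
rewrite /= cn Rmult_1_l => H; apply: Rle_trans (_ : _ <= Rmax 0 (rho (s n) - ms_d (p x) (p a))) _.
  by apply: Rle_trans (Rmax_r _ _); lra.
apply: H.
  move=> wm /in_blocks [n' [a' [_ [_ ->]]]] /=.
  by apply: Rmult_le_pos (Rmax_l _ _); have [] := pd_unit pd n' (f x).
by apply/in_blocks; exists n, a; rewrite cn Rmult_1_l.
Qed.

Lemma blocks_weighted N s x : bounded_by N s x -> weighted (blocks N s (fun n => c n (f x)) (p x)).
Proof.
move=> bx; split.
  move=> wm /in_blocks [n [a [_ [_ ->]]]] /=.
  by apply: Rmult_le_pos (Rmax_l _ _); have [] := pd_unit pd n (f x).
by have [n [_ h]] := blocks_total bx; have := rho0 (s n); lra.
Qed.

Lemma active_factors t q z a : 0 <= t -> 0 < t * Rmax 0 (q - ms_d z (p a)) -> 0 < t /\ ms_d z (p a) < q.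
Proof.
move=> [t0|<-]; last lra.
move=> pos; split => //; apply: Rnot_le_lt => le; move: pos; rewrite Rmax_left; lra.
Qed.

Lemma blocks_clustered N s x : bounded_by N s x ->
  clustered (g0 x) (sg x) (blocks N s (fun n => c n (f x)) (p x)).
Proof.
move=> bx wm /in_blocks [n [a [nN [ia ->]]]] /= pos.
have [c0 pa] : 0 < c n (f x) /\ ms_d (p x) (p a) < rho (s n).
  by apply: active_factors pos; have [] := pd_unit pd n (f x).
by have [_ E] := bx n c0; rewrite -E in ia pa; have := close c0 ia pa; lra.
Qed.

(** Averaging the constants [g0 a] with weights read off the chart makes the value depend on chart
    and label alone; it therefore has limits where [g0] may have none. *)
Lemma start_map (m0 : M) : exists g1 : X -> M, convergent f p c idx g1 /\
  forall x, exists l, weighted l /\ clustered (g0 x) (sg x) l /\ g1 x = r (wavg em l).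
Proof.
have [Nb HNb] := choice _ (fun x => active_bound pd (f x)).
have bb x : bounded_by (Nb x) (fun n => idx n (f x)) x by move=> n /(HNb x).
pose bl N s x := blocks N s (fun n => c n (f x)) (p x).
exists (fun x => r (wavg em (bl (Nb x) (fun n => idx n (f x)) x))); split; last first.
  move=> x; exists (bl (Nb x) (fun n => idx n (f x)) x).
  by split; [exact: blocks_weighted | split; [exact: blocks_clustered|]].
have wE N s x : bounded_by N s x -> wavg em (bl N s x) = wavg em (bl (Nb x) (fun n => idx n (f x)) x).
  by move=> bx; have [h1 h2] := blocks_indep bx (bb x); rewrite /wavg /bl h1 h2.
move=> B z [bB [[N [s Hs]] toz]].
have [ne|emp] := classic (forall d, 0 < d -> exists x, B d x); last first.
  (* If some basic set is empty, every point is a limit; [m0] is taken. *)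
  exists m0 => e e0; apply: NNPP => nev; apply: emp => d d0; apply: NNPP => nx.
  by apply: nev; exists d; split => // x Bx; case: nx; exists x.
have ev_ex P : eventually B P -> exists x, P x.
  by move=> [d [d0 Hd]]; have [x Bx] := ne d d0; exists x; apply: Hd.
(* The limit [z] is split into its [p] part [pz] and its weights [t]; the list formed from them is
   the limit of the lists at the points [x]. *)
pose pz : Seq := fun j => if Nat.odd j then z j else 0.
have top : tends B p pz.
  apply: tends_seq => // j; rewrite /pz; case E: (Nat.odd j).
    apply: (tendsR_ext bB (w := fun x => chart x j)); last exact: tends_coord toz.
    by apply: ev_all => x; rewrite /chart E.
  apply: (tendsR_ext bB (w := fun _ => 0)); last exact: tendsR_cst.
  by apply: ev_all => x; rewrite evenp.
have cn n : tendsR B (fun x => c n (f x)) (z (2 * n)%nat).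
  apply: (tendsR_ext bB (w := fun x => chart x (2 * n)%nat)); last exact: tends_coord toz.
  by apply: ev_all => x; rewrite chart_weight.
pose t n := z (2 * n)%nat.
have weight n i a : tendsR B (fun x => c n (f x) * Rmax 0 (rho i - ms_d (p x) (p a)))
    (t n * Rmax 0 (rho i - ms_d pz (p a))).
  apply: tendsR_mul => //; apply: tendsR_pos; apply: tendsR_sub => //; first exact: tendsR_cst.
  by apply: tends_dist => //; exact: tends_cst.
have [L [HL EL]] : exists L, list_tends B L (blocks N s t pz) /\ forall x, list_at L x = bl N s x.
  rewrite /bl; elim: (N) => [|K [L [HL EL]]] /=.
    by exists nil; split => //; exact: Forall2_nil.
  exists (L ++ map (fun a => (fun x => c K (f x) * Rmax 0 (rho (s K) - ms_d (p x) (p a)), fun _ => g0 a)) (pts (s K))).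
  split; last by move=> x; rewrite /list_at map_app -/(list_at L x) EL map_map.
  apply: Forall2_app => //; rewrite /block; elim: (pts (s K)) => [|a l IH] /=; first exact: Forall2_nil.
  by apply: Forall2_cons IH => /=; split; [exact: weight | exact: tends_cst].
have t0 n : 0 <= t n.
  apply: Rnot_lt_le => lt; have e0 : 0 < - t n by lra.
  have [x] := ev_ex _ (cn n _ e0); have [h _] := pd_unit pd n (f x); rewrite -/(t n); split_Rabs; lra.
have [be [be0 Hbe]] : exists be, 0 < be /\ forall n, (n < N)%nat -> be <= rho (s n) / 2.
  elim: (N) => [|K [be [be0 Hbe]]]; first by exists 1; split => [|n]; [lra | lia].
  exists (Rmin be (rho (s K) / 2)); split; first by apply: Rmin_glb_lt => //; have := rho0 (s K); lra.
  move=> n nK; have [/Hbe|->] : (n < K)%nat \/ n = K by lia.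
    by have := Rmin_l be (rho (s K) / 2); lra.
  exact: Rmin_r.
have pos : 0 < wtot (blocks N s t pz).
  apply: Rlt_le_trans be0 _; apply: Rnot_lt_le => lt.
  have e0 : 0 < be - wtot (blocks N s t pz) by lra.
  have [x [bx]] := ev_ex _ (ev_and bB Hs (wtot_tends bB HL e0)).
  have [n [nN h]] := blocks_total bx; rewrite EL /bl; have := Hbe n nN; split_Rabs; lra.
have wl : weighted (blocks N s t pz).
  split => // wm /in_blocks [n [a [_ [_ ->]]]] /=.
  by apply: Rmult_le_pos (Rmax_l _ _).
have act : eventually B (fun x => forall n, (n < N)%nat -> forall a, In a (pts (s n)) ->
    0 < t n * Rmax 0 (rho (s n) - ms_d pz (p a)) ->
    0 < c n (f x) * Rmax 0 (rho (s n) - ms_d (p x) (p a))).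
  apply: ev_nat => // n nN; apply: ev_list => // a ia.
  have [h|h] := classic (0 < t n * Rmax 0 (rho (s n) - ms_d pz (p a))); last first.
    by apply: ev_all => x /h.
  by apply: ev_mono (tendsR_gt (weight n (s n) a) h).
(* Positivity of a weight is an open condition, so an entry active in the limit is active at some
   nearby [x], the same for all entries; the limit list is thus clustered around [g0 x], although
   [g0] itself need not converge. *)
have Dl : D (wavg em (blocks N s t pz)).
  have [x [bx ax]] := ev_ex _ (ev_and bB Hs act).
  apply: (safe (x := x)) => // wm /in_blocks [n [a [nN [ia ->]]]] /= h.
  apply: (blocks_clustered bx (wm := (c n (f x) * Rmax 0 (rho (s n) - ms_d (p x) (p a)), g0 a))).
    by apply/in_blocks; exists n, a.
  exact: ax.
exists (r (wavg em (blocks N s t pz))).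
apply: (tends_ext bB (F := fun x => r (wavg em (list_at L x)))).
  by apply: ev_mono Hs => x bx; rewrite EL (wE N s x bx).
apply: (avg_tends Av bB HL pos) => //.
apply: ev_mono Hs => x bx; rewrite EL; apply: (safe (x := x)); first exact: blocks_weighted.
exact: blocks_clustered.
Qed.
End Start.

(** * Iteration of the moves *)

Section Iteration.
Variables (X Y M : MetricSpace) (f : X -> Y) (p : X -> Seq).
Variables (U : Y -> Y -> Prop) (c : nat -> Y -> R) (idx : nat -> Y -> Y).
Variables (V : bound_space) (em : M -> V) (D : V -> Prop) (r : V -> M).
Hypothesis Hf : perfect_map f.
Hypothesis cp : continuous p.
Hypothesis cubep : forall x, cube (p x).
Hypothesis evenp : forall x n, Nat.odd n = false -> p x n = 0.
Hypothesis pd : partition_data U c idx.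
Hypothesis Av : averaging em D r.
Hypothesis kM : kras_space M.
Hypothesis compM : complete_metric (@ms_d M).

Local Notation label := (label c idx).
Local Notation label_at := (label_at c idx).
Local Notation convergent := (convergent f p c idx).

(** A state is a map with the sizes allowed to its next move, label by label. The factor 4 is slack:
    later moves of one label add up to at most twice its current size. *)
Definition refines (a : nat) (s s' : (X -> M) * ((nat -> option Y) -> R)) : Prop :=
  (forall l, snd s' l <= snd s l / 4) /\
  (forall x, ms_d (fst s x) (fst s' x) < snd s (label_at a (f x))) /\
  forall y, settled c a y -> forall h : X -> M,
    (forall x, f x = y -> ms_d (h x) (fst s' x) < 4 * snd s' (label y)) ->
    good p (inv_succ a) (fiber f y) h.

(** The truncated label of a point may change with [a] before the point is settled; the displacement
    bound therefore asks for control over all of its truncated labels. *)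
Lemma iterated_moves (g1 : X -> M) (A0 : (nat -> option Y) -> R) : convergent g1 ->
  (forall l, 0 < A0 l <= 1) ->
  exists g : X -> M, continuous g /\
    (forall x b, (forall a, A0 (label_at a (f x)) <= b) -> ms_d (g1 x) (g x) <= 2 * b) /\
    forall k y, 0 < k -> good p k (fiber f y) g.
Proof.
move=> cg1 A01.
pose St := {gA : (X -> M) * ((nat -> option Y) -> R) | convergent (fst gA) /\ forall l, 0 < snd gA l}.
have [step Hstep] : exists step : nat -> St -> St, forall a st,
    refines a (proj1_sig st) (proj1_sig (step a st)).
  apply: (choice (fun a (step : St -> St) => forall st, refines a (proj1_sig st) (proj1_sig (step st)))) => a.
  apply: (choice (fun (st st' : St) => refines a (proj1_sig st) (proj1_sig st'))) => -[[g A] [/= cg A_pos]].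
  have [g' [et [cg' [et0 [small gd]]]]] := move_map Hf cp cubep evenp pd Av kM a cg A_pos.
  have A'0 l : 0 < Rmin (A l) (et l) / 4.
    by have := Rmin_glb_lt _ _ _ (A_pos l) (et0 l); lra.
  exists (exist _ (g', fun l => Rmin (A l) (et l) / 4) (conj cg' A'0)).
  split; [|split] => //=.
    by move=> l; have := Rmin_l (A l) (et l); lra.
  move=> y st h Hh; apply: (gd y st) => x fx; have := Hh x fx.
  by have := Rmin_r (A (label y)) (et (label y)); lra.
pose st n : St := nat_rect (fun _ => St) (exist _ (g1, A0) (conj cg1 (fun l => proj1 (A01 l))))
  (fun n s => step n s) n.
pose v n := fst (proj1_sig (st n)); pose A n := snd (proj1_sig (st n)).
have vS n x : ms_d (v n x) (v (S n) x) < A n (label_at n (f x)) by have [_ [H _]] := Hstep n (st n); apply: H.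
have AS n l : A (S n) l <= A n l / 4 by have [H _] := Hstep n (st n); apply: H.
have A_pos n l : 0 < A n l by have [_ H] := proj2_sig (st n); apply: H.
have Apow n k l : A (n + k)%nat l <= A n l * (/ 4) ^ k.
  elim: k => [|k IH]; first by rewrite Nat.add_0_r /=; lra.
  by rewrite Nat.add_succ_r /=; have := AS (n + k)%nat l; lra.
have vpow b x : (forall a, A0 (label_at a (f x)) <= b) -> forall n, ms_d (v n x) (v (S n) x) <= b * (/ 4) ^ n.
  move=> Hb n; have := vS n x; have := Apow 0%nat n (label_at n (f x)); rewrite Nat.add_0_l.
  have q : 0 <= (/ 4) ^ n by apply: pow_le; lra.
  have := Rmult_le_compat_r _ _ _ q (Hb n); rewrite -/(A 0%nat (label_at n (f x))) => h1 h2 h3.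
  by apply: Rle_trans (Rlt_le _ _ h3) (Rle_trans _ _ _ h2 h1).
have v1 x n : ms_d (v n x) (v (S n) x) <= 1 * (/ 4) ^ n.
  by apply: vpow => a; have [] := A01 (label_at a (f x)).
have [g Hg] : exists g : X -> M, forall x e, 0 < e -> exists N, forall n, (N <= n)%nat -> ms_d (v n x) (g x) < e.
  apply: (choice (fun x l => forall e, 0 < e -> exists N, forall n, (N <= n)%nat -> ms_d (v n x) l < e)) => x.
  by apply: (geometric_limit compM Rle_0_1) => n; apply: v1.
have tail n C x : 0 <= C -> (forall k, ms_d (v (n + k)%nat x) (v (S (n + k)) x) <= C * (/ 4) ^ k) ->
    ms_d (v n x) (g x) <= 2 * C.
  move=> C0 H; have := @geometric_bound M (fun k => v (n + k)%nat x) C (g x) C0; rewrite Nat.add_0_r; apply.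
    by move=> k; rewrite Nat.add_succ_r.
  move=> e /(Hg x) [N HN]; exists N => k Nk; apply: HN; lia.
exists g; split; [|split].
- move=> x e e0; have e3 : 0 < e / 8 by lra.
  have q1 : Rabs (/ 4) < 1 by rewrite Rabs_right; lra.
  have [N /(_ N (le_n _)) HN] := pow_lt_1_zero (/ 4) q1 _ e3.
  have qN : 0 <= (/ 4) ^ N by apply: pow_le; lra.
  move: HN; rewrite Rabs_right; first lra.
  move=> HN; have unif x' : ms_d (v N x') (g x') <= 2 * (/ 4) ^ N.
    by apply: tail => // k; have := v1 x' (N + k)%nat; rewrite Rmult_1_l pow_add.
  have [cvN _] := proj2_sig (st N); rewrite -/(v N) in cvN.
  have e2 : 0 < e / 4 by lra.
  have [d [d0 Hd]] := convergent_continuous (proj1 Hf) cp pd cvN x e2.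
  exists d; split => // x' /Hd h; have := unif x; have := unif x'.
  have := ms_tri (v N x) (g x) (g x'); have := ms_tri (v N x') (v N x) (g x').
  by rewrite (ms_sym (g x) (v N x)); lra.
- move=> x b Hb; have b0 : 0 <= b by have := Hb 0%nat; have [] := A01 (label_at 0 (f x)); lra.
  by apply: (tail 0%nat b x b0) => k; apply: vpow.
- move=> k y k0; have [a0 sy] := settled_exists pd y; have [b Hb] := inv_succ_small k0.
  have sa n : (a0 + b <= n)%nat -> settled c n y by move=> h; apply: settled_mono sy; lia.
  have /Hb lt : (b <= a0 + b)%nat by lia.
  have le : inv_succ (a0 + b) <= k by lra.
  (* From stage [a0 + b] on, the truncated labels over [y] equal [label y]; the remaining
     displacement is at most twice the size kept for that label, within the tolerance earned at this
     stage. *)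
  apply: (good_mono le); have [_ [_ gd]] := Hstep (a0 + b)%nat (st (a0 + b)%nat).
  apply: (gd y (sa _ (le_n _))) => x fx.
  rewrite -/(st (S (a0 + b))) -/(v (S (a0 + b))) -/(A (S (a0 + b))).
  have Apos' := A_pos (S (a0 + b)) (label y).
  have := tail (S (a0 + b)) (A (S (a0 + b)) (label y)) x (Rlt_le _ _ Apos'); rewrite ms_sym.
  move=> H; apply: Rle_lt_trans (H _) _; last lra.
  move=> j; apply: Rle_trans (Rlt_le _ _ (vS _ x)) _.
  rewrite settled_label; first by rewrite fx; apply: sa; lia.
  by rewrite fx; exact: Apow.
Qed.
End Iteration.

(** * Density *)

Lemma positive_lower_bound (X : MetricSpace) (K : X -> Prop) (eps : X -> R) : ucpt K ->
  continuous_real eps -> (forall x, K x -> 0 < eps x) -> exists e, 0 < e /\ forall x, K x -> e < eps x.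
Proof.
move=> cK ce e0; apply: (ucpt_lebesgue (P := fun x e => e < eps x) cK).
  by move=> x s s' le; lra.
move=> x Kx; have e4 : 0 < eps x / 4 by have := e0 x Kx; lra.
have [d [d0 Hd]] := ce x _ e4; exists (Rmin d (eps x / 4)); split; first exact: Rmin_glb_lt.
move=> x' xx _; have := Rmin_l d (eps x / 4); have := Rmin_r d (eps x / 4) => h1 h2.
have : Rabs (eps x - eps x') < eps x / 4 by apply: Hd; lra.
by split_Rabs; lra.
Qed.

Section Density.
Variables (X Y M : MetricSpace) (f : X -> Y) (p : X -> Seq).
Variables (V : bound_space) (em : M -> V) (D : V -> Prop) (r : V -> M).
Hypothesis Hf : perfect_map f.
Hypothesis cp : continuous p.
Hypothesis cubep : forall x, cube (p x).
Hypothesis evenp : forall x n, Nat.odd n = false -> p x n = 0.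
Hypothesis injp : forall x x', f x = f x' -> p x = p x' -> x = x'.
Hypothesis Av : averaging em D r.
Hypothesis kM : kras_space M.
Hypothesis compM : complete_metric (@ms_d M).

Lemma safe_radius (g0 : X -> M) (eps : X -> R) : continuous g0 -> continuous_real eps -> (forall x, 0 < eps x) ->
  exists sg : X -> R, (forall x, 0 < sg x <= 1) /\ (forall x x', Rabs (sg x - sg x') <= ms_d x x') /\
    forall x l, weighted l -> clustered (g0 x) (sg x) l ->
      D (wavg em l) /\ ms_d (g0 x) (r (wavg em l)) < eps x / 2.
Proof.
move=> cg ce e0.
apply: (lipschitz_minorant (P := fun x s => forall l, weighted l -> clustered (g0 x) s l ->
      D (wavg em l) /\ ms_d (g0 x) (r (wavg em l)) < eps x / 2)).
  by move=> x s s' _ le H l wl cl; apply: H => // wm iwm /(cl wm iwm); lra.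
move=> x0; have e8 : 0 < eps x0 / 8 by have := e0 x0; lra.
have [dl [dl0 Hdl]] := safe_point Av (g0 x0) e8.
have m0 : 0 < Rmin (dl / 2) (eps x0 / 8) by apply: Rmin_glb_lt; lra.
have ml := Rmin_l (dl / 2) (eps x0 / 8); have mr := Rmin_r (dl / 2) (eps x0 / 8).
have [d1 [d10 H1]] := cg x0 _ m0; have [d2 [d20 H2]] := ce x0 _ e8.
pose s := Rmin (dl / 2) (Rmin d1 d2).
have s1 : s <= dl / 2 by apply: Rmin_l.
have s2 : s <= d1 by apply: Rle_trans (Rmin_r _ _) (Rmin_l _ _).
have s3 : s <= d2 by apply: Rle_trans (Rmin_r _ _) (Rmin_r _ _).
exists s; split; first by do 2 (apply: Rmin_glb_lt; try lra).
move=> x xx l wl cl.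
have h1 : ms_d (g0 x0) (g0 x) < Rmin (dl / 2) (eps x0 / 8) by apply: H1; lra.
have h2 : Rabs (eps x0 - eps x) < eps x0 / 8 by apply: H2; lra.
have [|Dl near] := Hdl l wl.
  by move=> wm iwm /(cl wm iwm); have := ms_tri (g0 x) (g0 x0) (snd wm); lra.
split => //; have := ms_tri (g0 x0) (g0 x) (r (wavg em l)); rewrite (ms_sym (g0 x) (g0 x0)).
by move: h2; split_Rabs; lra.
Qed.

(** The data of a vertex are a radius for distances under [p], a finite list of points of [X], and a
    lower bound for [eps]; they are to work for all fibres near [y]. *)
Definition vertex_nbhd (g0 : X -> M) (eps sg : X -> R) (v : R * list X * R) (y : Y) : Prop :=
  exists s, 0 < s /\ forall x, ms_d y (f x) < s ->
    snd v < eps x /\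
    (exists a, In a (snd (fst v)) /\ ms_d (p x) (p a) < fst (fst v) / 2) /\
    forall a, In a (snd (fst v)) -> ms_d (p x) (p a) < fst (fst v) -> ms_d (g0 x) (g0 a) < sg x.

(** On the compact fibre over [y] the map [p] is injective, so points close under [p] have close
    values of [g0]; this provides the radius. A tube around the fibre then inherits the three
    conditions. *)
Lemma vertex_exists (g0 : X -> M) (eps sg : X -> R) y : continuous g0 -> continuous_real eps ->
  (forall x, 0 < eps x) -> (forall x, 0 < sg x) -> (forall x x', Rabs (sg x - sg x') <= ms_d x x') ->
  exists v, (0 < fst (fst v) /\ 0 < snd v) /\ vertex_nbhd g0 eps sg v y.
Proof.
move=> cg ce e0 sg0 sglip; have cF := fiber_ucpt Hf (y := y).
have [e [e_pos He]] := positive_lower_bound cF ce (fun x _ => e0 x).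
have [rho [rho0 Hrho]] : exists rho, 0 < rho /\ forall x a, fiber f y x -> fiber f y a ->
    ms_d (p x) (p a) <= rho -> ms_d (g0 x) (g0 a) < sg x.
  apply: NNPP => nr.
  have bad j : exists xa : X * X, (fiber f y (fst xa) /\ fiber f y (snd xa)) /\
      ms_d (p (fst xa)) (p (snd xa)) <= inv_succ j /\ sg (fst xa) <= ms_d (g0 (fst xa)) (g0 (snd xa)).
    apply: NNPP => nb; apply: nr; exists (inv_succ j); split; first exact: inv_succ_pos.
    move=> x a fx fa le; apply: Rnot_le_lt => ge; apply: nb; by exists (x, a).
  have [xa Hxa] := choice _ bad.
  have [x [fx xu]] := cF (fun j => fst (xa j)) (fun j => proj1 (proj1 (Hxa j))).
  have [a [fa au]] := cF (fun j => snd (xa j)) (fun j => proj2 (proj1 (Hxa j))).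
  have E : x = a.
    apply: injp; first by rewrite fx fa.
    apply: ms_eq; apply: Rle_antisym; last exact: ms_ge0.
    apply: (ulim_dist_le (ulim_cont cp xu) (ulim_cont cp au)) => d d0.
    by apply: ufW (uf_inv_succ d0) => j; have [_ [h _]] := Hxa j; lra.
  have : sg x <= ms_d (g0 x) (g0 a); last by rewrite -E ms_refl; have := sg0 x; lra.
  apply: (ulim_dist_ge (ulim_cont cg xu) (ulim_cont cg au)) => d d0.
  apply: ufW (xu d d0) => j h; have [_ [_ h']] := Hxa j.
  by have := sglip x (fst (xa j)); split_Rabs; lra.
have cpF : continuous_within (fiber f y) p.
  by move=> z d _ d0; have [d' [d'0 H]] := cp z d0; exists d'; split => // z' _; apply: H.
have rh2 : 0 < rho / 2 by lra.
have [d [d0 Hd]] := uniform_continuity cpF cF rh2.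
have [l [lF Hl]] := ucpt_net cF d0.
exists (rho, l, e); split => //.
(* The implication is restated as a disjunction of strict inequalities, which is an open
   condition. *)
have [||s [s0 Hs]] := @perfect_tube X Y f Hf (fun x => e < eps x /\ (exists a, In a l /\ ms_d (p x) (p a) < rho / 2) /\
   forall a, In a l -> rho < ms_d (p x) (p a) \/ ms_d (g0 x) (g0 a) < sg x) y.
- move=> x [h1 [[a [la h2]] h3]].
  have bb := ball_base_mono (x0 := x).
  have teps : tendsR (ball_base x) eps (eps x).
    move=> d' /(ce x) [d'' [d''0 Hd'']]; exists d''; split => // x' /Hd''.
    by rewrite Rabs_minus_sym.
  have tsg : tendsR (ball_base x) sg (sg x).
    move=> d' d'0; exists d'; split => // x'; rewrite /ball_base => xx.
    by have := sglip x x'; rewrite Rabs_minus_sym; lra.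
  have tp b : tendsR (ball_base x) (fun x' => ms_d (p x') (p b)) (ms_d (p x) (p b)).
    by apply: tends_dist => //; [exact: (proj1 (continuousP p) cp x) | exact: tends_cst].
  have tg b : tendsR (ball_base x) (fun x' => sg x' - ms_d (g0 x') (g0 b)) (sg x - ms_d (g0 x) (g0 b)).
    apply: tendsR_sub => //.
    by apply: tends_dist => //; [exact: (proj1 (continuousP g0) cg x) | exact: tends_cst].
  apply: (ev_and bb (tendsR_gt teps h1)); apply: (ev_and bb).
    have gap : 0 < rho / 2 - ms_d (p x) (p a) by lra.
    by apply: ev_mono (tp a _ gap) => x' h; exists a; split => //; split_Rabs; lra.
  apply: ev_list => // b lb; case: (h3 b lb) => h.
    by apply: ev_mono (tendsR_gt (tp b) h) => x'; left.
  have h' : 0 < sg x - ms_d (g0 x) (g0 b) by lra.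
  by apply: ev_mono (tendsR_gt (tg b) h') => x' h''; right; lra.
- move=> x fx; split; first exact: He.
  split.
    by have [a [la ax]] := Hl x fx; exists a; split => //; rewrite ms_sym; apply: Hd => //; apply: lF.
  move=> a /lF fa; have [h|h] := Rlt_le_dec rho (ms_d (p x) (p a)); first by left.
  by right; apply: Hrho.
- exists s; split => // x /Hs [h1 [h2 h3]]; do 2 (split => //).
  by move=> a la /= lt; case: (h3 a la) => //; move: lt => /= lt h4; lra.
Qed.

Lemma good_dense (g0 : X -> M) (eps : X -> R) : continuous g0 -> continuous_real eps ->
  (forall x, 0 < eps x <= 1) ->
  exists g : X -> M, continuous g /\ (forall x, ms_d (g x) (g0 x) < eps x) /\
    forall k y, 0 < k -> good p k (fiber f y) g.
Proof.
move=> cg ce e01; have e0 x : 0 < eps x by have [] := e01 x.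
have [[x0]|none] := classic (inhabited X); last first.
  exists g0; split => //; split; first by move=> x; case: none; exact: inhabits.
  by move=> k y _ C [[x _] _]; case: none; exact: inhabits.
have [sg [sg01 [sglip safe]]] := safe_radius cg ce e0.
have sg0 x : 0 < sg x by have [] := sg01 x.
have [v Hv] := choice _ (fun y => vertex_exists y cg ce e0 sg0 sglip).
pose U i y := vertex_nbhd g0 eps sg (v i) y.
have oU i : open_set (@ms_d Y) (U i).
  move=> y [s [s0 Hs]]; exists (s / 2); split; first lra.
  move=> z yz; exists (s / 2); split; first lra.
  by move=> x zx; apply: Hs; have := ms_tri z y (f x); lra.
have [|c [idx pd]] := partition_exists oU.
  by move=> y; exists y; have [_] := Hv y.
have active x n : 0 < c n (f x) -> snd (v (idx n (f x))) < eps x /\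
    (exists a, In a (snd (fst (v (idx n (f x))))) /\ ms_d (p x) (p a) < fst (fst (v (idx n (f x)))) / 2) /\
    forall a, In a (snd (fst (v (idx n (f x))))) -> ms_d (p x) (p a) < fst (fst (v (idx n (f x)))) ->
      ms_d (g0 x) (g0 a) < sg x.
  by move=> /(pd_sub pd) [s [s0 Hs]]; apply: Hs; rewrite ms_refl.
have [||||g1 [cg1 Hg1]] := @start_map X Y M f p U c idx V em D r evenp pd Av g0 sg
  (fun i => fst (fst (v i))) (fun i => snd (fst (v i))) _ _ _ _ (g0 x0).
- by move=> i; have [[]] := Hv i.
- by move=> x l wl cl; have [] := safe x l wl cl.
- by move=> x n /active [_ []].
- by move=> x n /active [_ []].
(* Any vertex in the label supplies a lower bound for [eps] over its whole cover member, and this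
   bound depends on the label only. *)
have [A0 HA0] : exists A0 : (nat -> option Y) -> R, forall l, 0 < A0 l <= 1 /\
    forall x a, label_at c idx a (f x) = l -> A0 l <= eps x / 4.
  apply: (choice (fun l A => 0 < A <= 1 /\ forall x a, label_at c idx a (f x) = l -> A <= eps x / 4)) => l.
  have [[n [i Hl]]|none] := classic (exists n i, l n = Some i); last first.
    (* A label without vertices never occurs: a weight equal to 1 exceeds [inv_succ a / 2] at every
       stage. *)
    exists 1; split; first lra; move=> x a E; case: none.
    have [n cn] := pd_one pd (f x); exists n, (idx n (f x)); rewrite -E /label_at cn.
    have := @inv_succ_anti 0 a (le_0_n a); have E0 : inv_succ 0 = 1 by rewrite /inv_succ /=; lra.
    by move=> le1; case: Rlt_dec => // ge1; exfalso; lra.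
  have [[_ vi] _] := Hv i; exists (Rmin 1 (snd (v i) / 4)); split.
    by split; [apply: Rmin_glb_lt; lra | exact: Rmin_l].
  move=> x a E; move: Hl; rewrite -E /label_at; case: Rlt_dec => // h [Ei].
  have pos : 0 < c n (f x) by have := inv_succ_pos a; lra.
  by have [h1 _] := active x n pos; rewrite Ei in h1; have := Rmin_r 1 (snd (v i) / 4); lra.
have [g [cgg [near gd]]] := iterated_moves Hf cp cubep evenp pd Av kM compM cg1 (fun l => proj1 (HA0 l)).
exists g; split => //; split => // x.
have h1 := near x (eps x / 4) (fun a => proj2 (HA0 _) x a eq_refl).
have h2 : ms_d (g0 x) (g1 x) < eps x / 2.
  by have [l [wl [cl ->]]] := Hg1 x; have [] := safe x l wl cl.
have := ms_tri (g1 x) (g x) (g0 x).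
by rewrite (ms_sym (g x) (g1 x)) (ms_sym (g1 x) (g0 x)); lra.
Qed.
End Density.

Lemma fiberwise_kras (X Y M : MetricSpace) (f : X -> Y) (V : bound_space) (em : M -> V) (D : V -> Prop) (r : V -> M) :
  perfect_map f -> averaging em D r -> kras_space M -> complete_metric (@ms_d M) ->
  fiberwise_kras_dense_Gdelta M f.
Proof.
move=> Hf Av kM compM.
have [p [cp [cubep [evenp injp]]]] := fiber_embedding Hf.
exists (fun g => forall n, fiberwise_good f p (inv_succ n) g); split; [|split; [|split]].
- by move=> g /(_ 0%nat) [].
- exists (fun n => fiberwise_good f p (inv_succ n)); split => // n.
  exact: fiberwise_good_open.
- move=> W [Wc oW] [g0 Wg0]; have [eps [ce [e01 He]]] := oW g0 Wg0.
  have [g [cg [near gd]]] := good_dense Hf cp cubep evenp injp Av kM compM (Wc g0 Wg0) ce e01.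
  exists g; split; first exact: He.
  by move=> n; split => // y; apply: gd; apply: inv_succ_pos.
- move=> g Hg y; have [cg _] := Hg 0%nat.
  apply: (good_kras (p := p) cp cg (fiber_ucpt Hf (y := y))).
    by move=> x x' fx fx'; apply: injp; rewrite fx fx'.
  move=> k k0; have [n Hn] := inv_succ_small k0; have [_ gn] := Hg n.
  by apply: good_mono (gn y); have := Hn n (le_n _); lra.
Qed.

(** * Change of metric *)

Definition finer {T : Type} (d d' : T -> T -> R) : Prop :=
  forall m e, 0 < e -> exists dl, 0 < dl /\ forall m', d m m' < dl -> d' m m' < e.

Section MetricChange.
Variables (T : Type) (d d' : T -> T -> R) (Hd : is_metric d) (Hd' : is_metric d').
Hypothesis fin : finer d d'.

Let M := {| ms_d := d; ms_metric := Hd |}.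
Let M' := {| ms_d := d'; ms_metric := Hd' |}.

Lemma finer_continuous (X : MetricSpace) (g : X -> T) : @continuous X M g -> @continuous X M' g.
Proof.
move=> cg x e /(fin (g x)) [e' [/(cg x) [dl [dl0 H]] He']].
by exists dl; split => // x' /H /He'.
Qed.

(** Metrics with the same topology need not be uniformly equivalent; a tolerance for one becomes a
    variable tolerance for the other along a continuous [g]. This makes the source limitation
    topology independent of the metric. *)
Lemma finer_tolerance (X : MetricSpace) (g : X -> T) (eps : X -> R) : @continuous X M g ->
  continuous_real eps -> (forall x, 0 < eps x) ->
  exists eps' : X -> R, continuous_real eps' /\ (forall x, 0 < eps' x <= 1) /\
    forall x m, d m (g x) < eps' x -> d' m (g x) < eps x.
Proof.
move=> cg ce e0.
have [||sg [sg01 [lip H]]] := @lipschitz_minorant X (fun x s => forall m, d m (g x) < s -> d' m (g x) < eps x).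
- by move=> x s s' _ le H m lt; apply: H; lra.
- move=> x0; have e4 : 0 < eps x0 / 4 by have := e0 x0; lra.
  have [dl [dl0 Hdl]] := fin (g x0) e4; have dl2 : 0 < dl / 2 by lra.
  have [d1 [d10 H1]] := cg x0 _ dl2; have [d2 [d20 H2]] := ce x0 _ e4.
  pose s := Rmin (dl / 2) (Rmin d1 d2).
  have s1 : s <= dl / 2 by apply: Rmin_l.
  have s2 : s <= d1 by apply: Rle_trans (Rmin_r _ _) (Rmin_l _ _).
  have s3 : s <= d2 by apply: Rle_trans (Rmin_r _ _) (Rmin_r _ _).
  exists s; split; first by do 2 (apply: Rmin_glb_lt; try lra).
  move=> x xx m mx.
  have h1 : d (g x0) (g x) < dl / 2 by apply: (H1 x); lra.
  have h2 : Rabs (eps x0 - eps x) < eps x0 / 4 by apply: H2; lra.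
  have h3 : d (g x0) m < dl.
    by have := @ms_tri M (g x) (g x0) m; rewrite (@ms_sym M (g x) m) /=; lra.
  have h4 : d' (g x0) (g x) < eps x0 / 4 by apply: Hdl; lra.
  have h5 := Hdl _ h3.
  have := @ms_tri M' (g x0) m (g x); rewrite (@ms_sym M' m (g x0)) /=.
  by move: h2; split_Rabs; lra.
- exists sg; split; last by [].
  by move=> x e ep; exists e; split => // x' xx; have := lip x x'; lra.
Qed.
End MetricChange.

Section EquivalentMetrics.
Variables (T : Type) (d d' : T -> T -> R) (Hd : is_metric d) (Hd' : is_metric d').
Hypothesis fin : finer d d'.
Hypothesis fin' : finer d' d.

Let M := {| ms_d := d; ms_metric := Hd |}.
Let M' := {| ms_d := d'; ms_metric := Hd' |}.

Lemma SL_open_change (X : MetricSpace) (W : (X -> T) -> Prop) : @SL_open X M' W -> @SL_open X M W.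
Proof.
move=> [Wc oW]; split; first by move=> g /Wc; apply: (finer_continuous (Hd := Hd') Hd fin').
move=> g Wg; have [eps [ce [e01 H]]] := oW g Wg.
have cg : @continuous X M g by apply: (finer_continuous (Hd := Hd') Hd fin'); apply: Wc.
have [eps' [ce' [e01' H']]] := finer_tolerance Hd' fin cg ce (fun x => proj1 (e01 x)).
exists eps'; do 2 (split => //); move=> h ch near; apply: H; first exact: (finer_continuous (Hd := Hd) Hd' fin).
by move=> x; apply: H'; apply: near.
Qed.

(** A constant tolerance becomes a variable one, which has a positive lower bound because the domain
    is compact. *)
Lemma kras_space_change : kras_space M -> kras_space M'.
Proof.
move=> kM X cX f e cf e0.
have cf' : @continuous X M f by apply: (finer_continuous (Hd := Hd') Hd fin').
have [|//|eps [ceps [eps01 Heps]]] := finer_tolerance Hd' fin cf' (eps := fun _ => e).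
  by move=> x d1 d10; exists 1; split; [lra | move=> x' _; rewrite Rminus_diag Rabs_R0].
have [|s [s0 Hs]] := positive_lower_bound (compact_ucpt cX) ceps; first by move=> x _; case: (eps01 x).
have [g [cg [kg near]]] := kM X cX f s cf' s0.
exists g; split; first exact: (finer_continuous (Hd := Hd) Hd' fin).
split; first exact: kg.
by move=> x; apply: Heps; have := near x; have := Hs x I; simpl; lra.
Qed.
End EquivalentMetrics.

(** Completeness and averages are available for a metric [d1] adapted to [M], while the conclusion
    is stated for the given metric. *)
Lemma fiberwise_kras_change (X Y M : MetricSpace) (f : X -> Y) (d1 : M -> M -> R) (Hd1 : is_metric d1)
    (V : bound_space) (em : M -> V) (D : V -> Prop) (r : V -> M) :
  perfect_map f -> finer (@ms_d M) d1 -> finer d1 (@ms_d M) ->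
  kras_space M -> complete_metric d1 -> @averaging {| ms_d := d1; ms_metric := Hd1 |} V em D r ->
  fiberwise_kras_dense_Gdelta M f.
Proof.
case: M d1 Hd1 em r => T d Hd /= d1 Hd1 em r Hf fin fin' kM comp Av.
have [S [Sc [[W [oW SW]] [Sd Sk]]]] := fiberwise_kras Hf Av (kras_space_change fin fin' kM) comp.
exists S; split; first by move=> g /Sc; apply: (finer_continuous (Hd := Hd1) Hd fin').
split; first by exists W; split => // n; exact: (SL_open_change Hd fin fin' (oW n)).
split; first by move=> W' oW'; apply: Sd; exact: (SL_open_change Hd1 fin' fin oW').
exact: Sk.
Qed.

Lemma fiberwise_kras_empty (X Y M : MetricSpace) (f : X -> Y) : ~ inhabited M -> fiberwise_kras_dense_Gdelta M f.
Proof.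
move=> nM; exists (@continuous X M); split => //; split; last split.
- exists (fun _ => @continuous X M); split; last by move=> g; split => // /(_ 0%nat).
  move=> _; split => // g _; exists (fun _ => 1); split; last by split => // x; lra.
  by move=> x e e0; exists 1; split; [lra | move=> x' _; rewrite Rminus_diag Rabs_R0].
- by move=> W [Wc _] [g Wg]; exists g; split => //; apply: Wc.
- by move=> g _ y C [[x _] _]; case: nM; exact: inhabits (g x).
Qed.

(** * Convex sets and absolute neighbourhood retracts *)

Lemma weights_null (M : MetricSpace) (V : bound_space) (em : M -> V) (l : list (R * M)) :
  (forall wm, In wm l -> 0 <= fst wm) -> wtot l = 0 -> wsum em l = vzero.
Proof.
elim: l => [|[w m] l IH] //= Hl tot.
have w0 : 0 <= w by apply: (Hl (w, m)); left.
have l0 : 0 <= wtot l by apply: wtot_ge0 => wm iwm; apply: Hl; right.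
rewrite IH; [by move=> wm iwm; apply: Hl; right | lra |].
by have -> : w = 0 by [lra]; rewrite vscal0 vadd0.
Qed.

Lemma wavg_convex (M : MetricSpace) (V : bound_space) (em : M -> V) (K : V -> Prop) :
  (forall x y t, K x -> K y -> 0 <= t <= 1 -> K (vadd (vscal t x) (vscal (1 - t) y))) ->
  (forall m, K (em m)) -> forall l, weighted l -> K (wavg em l).
Proof.
move=> cK Kem; elim=> [|[w m] l IH] [Hl] /=; first by move/Rlt_irrefl.
move=> tot; have w0 : 0 <= w by apply: (Hl (w, m)); left.
have Hl' wm : In wm l -> 0 <= fst wm by move=> iwm; apply: Hl; right.
case: (wtot_ge0 Hl') => [l0|l0]; last first.
  rewrite /wavg /= (weights_null em Hl' (eq_sym l0)) vadd0 vscalA -l0 Rplus_0_r Rinv_l ?vscal1 //; lra.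
have Kl := IH (conj Hl' l0).
pose t := w / (w + wtot l).
have t01 : 0 <= t <= 1.
  split; first by apply: Rle_mult_inv_pos; lra.
  by apply: (Rmult_le_reg_r (w + wtot l)); [lra | rewrite /t /Rdiv Rmult_assoc Rinv_l; lra].
suff -> : wavg em ((w, m) :: l) = vadd (vscal t (em m)) (vscal (1 - t) (wavg em l)) by exact: cK.
rewrite /wavg /= vscalDr !vscalA.
have -> : / (w + wtot l) * w = t by rewrite /t; field; lra.
by have -> : (1 - t) * / wtot l = / (w + wtot l) by rewrite /t; field; lra.
Qed.

Section BanachCase.
Variables (B : Banach).

Lemma bound_space_of_Banach_scal (a : R) (x : B) r : bnorm x <= r -> bnorm (bscal a x) <= Rabs a * r.
Proof. by rewrite b_norm_scal => h; apply: Rmult_le_compat_l => //; exact: Rabs_pos. Qed.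

Definition banach_space : bound_space := {|
  vec := B; vzero := bzero; vadd := badd; vscal := bscal; nle := fun x r => bnorm x <= r;
  vaddA := @b_add_assoc B; vaddC := @b_add_comm B; vadd0 := @b_add_zero B; vaddN := @b_add_opp B;
  vscal1 := @b_scal_one B; vscalA := @b_scal_scal B; vscalDl := @b_scal_addR B; vscalDr := @b_scal_addV B;
  nle_mono := fun x r s h h' => Rle_trans _ _ _ h h';
  nle_add := fun x y r s h h' => Rle_trans _ _ _ (@b_norm_triangle B x y) (Rplus_le_compat _ _ _ _ h h');
  nle_scal := bound_space_of_Banach_scal |}.

Lemma bnorm_zero : bnorm (bzero : B) = 0.
Proof.
have E : (bzero : B) = bscal 0 bzero by exact: (eq_sym (vscal0 (bzero : banach_space))).
by rewrite E b_norm_scal Rabs_R0 Rmult_0_l.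
Qed.

Lemma bdist_metric : is_metric (@bdist B).
Proof.
have cancel (x y : banach_space) : vadd (vsub x y) y = x.
  by rewrite /vsub -vaddA (vaddC (vscal _ _)) vaddN vadd0.
have negsub (x y : banach_space) : vscal (-1) (vsub x y) = vsub y x.
  by rewrite /vsub vscalDr vscalA vaddC; have -> : -1 * -1 = 1 by [ring]; rewrite vscal1.
split; [|split; [|split]].
- by move=> x y; exact: b_norm_nonneg.
- move=> x y; split => [/b_norm_zero E|->].
    by rewrite -(cancel x y) /vsub /= E b_add_comm b_add_zero.
  by rewrite /bdist b_add_opp bnorm_zero.
- move=> x y; have E : badd x (bscal (-1) y) = bscal (-1) (badd y (bscal (-1) x)) := eq_sym (negsub y x).
  rewrite /bdist E.
  by rewrite b_norm_scal Rabs_Ropp Rabs_R1 Rmult_1_l.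
- move=> x y z; rewrite /bdist; have -> : badd x (bscal (-1) z) = badd (badd x (bscal (-1) y)) (badd y (bscal (-1) z)).
    have E : badd (badd x (bscal (-1) y)) y = x := cancel x y.
    by rewrite b_add_assoc E.
  exact: b_norm_triangle.
Qed.
End BanachCase.

Lemma fiberwise_kras_convex (X Y M : MetricSpace) (f : X -> Y) : perfect_map f -> kras_space M ->
  homeo_closed_convex_Banach M -> fiberwise_kras_dense_Gdelta M f.
Proof.
move=> Hf kM [B [K [h [clK [cvK [Kh [hK [injh [h_inv h_cont]]]]]]]]].
have [[m0]|nM] := classic (inhabited M); last exact: fiberwise_kras_empty.
pose d1 m m' := bdist (h m) (h m').
have [g1 [g2 [g3 g4]]] := bdist_metric B.
have Hd1 : is_metric d1.
  split; [|split; [|split]] => *; rewrite /d1 //.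
  by rewrite g2; split => [/injh|->].
(* The inverse of [h], extended to all of [B] by the default value [m0]. *)
have [r Hr] : exists r : B -> M, forall k, K k -> h (r k) = k.
  apply: (choice (fun k m => K k -> h m = k)) => k.
  have [/hK [m Hm]|nK] := classic (K k); last by exists m0.
  by exists m.
have rh m : r (h m) = m by apply: injh; apply: Hr.
apply: (@fiberwise_kras_change X Y M f d1 Hd1 (banach_space B) h K r) => //.
- move=> u cu; have [b Hb] := @b_complete B _ cu.
  have Kb : K b.
    apply: NNPP => nK; have [e [e0 He]] := clK b nK.
    have [N HN] := Hb e e0; apply: (He (h (u N))) => //.
    by rewrite g3; apply: HN.
  by exists (r b); rewrite /d1 Hr.
- split.
  + by move=> m; exists (bnorm (h m)); exact: Rle_refl.
  + by move=> m m'; rewrite /= /d1 g3; exact: Rle_refl.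
  + exact: rh.
  + move=> b e Kb e0; exists (e / 2); split; first lra.
    move=> b' Kb' /= lt; rewrite /d1 !Hr // g3.
    by apply: Rle_lt_trans lt _; lra.
  + move=> m; exists 1; split; first lra.
    by move=> l wl _; apply: wavg_convex.
Qed.

Definition unit_valued {M : Type} (phi : M -> R) : Prop := forall m, 0 <= phi m <= 1.

Section UniformMetric.
Variable M : Type.

Lemma unif_lub (phi psi : {phi : M -> R | unit_valued phi}) :
  {s | is_lub (fun r => r = 0 \/ exists m, r = Rabs (proj1_sig phi m - proj1_sig psi m)) s}.
Proof.
apply: completeness; last by exists 0; left.
exists 1 => r [->|[m ->]]; first lra.
have := proj2_sig phi m; have := proj2_sig psi m; split_Rabs; lra.
Qed.

Definition unif_d phi psi : R := proj1_sig (unif_lub phi psi).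

Lemma unif_d_ge phi psi m : Rabs (proj1_sig phi m - proj1_sig psi m) <= unif_d phi psi.
Proof. by rewrite /unif_d; case: (unif_lub phi psi) => s [H _] /=; apply: H; right; exists m. Qed.

Lemma unif_d_ge0 phi psi : 0 <= unif_d phi psi.
Proof. by rewrite /unif_d; case: (unif_lub phi psi) => s [H _] /=; apply: H; left. Qed.

Lemma unif_d_le phi psi r : 0 <= r -> (forall m, Rabs (proj1_sig phi m - proj1_sig psi m) <= r) ->
  unif_d phi psi <= r.
Proof.
by move=> r0 Hr; rewrite /unif_d; case: (unif_lub phi psi) => s [_ H] /=; apply: H => t [->|[m ->]].
Qed.

Lemma unif_metric : is_metric unif_d.
Proof.
split; [|split; [|split]].
- exact: unif_d_ge0.
- move=> phi psi; split => [E|->].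
    have : proj1_sig phi = proj1_sig psi.
      apply: functional_extensionality => m; have := unif_d_ge phi psi m; rewrite E; split_Rabs; lra.
    case: phi psi {E} => [phi H] [psi H'] /= E; subst psi; congr (exist _ _ _); exact: proof_irrelevance.
  apply: Rle_antisym; last exact: unif_d_ge0.
  by apply: unif_d_le => [|m]; [lra | rewrite Rminus_diag Rabs_R0; lra].
- move=> phi psi; apply: Rle_antisym; apply: unif_d_le; try exact: unif_d_ge0.
    by move=> m; rewrite Rabs_minus_sym; exact: unif_d_ge.
  by move=> m; rewrite Rabs_minus_sym; exact: unif_d_ge.
- move=> x y z; apply: unif_d_le; first by have := unif_d_ge0 x y; have := unif_d_ge0 y z; lra.
  move=> m; have := unif_d_ge x y m; have := unif_d_ge y z m; split_Rabs; lra.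
Qed.

Definition UnitFun : MetricSpace := {| ms_d := unif_d; ms_metric := unif_metric |}.

Definition fun_space : bound_space.
Proof.
refine {| vec := M -> R; vzero := fun _ => 0; vadd := fun x y m => x m + y m; vscal := fun a x m => a * x m;
  nle := fun x r => forall m, Rabs (x m) <= r |}; try by move=> *; apply: functional_extensionality => m; ring.
- by move=> x r s H le m; apply: Rle_trans (H m) le.
- by move=> x y r s H H' m; have := H m; have := H' m; have := Rabs_triang (x m) (y m); lra.
- by move=> a x r H m; rewrite Rabs_mult; apply: Rmult_le_compat_l (H m); exact: Rabs_pos.
Defined.
End UniformMetric.

(* Kuratowski's embedding of a complete metric space into its bounded functions is closed, so that
   an absolute neighbourhood retract is a retract of one of its neighbourhoods there. *)
Lemma ANR_averaging (M : MetricSpace) (d1 : M -> M -> R) (Hd1 : is_metric d1) : inhabited M ->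
  (forall m m', d1 m m' <= 1) -> complete_metric d1 -> finer (@ms_d M) d1 -> finer d1 (@ms_d M) -> ANR M ->
  exists D r, @averaging {| ms_d := d1; ms_metric := Hd1 |} (fun_space M) d1 D r.
Proof.
move=> [m0] le1 comp fin fin' anr.
pose M1 := {| ms_d := d1; ms_metric := Hd1 |}.
have tri (a b c : M) : d1 a c <= d1 a b + d1 b c := @ms_tri M1 b a c.
have sym (a b : M) : d1 a b = d1 b a := @ms_sym M1 a b.
have refl (a : M) : d1 a a = 0 := @ms_refl M1 a.
have unit_d m : unit_valued (d1 m) by move=> m'; split; [exact: (@ms_ge0 M1) | exact: le1].
pose e m : UnitFun M := exist _ (d1 m) (unit_d m).
have e_iso m m' : ms_d (e m) (e m') = d1 m m'.
  apply: Rle_antisym.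
    apply: unif_d_le; first exact: (@ms_ge0 M1).
    move=> m'' /=; have := tri m m' m''; have := tri m' m m''; rewrite (sym m' m); split_Rabs; lra.
  have := unif_d_ge (e m) (e m') m'; rewrite /= refl Rminus_0_r Rabs_right //.
  by apply: Rle_ge; exact: (@ms_ge0 M1).
pose A (z : UnitFun M) := exists m, z = e m.
have [phi Hphi] : exists phi : {z | A z} -> M, forall a, proj1_sig a = e (phi a).
  by apply: (choice (fun (a : {z | A z}) m => proj1_sig a = e m)) => -[z [m Hm]]; exists m.
have closedA : closed_set (@ms_d (UnitFun M)) A.
  move=> z nA; apply: NNPP => no; apply: nA.
  have [u Hu] : exists u : nat -> M, forall j, ms_d z (e (u j)) < inv_succ j.
    apply: (choice (fun j m => ms_d z (e m) < inv_succ j)) => j; apply: NNPP => nm; apply: no.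
    exists (inv_succ j); split; first exact: inv_succ_pos.
    by move=> z' zz' [m Em]; apply: nm; exists m; rewrite -Em.
  have [|m Hm] := comp u.
    move=> eps eps0; have eps2 : 0 < eps / 2 by lra.
    have [N HN] := inv_succ_small eps2; exists N => n n' /HN h /HN h'.
    rewrite -e_iso; have := Hu n; have := Hu n'; have := ms_tri z (e (u n)) (e (u n')).
    by rewrite (ms_sym (e (u n)) z); lra.
  exists m; apply: (ulim_uniq (ulim_inv_succ Hu)) => eps /Hm [N HN].
  by apply: ufW (uf_ge N) => j /HN; rewrite e_iso sym.
have cphi : @continuous_on_sub (UnitFun M) M A phi.
  move=> a eps /(fin' (phi a)) [dl [dl0 Hdl]]; exists dl; split => // b; rewrite !Hphi e_iso; exact: Hdl.
have [U [psi [oU [AU [cpsi ext]]]]] := anr _ A phi closedA cphi.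
(* The neighbourhood [U] lives among the functions with values in the unit interval, whereas
   averages are formed among all functions; [D] is [U] seen in the larger space. *)
pose D (x : M -> R) := exists H : unit_valued x, U (exist _ x H).
have [r Hr] : exists r : (M -> R) -> M, forall x (H : unit_valued x) (u : U (exist _ x H)), r x = psi (exist _ _ u).
  apply: (choice (fun x m => forall (H : unit_valued x) (u : U (exist _ x H)), m = psi (exist _ _ u))) => x.
  have [[H u]|nD] := classic (D x); last by exists m0 => H u; case: nD; exists H.
  exists (psi (exist _ _ u)) => H' u'; have EH : H = H' by exact: proof_irrelevance.
  by subst H'; congr (psi (exist _ _ _)); exact: proof_irrelevance.
have lip (m m' : M1) : @nle (fun_space M) (vsub (d1 m' : fun_space M) (d1 m : fun_space M)) (ms_d m m').
  move=> p /=; have := tri m m' p; have := tri m' m p; rewrite (sym m' m); split_Rabs; lra.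
exists D, r; split.
- by move=> m; exists 1 => p; have := unit_d m p; split_Rabs; lra.
- exact: lip.
- move=> m; have u : U (e m) by apply: AU; exists m.
  have Aem : A (e m) by exists m.
  rewrite (Hr (d1 m) (unit_d m) u) (ext (e m) Aem u).
  have : e m = e (phi (exist _ (e m) Aem)) by exact: Hphi (exist _ (e m) Aem).
  by move=> /(f_equal (fun z => ms_d z (e m))); rewrite ms_refl e_iso => E; apply: (@ms_eq M1).
- move=> b eps [H u] eps0; have [eps' [eps'0 Heps']] := fin (psi (exist _ _ u)) eps eps0.
  have [dl [dl0 Hdl]] := cpsi (exist _ _ u) eps' eps'0.
  exists (dl / 2); split; first lra.
  move=> b' [H' u'] near; rewrite (Hr _ _ u) (Hr _ _ u') /=; apply: Heps'; apply: Hdl => /=.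
  apply: (Rle_lt_trans _ (dl / 2)); last lra.
  apply: unif_d_le => [|p /=]; first lra.
  have := near p; rewrite /= => h; rewrite Rabs_minus_sym.
  by have -> : b' p - b p = b' p + -1 * b p by [ring].
- move=> m; have u : U (e m) by apply: AU; exists m.
  have [rho [rho0 Hrho]] := oU (e m) u; exists (rho / 2); split; first lra.
  move=> l wl cl.
  have H : unit_valued (wavg (V := fun_space M) (M := M1) d1 l).
    apply: (@wavg_convex M1 (fun_space M) d1 unit_valued) wl => // x y t Hx Hy t01 p /=.
    by have := Hx p; have := Hy p; nra.
  exists H; apply: Hrho; apply: (Rle_lt_trans _ (rho / 2)); last lra.
  have rh2 : 0 <= rho / 2 by lra.
  have near := @wavg_near M1 (fun_space M) d1 m (rho / 2) l lip rh2 wl cl.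
  apply: unif_d_le => // p /=; rewrite Rabs_minus_sym; have := near p => /= h.
  by have -> : wavg (V := fun_space M) (M := M1) d1 l p - d1 m p =
    wavg (V := fun_space M) (M := M1) d1 l p + -1 * d1 m p by [ring].
Qed.

Lemma fiberwise_kras_ANR (X Y M : MetricSpace) (f : X -> Y) : perfect_map f -> kras_space M ->
  complete_ANR M -> fiberwise_kras_dense_Gdelta M f.
Proof.
move=> Hf kM [anr [d' [Hd' [same comp]]]].
have [inh|nM] := classic (inhabited M); last exact: fiberwise_kras_empty.
pose M' := {| ms_d := d'; ms_metric := Hd' |}.
(* Truncation at 1 keeps the topology and completeness and gives the Kuratowski embedding values in
   the unit interval. *)
pose d1 m m' := Rmin 1 (d' m m').
have d'0 (a b : M) : 0 <= d' a b := @ms_ge0 M' a b.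
have refl (a : M) : d' a a = 0 := @ms_refl M' a.
have sym (a b : M) : d' a b = d' b a := @ms_sym M' a b.
have Hd1 : is_metric d1.
  split; [|split; [|split]].
  - by move=> x y; apply: Rmin_glb; [lra | exact: d'0].
  - move=> x y; rewrite /d1; split => [E|->].
      by apply: (@ms_eq M'); move: E; rewrite /= /Rmin; case: Rle_dec; lra.
    by rewrite refl Rmin_right; lra.
  - by move=> x y; rewrite /d1 (sym x y).
  - move=> x y z; have := @ms_tri M' y x z; have := d'0 x y; have := d'0 y z.
    by rewrite /d1 /= /Rmin; do 3 case: Rle_dec => ?; lra.
have d1_le m m' : d1 m m' <= d' m m' by exact: Rmin_r.
have d1_small m m' e : e <= 1 -> d1 m m' < e -> d' m m' < e.
  by rewrite /d1 /Rmin; case: Rle_dec => ?; lra.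
have fin : finer (@ms_d M) d1.
  move=> m e e0; have /same oB := @open_ball M' m e.
  have [|dl [dl0 Hdl]] := oB m; first by rewrite /= refl.
  by exists dl; split => // m' /Hdl /= h; have := d1_le m m'; lra.
have fin' : finer d1 (@ms_d M).
  move=> m e e0; have /same oB := @open_ball M m e.
  have [|dl [dl0 Hdl]] := oB m; first by rewrite ms_refl.
  exists (Rmin 1 dl); split; first by apply: Rmin_glb_lt; lra.
  move=> m' lt; apply: Hdl; have := Rmin_r 1 dl.
  by have := d1_small m m' (Rmin 1 dl) (Rmin_l _ _) lt; lra.
have comp1 : complete_metric d1.
  move=> u cu; have [|l Hl] := comp u.
    move=> e e0; have [|N HN] := cu (Rmin 1 e); first by apply: Rmin_glb_lt; lra.
    exists N => n m nN mN; have := d1_small _ _ (Rmin 1 e) (Rmin_l _ _) (HN n m nN mN).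
    by have := Rmin_r 1 e; lra.
  by exists l => e /Hl [N HN]; exists N => n /HN h; have := d1_le (u n) l; lra.
have [D [r Av]] := ANR_averaging Hd1 inh (fun m m' => Rmin_l _ _) comp1 fin fin' anr.
exact: (fiberwise_kras_change Hf fin fin' kM comp1 Av).
Qed.

Theorem theorem1p1 (X Y M : MetricSpace) (f : X -> Y) (Hf : perfect_map f) :
  (kras_space M -> complete_ANR M -> strongly_countable_dimensional (@ms_d Y) ->
     fiberwise_kras_dense_Gdelta M f) /\
  (kras_space M -> homeo_closed_convex_Banach M -> C_space (@ms_d Y) ->
     fiberwise_kras_dense_Gdelta M f).
Proof.
split=> kM HM _; [exact: fiberwise_kras_ANR | exact: fiberwise_kras_convex].
Qed.
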